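(* Let $G^\theta$ be the additive residual process for every $\theta\in\Theta$ and assume the following. (Boundedness) There exist constants $C,C'>0$ such that for every $\theta\in\Theta$: the $\mathcal G_t^\theta$-intensity $\boldsymbol\lambda^\theta$ of $N^\theta$ is càglàd with $\sup_{0\le t\le 1}\boldsymbol\lambda_t^\theta\le C$ almost surely; the residual process $G^\theta$ is càglàd with $\sup_{0\le t\le 1}|G_t^\theta|\le C'$ almost surely; and the estimators satisfy the same bounds, $\sup_t|\hat\lambda_t^{(n),\theta}|\le C$ and $\sup_t|\hat G_t^{(n),\theta}|\le C'$ almost surely. (Rates) $|J_n|\to\infty$ as $n\to\infty$, and with $g^\theta(n)=\||G^\theta-\hat G^{(n),\theta}\||_2$ and $h^\theta(n)=\||\lambda^\theta-\hat\lambda^{(n),\theta}\||_2$, $$\lim_{n\to\infty}\sup_{\theta\in\Theta}\max\{g^\theta(n),\,h^\theta(n),\,\sqrt{|J_n|}\,g^\theta(n)h^\theta(n)\}=0 .$$ Then for any $0<\alpha<\beta<1$ there exists $c>0$ such that $$\liminf_{n\to\infty}\inf_{\theta\in\mathcal A_{c,n}}\mathbb P(\Psi_n^{\alpha,\theta}=1)\ge\beta,\qquad\text{where }\mathcal A_{c,n}=\{\theta\in\Theta:\|\gamma^\theta\|_\infty\ge c\,|J_n|^{-1/2}\}.$$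
   Context: Setting. $\Theta$ is an arbitrary set indexing sampling distributions; every object below depends on $\theta\in\Theta$, with the superscript $\theta$ often suppressed. Time is $[0,1]$. $N$ is a counting process adapted to a right-continuous complete filtration $\mathcal F_t$; $X$ is a real-valued càglàd process; $\mathcal G_t$ is the right-continuous complete filtration generated by $\mathcal F_t$ and $X_t$. $N$ has an $\mathcal F_t$-intensity $\lambda$ (i.e. $\lambda$ is $\mathcal F_t$-predictable and $M_t=N_t-\int_0^t\lambda_s\,ds$ is a local $\mathcal F_t$-martingale) and a $\mathcal G_t$-intensity $\boldsymbol\lambda$. The additive residual process is $G_t=X_t-\Pi_t$, where $\Pi_t=E(X_t\mid\mathcal F_{t-})$ is the predictable projection. The Local Covariance Measure is $\gamma_t=E\int_0^tG_s\,dM_s$; $\|\cdot\|_\infty$ is the supremum norm on $[0,1]$. Data and estimators. $(N_j,X_j,\mathcal F_j)$, $j=1,\dots,n$, are i.i.d. replications of $(N,X,\mathcal F)$. $J_n\cup J_n^c=\{1,\dots,n\}$ is a partition into two disjoint sets. The estimates $\hat\lambda^{(n)}$ of $\lambda$ and $\hat\Pi^{(n)}$ of $\Pi$ are fitted on data indexed by $J_n^c$ only; given those data they are fixed maps evaluated on the $\mathcal F$-history of a new observation, yielding (conditionally on the training data) $\mathcal F_t$-predictable processes, and $\hat G^{(n)}_t=X_t-\hat\Pi^{(n)}_t$. $\hat\lambda_j^{(n)},\hat G_j^{(n)}$ are the evaluations on observation $j\in J_n$; $\hat\lambda_t^{(n)},\hat G_t^{(n)}$ are the evaluations on one additional copy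 $(N,X,\mathcal F)$ independent of the data. With $\hat M_{j,t}^{(n)}=N_{j,t}-\int_0^t\hat\lambda_{j,s}^{(n)}ds$, set $$\hat\gamma_t^{(n)}=\frac1{|J_n|}\sum_{j\in J_n}\int_0^t\hat G_{j,s}^{(n)}\,d\hat M_{j,s}^{(n)},\qquad \hat{\mathcal V}_n(t)=\frac1{|J_n|}\sum_{j\in J_n}\int_0^t(\hat G_{j,s}^{(n)})^2\,dN_{j,s}.$$ For a process $W$ on $[0,1]$, $\||W\||_2^2=E\int_0^1W_s^2\,ds$. Test. $\hat T_n=\dfrac{\sqrt{|J_n|}}{\sqrt{\hat{\mathcal V}_n(1)}}\sup_{0\le t\le1}|\hat\gamma_t^{(n)}|$ (with $x/0=\infty$ for $x>0$ and $0/0=0$). $z_{1-\alpha}$ is the $(1-\alpha)$-quantile of $S=\sup_{0\le t\le1}|B_t|$, $B$ a standard Brownian motion. The Local Covariance Test with significance level $\alpha$ is $\Psi_n^\alpha=1$ if $\hat T_n>z_{1-\alpha}$ and $\Psi_n^\alpha=0$ otherwise. An infimum of probabilities over the empty set is read as $1$. *)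

(* Defs.v *)
From HB Require Import structures.
From mathcomp Require Export all_boot all_order all_algebra.
From mathcomp Require Export all_classical all_reals all_analysis.

Set Implicit Arguments.
Unset Strict Implicit.
Unset Printing Implicit Defensive.

Import Order.TTheory GRing.Theory Num.Theory.
Import numFieldNormedType.Exports.

Local Open Scope classical_set_scope.
Local Open Scope ring_scope.

(* A real process is a function [R -> T -> R]; only its values at times in
   [0, 1] are ever used. *)

Section paths.
Context {R : realType}.
Implicit Types (f : R -> R) (n : R -> nat).

Definition caglad f : Prop :=
  (forall t, 0 < t <= 1 -> f u @[u --> t^'-] --> f t) /\
  (forall t, 0 <= t < 1 -> cvg (f u @[u --> t^'+])).

Definition jump f (t : R) : R := f t - lim (f u @[u --> t^'-]).

Definition counting_path n : Prop :=
  [/\ n 0 = 0%N,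
      (forall s t, 0 <= s -> s <= t -> t <= 1 -> (n s <= n t)%N),
      (forall t, 0 <= t < 1 ->
        ((n u)%:R : R) @[u --> t^'+] --> ((n t)%:R : R)) &
      (forall t, 0 < t <= 1 -> jump (fun u => (n u)%:R) t <= 1)].

(* The integral over (0, t] against a counting path is the sum over its
   (finitely many) jump times. *)
Definition int_dN (h : R -> R) n (t : R) : R :=
  \sum_(s \in `]0, t]) h s * jump (fun u => (n u)%:R) s.

Definition int_ds (h : R -> R) (t : R) : R :=
  \int[lebesgue_measure]_(s in `[0, t]) h s.

(* Integral against d(n_s - l_s ds). *)
Definition int_dM (h : R -> R) n (l : R -> R) (t : R) : R :=
  int_dN h n t - int_ds (fun s => h s * l s) t.

End paths.

Section filtrations.
Context {R : realType} {d : measure_display} {T : measurableType d}.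
Variable P : probability T R.
Implicit Types (F : R -> set (set T)) (H : R -> T -> R).

Definition measurable_wrt (E : set (set T)) (f : T -> R) : Prop :=
  forall B : set R, measurable B -> E (f @^-1` B).

Definition adapted F H : Prop :=
  forall t, 0 <= t <= 1 -> measurable_wrt (F t) (H t).

Definition is_filtration F : Prop :=
  (forall t, 0 <= t <= 1 ->
     sigma_algebra [set: T] (F t) /\ F t `<=` measurable) /\
  (forall s t, 0 <= s -> s <= t -> t <= 1 -> F s `<=` F t).

Definition right_continuous F : Prop :=
  forall t, 0 <= t < 1 -> \bigcap_(s in `]t, 1]) F s `<=` F t.

Definition complete_filtration F : Prop := P.-negligible `<=` F 0.

(* The right-continuous filtration generated by F and X; it is complete as
   soon as F is, and at t = 1 the intersection reduces to s = 1. *)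
Definition enlarged_filtration F H (t : R) : set (set T) :=
  \bigcap_(s in [set s : R | t < s <= 1 \/ s = 1])
    <<s F s `|` [set A | exists u (B : set R),
                   [/\ 0 <= u <= s, measurable B & A = H u @^-1` B]] >>.

(* F_{t-}, with the usual convention F_{0-} = F_0. *)
Definition left_filtration F (t : R) : set (set T) :=
  <<s F 0 `|` \bigcup_(s in [set s : R | 0 <= s < t]) F s >>.

Definition predictable_rectangles F : set (set (R * T)) :=
  [set [set 0] `*` A | A in F 0] `|`
  [set Q | exists s t A, [/\ 0 <= s, s < t, t <= 1, F s A & Q = `]s, t] `*` A]].

Definition predictable F H : Prop :=
  forall B : set R, measurable B ->
    <<s `[0, 1] `*` [set: T], predictable_rectangles F >>
      ((`[0, 1] `*` [set: T]) `&` [set p | B (H p.1 p.2)]).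

Definition is_condexp (E : set (set T)) (f g : T -> R) : Prop :=
  [/\ P.-integrable [set: T] (EFin \o f),
      P.-integrable [set: T] (EFin \o g),
      measurable_wrt E g &
      forall A, E A ->
        (\int[P]_(w in A) (f w)%:E = \int[P]_(w in A) (g w)%:E)%E].

Definition predictable_projection F H (K : R -> T -> R) : Prop :=
  predictable F K /\
  (forall t, 0 <= t <= 1 -> is_condexp (left_filtration F t) (H t) (K t)).

Definition martingale F H : Prop :=
  adapted F H /\
  (forall s t, 0 <= s -> s <= t -> t <= 1 -> is_condexp (F s) (H t) (H s)).

Definition stopping_time F (tau : T -> R) : Prop :=
  (forall w, 0 <= tau w) /\
  (forall t, 0 <= t <= 1 -> F t [set w | tau w <= t]).

(* As time is the closed interval [0, 1], a localizing sequence has to reach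
   the end point 1 almost surely. *)
Definition local_martingale F H : Prop :=
  exists tau : nat -> T -> R,
    [/\ (forall k, stopping_time F (tau k)),
        {ae P, forall w, forall k, tau k w <= tau k.+1 w},
        {ae P, forall w, exists k, 1 <= tau k w} &
        forall k, martingale F (fun t w => H (Num.min t (tau k w)) w)].

Definition is_intensity F (N : R -> T -> nat) (l : R -> T -> R) : Prop :=
  [/\ predictable F l,
      {ae P, forall w,
         lebesgue_measure.-integrable `[0, 1] (fun s : R => (l s w)%:E)} &
      local_martingale F (fun t w => (N t w)%:R - int_ds (l ^~ w) t)].

Definition norm2 (W : R -> T -> R) : \bar R :=
  ((\int[P]_w \int[lebesgue_measure]_(s in `[0%R, 1%R]) ((W s w) ^+ 2)%:E)
     `^ 2^-1)%E.

End filtrations.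

Section brownian.
Context {R : realType}.

Definition independent_family {d d' : measure_display}
    {T : measurableType d} {T' : measurableType d'} (P : probability T R)
    (I : choiceType) (Y : I -> T -> T') : Prop :=
  forall (s : seq I) (A : I -> set T'), uniq s -> (forall i, measurable (A i)) ->
    P (\bigcap_(i in [set` s]) (Y i @^-1` A i)) =
    (\prod_(i <- s) fine (P (Y i @^-1` A i)))%:E.

Definition standard_brownian {d : measure_display} {T : measurableType d}
    (P : probability T R) (B : R -> T -> R) : Prop :=
  [/\ (forall t, 0 <= t <= 1 -> measurable_fun [set: T] (B t)),
      (forall w, B 0 w = 0 /\ {within `[0, 1], continuous (B ^~ w)}),
      (forall s t, 0 <= s -> s < t -> t <= 1 -> forall A : set R, measurable A ->
         P [set w | A (B t w - B s w)] = normal_prob 0 (Num.sqrt (t - s)) A) &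
      (forall (k : nat) (t : nat -> R),
         (forall i, (i < k)%N -> t i <= t i.+1) ->
         0 <= t 0%N -> t k <= 1 ->
         independent_family P (fun (i : 'I_k) w => B (t i.+1) w - B (t i) w))].

Definition quantile {d : measure_display} {T : measurableType d}
    (P : probability T R) (S : T -> \bar R) (p : R) : R :=
  inf [set x : R | (p%:E <= P [set w | (S w <= x%:E)%E])%E].

Definition sup01 (f : R -> \bar R) : \bar R :=
  ereal_sup [set `|f t|%E | t in `[0, 1]].

Definition brownian_sup_quantile {d : measure_display} {T : measurableType d}
    (P : probability T R) (B : R -> T -> R) (p : R) : R :=
  quantile P (fun w => sup01 (fun t => (B t w)%:E)) p.

End brownian.

(* The distribution of one observation (N, X, F), together with the
   intensities and the predictable projection. *)
Record obs_model (R : realType) (d : measure_display) := ObsModel {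
  space : measurableType d;
  prob : probability space R;
  filt : R -> set (set space);
  cnt : R -> space -> nat;
  cov : R -> space -> R;
  intens : R -> space -> R;       (* F_t-intensity lambda *)
  full_intens : R -> space -> R;  (* G_t-intensity boldsymbol lambda *)
  proj : R -> space -> R }.       (* predictable projection Pi of X *)

Arguments prob {R d} o.
Arguments filt {R d} o t.
Arguments cnt {R d} o t w.
Arguments cov {R d} o t w.
Arguments intens {R d} o t w.
Arguments full_intens {R d} o t w.
Arguments proj {R d} o t w.

Section model.
Context {R : realType} {d : measure_display}.
Variable M : obs_model R d.

Definition obs_model_ok : Prop :=
  [/\ is_filtration (filt M) /\
        right_continuous (filt M) /\ complete_filtration (prob M) (filt M),
      (forall w, counting_path (cnt M ^~ w)) /\
        adapted (filt M) (fun t w => (cnt M t w)%:R),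
      (forall w, caglad (cov M ^~ w)) /\
        (forall t, 0 <= t <= 1 -> measurable_fun [set: space M] (cov M t)),
      is_intensity (prob M) (filt M) (cnt M) (intens M) /\
        is_intensity (prob M) (enlarged_filtration (filt M) (cov M))
          (cnt M) (full_intens M) &
      predictable_projection (prob M) (filt M) (cov M) (proj M)].

Definition residual (t : R) (w : space M) : R := cov M t w - proj M t w.

Definition LCM (t : R) : \bar R :=
  ('E_(prob M)[fun w => int_dM (residual ^~ w) (cnt M ^~ w) (intens M ^~ w) t])%E.

End model.

Arguments residual {R d} M t w.
Arguments LCM {R d} M t.

(* An i.i.d. sample, given by random elements of the space of one observation:
   the j-th replication of (N, X, F) consists of N o obs j, X o obs j and the
   inverse image of F under obs j.  The estimators are functions of the
   training data and of a new observation. *)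
Record sampling (R : realType) (d d' : measure_display) (M : obs_model R d)
    (J : forall n, {set 'I_n}) := Sampling {
  sspace : measurableType d';
  sprob : probability sspace R;
  obs : nat -> sspace -> space M;
  newobs : sspace -> space M;
  lhat : forall n, (#|~: J n|).-tuple (space M) -> R -> space M -> R;
  Pihat : forall n, (#|~: J n|).-tuple (space M) -> R -> space M -> R }.

Arguments sprob {R d d' M J} s.
Arguments obs {R d d' M J} s j w.
Arguments newobs {R d d' M J} s w.
Arguments lhat {R d d' M J} s n D t x : rename.
Arguments Pihat {R d d' M J} s n D t x : rename.

Section test.
Context {R : realType} {d d' : measure_display}.
Variables (M : obs_model R d) (J : forall n, {set 'I_n}).
Variable S : sampling d' M J.

Definition all_obs (o : option nat) : sspace S -> space M :=
  if o is Some j then obs S j else newobs S.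

Definition iid_copies : Prop :=
  [/\ (forall o, measurable_fun [set: sspace S] (all_obs o)),
      (forall o A, measurable A -> sprob S (all_obs o @^-1` A) = prob M A) &
      independent_family (sprob S) all_obs].

Definition estimator_ok (k : nat) (h : k.-tuple (space M) -> R -> space M -> R) :=
  measurable_fun [set q : k.-tuple (space M) * (R * space M) | 0 <= q.2.1 <= 1]
    (fun q => h q.1 q.2.1 q.2.2) /\
  (forall D, predictable (filt M) (h D)).

Definition sampling_ok : Prop :=
  [/\ measure_is_complete (sprob S),
      iid_copies &
      forall n, estimator_ok (lhat S n) /\
                estimator_ok (Pihat S n)].

Definition train n (w : sspace S) : (#|~: J n|).-tuple (space M) :=
  [tuple obs S (enum_val i) w | i < #|~: J n|].

Definition Ghat n (D : (#|~: J n|).-tuple (space M)) (t : R) (x : space M) : R :=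
  cov M t x - Pihat S n D t x.

Definition lhat_new n (t : R) (w : sspace S) : R :=
  lhat S n (train n w) t (newobs S w).
Definition Ghat_new n (t : R) (w : sspace S) : R :=
  Ghat (train n w) t (newobs S w).

Definition lhat_at n (j : 'I_n) (t : R) (w : sspace S) : R :=
  lhat S n (train n w) t (obs S j w).
Definition Ghat_at n (j : 'I_n) (t : R) (w : sspace S) : R :=
  Ghat (train n w) t (obs S j w).

Definition g_err n : \bar R :=
  norm2 (sprob S) (fun t w => residual M t (newobs S w) - Ghat_new n t w).
Definition h_err n : \bar R :=
  norm2 (sprob S) (fun t w => intens M t (newobs S w) - lhat_new n t w).

Definition gamma_hat n (t : R) (w : sspace S) : R :=
  (#|J n|)%:R^-1 * \sum_(j in J n)
    int_dM (Ghat_at j ^~ w) (fun s => cnt M s (obs S j w)) (lhat_at j ^~ w) t.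

Definition V_hat n (t : R) (w : sspace S) : R :=
  (#|J n|)%:R^-1 * \sum_(j in J n)
    int_dN (fun s => Ghat_at j s w ^+ 2) (fun s => cnt M s (obs S j w)) t.

(* The test statistic, with x / 0 = +oo for x > 0 and 0 / 0 = 0. *)
Definition T_hat n (w : sspace S) : \bar R :=
  let x := ((Num.sqrt (#|J n|)%:R)%:E * sup01 (fun t => (gamma_hat n t w)%:E))%E in
  if V_hat n 1 w == 0 then (if x == 0%E then 0%E else +oo%E)
  else (x * ((Num.sqrt (V_hat n 1 w))^-1)%:E)%E.

Definition LCT n (z : R) (w : sspace S) : bool := (z%:E < T_hat n w)%E.

End test.

Arguments lhat_new {R d d' M J} S n t w.
Arguments Ghat_new {R d d' M J} S n t w.
Arguments g_err {R d d' M J} S n.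
Arguments h_err {R d d' M J} S n.
Arguments T_hat {R d d' M J} S n w.
Arguments LCT {R d d' M J} S n z w.

(* Main.v *)
(* Fix t with |gamma_t| > (c - 1) |J_n|^(-1/2).  Conditionally on the training
   data D, the estimate gamma_hat_t is the mean of |J_n| independent copies of a
   variable with mean m(D) and second moment bounded uniformly in theta, so
   gamma_hat_t - m(D) is of order |J_n|^(-1/2) by Chebyshev.  The intensity
   compensates N on predictable integrands and the residual process is
   orthogonal to them, so the conditional bias m(D) - gamma_t is the expected
   integral over (0, t] of (Pi - Pi_hat) (lambda - lambda_hat), and Hoelder's
   inequality bounds its mean by the product of the two rates.  Finally
   V_hat_n(1) has bounded mean.  By Markov's inequality, for c large the event
   sqrt |J_n| |gamma_hat_t| > (|z| + 1) sqrt K, V_hat_n(1) < K has probability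
   at least beta, and on it the test rejects. *)
From HB Require Import structures.
Require Import Defs.
From mathcomp Require Import measurable_realfun ring lra zify.
From mathcomp Require finmap.

Import Order.TTheory GRing.Theory Num.Theory.
Import numFieldNormedType.Exports.
Local Open Scope classical_set_scope.
Local Open Scope ring_scope.

Set Implicit Arguments.
Unset Strict Implicit.
Unset Printing Implicit Defensive.

(** * Lebesgue measure on the unit interval *)

(** Three obstacles shape the proof. The process [N] minus its compensator is only a local
    martingale, and a bound is assumed only for the intensity relative to the larger filtration.
    Fatou's lemma in that filtration yields the moments of [N], while the integrability of [intens]
    is drawn from the finite error [h_err] and the bounded [lhat]. Next, integrals against [dN] are
    pathwise finite sums; to compute their expectations, [dN] is viewed as a measure on pairs (rank
    of a jump, outcome), and identities between expected integrals are checked on predictable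
    rectangles, then extended by a Dynkin argument and by simple functions. Finally, the bounds on
    the estimators are almost sure statements about the new observation. They pass to almost every
    fixed value of the training data, and to the observations of [J n], because the joint law with
    the training data is in both cases the same product measure. *)

Section unit_lebesgue.
Context {R : realType}.

Let idTR : measurableTypeR R -> R := idfun.

#[local] HB.instance Definition _ :=
  @isMeasurableFun.Build _ _ _ _ idTR (@measurable_id _ _ setT).

(* The library's [lebesgue_measure] lives on [measurableTypeR R], whose display
   differs from the one of [R]. *)
Definition unit_lebesgue : probability R R :=
  distribution (uniform_prob (@ltr01 R)) (idTR : {mfun _ >-> _}).

Lemma ge0_integral_unit_lebesgue (f : R -> \bar R) :
  measurable_fun [set: R] f -> (forall x, 0 <= f x)%E ->
  (\int[unit_lebesgue]_x f x = \int[lebesgue_measure]_(x in `[0%R, 1%R]) f x)%E.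
Proof.
move=> mf f0; rewrite ge0_integral_distribution//.
by rewrite integral_uniform// subr0 invr1 mul1e.
Qed.

Lemma integral_unit_lebesgue (f : R -> \bar R) : measurable_fun [set: R] f ->
  (\int[unit_lebesgue]_x f x = \int[lebesgue_measure]_(x in `[0%R, 1%R]) f x)%E.
Proof.
move=> mf; rewrite integralE [RHS]integralE.
rewrite ge0_integral_unit_lebesgue; [|exact: measurable_funepos|by []].
by rewrite ge0_integral_unit_lebesgue; [|exact: measurable_funeneg|by []].
Qed.

Lemma unit_lebesgue_set1 (x : R) : unit_lebesgue [set x] = 0%E.
Proof.
have := @integral_indic _ _ _ unit_lebesgue setT measurableT [set x] (measurable_set1 x).
rewrite setIT => <-; rewrite ge0_integral_unit_lebesgue//.
  rewrite integral_indic//; apply/eqP; rewrite eq_le measure_ge0 andbT.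
  rewrite -(lebesgue_measure_set1 x); apply: le_measure => //; rewrite ?inE.
  - by apply: measurableI => //; exact: measurable_set1.
  - exact: measurable_set1.
by apply/measurable_EFinP/measurable_indic.
Qed.

End unit_lebesgue.

(** * Jump times and integrals against counting paths *)

Section jump_times.
Context {R : realType}.
Implicit Types (n : R -> nat) (h : R -> R).

(* The value 2, outside of the time interval, stands for a jump that does not
   occur. *)
Definition jump_time n (k : nat) : R :=
  if (k <= n 1%R)%N then inf [set t | 0 <= t <= 1 /\ (k <= n t)%N] else 2.

Lemma jump_time_ge0 n k : 0 <= jump_time n k.
Proof.
rewrite /jump_time; case: ifP => // kn.
by apply: lb_le_inf; [exists 1 => /=; rewrite ler01 lexx | move=> t /= [/andP[]]].
Qed.

(** Right continuity makes the infimum attained. This equivalence replaces the infimum nearly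
    everywhere below: it reduces events about jump times to events about the values of [n]. *)
Lemma jump_time_le n k t : counting_path n -> 0 <= t <= 1 ->
  (jump_time n k <= t) = (k <= n t)%N.
Proof.
move=> [n0 nmono nr _] /andP[t0 t1]; apply/idP/idP; last first.
  move=> kn; rewrite /jump_time (leq_trans kn (nmono _ _ t0 t1 (lexx _))).
  apply: ge_inf; first by exists 0 => x /= [/andP[]].
  by split => //; rewrite t0 t1.
rewrite /jump_time; case: ifP => kn1; last first.
  by move=> /le_trans/(_ t1); rewrite leNgt ltr1n.
move=> Ht; rewrite leqNgt; apply/negP => nk.
have tlt : t < 1.
  by rewrite lt_neqAle t1 andbT; apply/eqP => t1'; rewrite t1' ltnNge kn1 in nk.
have /nr/cvgrPdist_lt/(_ 1 ltr01) : 0 <= t < 1 by rewrite t0 tlt.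
rewrite near_withinE => -[e /= e0 He].
(* The path keeps a value below [k] slightly to the right of [t], so the infimum would exceed [t] by
   a positive amount. *)
suff : t + Num.min (e / 2) (1 - t) <= t.
  by rewrite gerDl leNgt lt_min subr_gt0 tlt divr_gt0.
apply: le_trans Ht; apply: lb_le_inf; first by exists 1 => /=; rewrite ler01 lexx.
move=> x /= [/andP[x0 x1] kx]; rewrite leNgt; apply/negP => xt.
have ltx : t < x.
  rewrite ltNge; apply/negP => xt'.
  by have := leq_trans kx (nmono _ _ x0 xt' t1); rewrite leqNgt nk.
have : `|t - x| < e.
  rewrite ltr0_norm ?subr_lt0// opprB ltrBlDl (lt_le_trans xt)// lerD2l.
  by rewrite (@le_trans _ _ (e / 2)) ?ge_min ?lexx// ler_pdivrMr// ler_peMr// ?ler1n// ltW.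
move=> /He /(_ ltx).
have nle := nmono _ _ t0 (ltW ltx) x1.
rewrite distrC ger0_norm ?subr_ge0 ?ler_nat// -natrB// ltrn1 ltnS leqn0 subn_eq0 => /(leq_trans kx).
by rewrite leqNgt nk.
Qed.

Lemma jump_time_gt0 n k : counting_path n -> (0 < k)%N -> 0 < jump_time n k.
Proof.
move=> cn k0; rewrite ltNge jump_time_le// ?lexx ?ler01//.
by case: cn => -> _ _ _; rewrite leqn0 -lt0n.
Qed.

(** A monotone path with values in the natural numbers is constant just before [s]; [m] is the
    largest value it takes there, hence the left limit. *)
Lemma counting_path_left n s : counting_path n -> 0 < s <= 1 ->
  exists m u0, [/\ 0 <= u0 < s, forall u, u0 <= u < s -> n u = m &
    jump (fun u => (n u)%:R : R) s = (n s)%:R - m%:R].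
Proof.
move=> [n0 nmono nr _] /andP[s0 s1].
pose P m := `[< exists u, 0 <= u < s /\ n u = m >].
have Pex : exists m, P m by exists 0%N; apply/asboolP; exists 0; rewrite lexx s0.
have Pub m : P m -> (m <= n s)%N.
  by move=> /asboolP[u [/andP[u0 us] <-]]; apply: nmono => //; exact: ltW.
case: (ex_maxnP Pex Pub) => m /asboolP[u0 [/andP[u00 u0s] nu0]] mmax.
exists m, u0; split => [|u /andP[uu us]|]; first by rewrite u00 u0s.
- apply/eqP; rewrite eqn_leq -{2}nu0 nmono// ?andbT ?(le_trans (ltW us))//.
  by apply: mmax; apply/asboolP; exists u; rewrite us (le_trans u00 uu).
- rewrite /jump; congr (_ - _); apply: cvg_lim => //.
  apply: cvg_near_cst; near=> u; congr (_%:R).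
  have u0u : u0 <= u by near: u; exact: nbhs_left_ge.
  have us : u < s by near: u; exact: nbhs_left_lt.
  apply/eqP; rewrite eqn_leq -{2}nu0 nmono// ?andbT ?(le_trans (ltW us))//.
  by apply: mmax; apply/asboolP; exists u; rewrite us (le_trans u00 u0u).
Unshelve. all: by end_near. Qed.

(** With [m] the value just before the jump time, [m < k <= n s], and a jump of at most 1 leaves
    only [n s = m + 1 = k]. In particular, distinct ranks have distinct jump times. *)
Lemma jump_at_jump_time n k : counting_path n -> (0 < k <= n 1%R)%N ->
  jump (fun u => (n u)%:R : R) (jump_time n k) = 1 /\ n (jump_time n k) = k.
Proof.
move=> cn /andP[k0 kn1].
have s0 : 0 < jump_time n k by exact: jump_time_gt0.
have s1 : jump_time n k <= 1 by rewrite jump_time_le// ?ler01 ?lexx.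
have s01 : 0 < jump_time n k <= 1 by rewrite s0 s1.
have [m [u0 [/andP[u00 u0s] mE ->]]] := counting_path_left cn s01.
have kle : (k <= n (jump_time n k))%N.
  by rewrite -jump_time_le ?lexx// s1 ltW.
have mk : (m < k)%N.
  rewrite -(mE u0) ?lexx ?u0s// ltnNge -jump_time_le// -?ltNge//.
  by rewrite u00 (le_trans (ltW u0s)).
have := let: And4 _ _ _ H := cn in H _ s01.
have [m' [u0' [/andP[u00' u0s'] mE' jE]]] := counting_path_left cn s01.
rewrite jE; have -> : m' = m.
  have H : Num.max u0 u0' < jump_time n k by rewrite gt_max u0s u0s'.
  by rewrite -(mE (Num.max u0 u0')) ?H ?le_max ?lexx// (mE' (Num.max u0 u0')) ?H ?le_max ?lexx ?orbT.
have mn : (m <= n (jump_time n k))%N by rewrite (leq_trans (ltnW mk)).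
rewrite -natrB// lern1 leq_subLR addn1 => nm.
have nk : n (jump_time n k) = k.
  by apply/eqP; rewrite eqn_leq kle (leq_trans nm).
split => //; rewrite nk.
have -> : k = m.+1 by apply/eqP; rewrite eqn_leq mk andbT -nk.
by rewrite subSnn.
Qed.

(** If [n s] exceeded the value just before [s], then the rank [n s] would be reached at [s] for the
    first time, and [s] would be its jump time. *)
Lemma jump_eq0 n s : counting_path n -> 0 < s <= 1 ->
  (forall k, (0 < k <= n s)%N -> jump_time n k != s) ->
  jump (fun u => (n u)%:R : R) s = 0.
Proof.
move=> cn s01 H; have [s0 s1] := andP s01.
have [m [u0 [/andP[u00 u0s] mE ->]]] := counting_path_left cn s01.
suff -> : n s = m by rewrite subrr.
have [_ nmono _ _] := cn.
apply/eqP; rewrite eqn_leq; apply/andP; split; last first.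
  by rewrite -(mE u0) ?lexx// nmono// ltW.
rewrite leqNgt; apply/negP => ms.
have ns0 : (0 < n s)%N by exact: leq_ltn_trans ms.
have := H (n s); rewrite ns0 leqnn => /(_ isT)/eqP; apply.
apply/eqP; rewrite eq_le jump_time_le// ?leqnn ?(ltW s0)//=.
rewrite leNgt; apply/negP => ts.
have t0 := jump_time_ge0 n (n s).
pose u := Num.max u0 (jump_time n (n s)).
have us : u < s by rewrite gt_max u0s ts.
have : jump_time n (n s) <= u by rewrite le_max lexx orbT.
have uu : u0 <= u < s by rewrite us le_max lexx.
rewrite jump_time_le//; first by rewrite (mE _ uu) leqNgt ms.
by rewrite (le_trans (ltW us))// le_max t0 orbT.
Qed.

(** The sum over the uncountable interval is reindexed by rank: jumps vanish off the jump times,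
    equal 1 at them, and ranks are determined by their times. *)
Lemma int_dNE h n t : counting_path n -> 0 <= t <= 1 ->
  int_dN h n t = \sum_(k < n t) h (jump_time n k.+1).
Proof.
move=> cn /andP[t0 t1].
have [_ nmono _ _] := cn.
have nt1 : (n t <= n 1%R)%N by exact: nmono.
have jt k : (k < n t)%N -> 0 < jump_time n k.+1 <= t.
  by move=> kn; rewrite jump_time_gt0//= jump_time_le// t0 t1.
rewrite /int_dN (fsbig_ord _ _ (fun k => h (jump_time n k.+1))).
have inj : set_inj `I_(n t) (fun k => jump_time n k.+1).
  move=> i j; rewrite !inE /= => it jt' ij.
  have [_ ni] := @jump_at_jump_time n i.+1 cn (leq_trans it nt1).
  have [_] := @jump_at_jump_time n j.+1 cn (leq_trans jt' nt1).
  by rewrite -ij ni => -[].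
transitivity (\sum_(s \in [set jump_time n k.+1 | k in `I_(n t)])
    h s * jump (fun u => (n u)%:R) s); last first.
  rewrite fsbig_image//; apply: eq_fsbigr => k; rewrite inE /= => kn.
  by rewrite (@jump_at_jump_time n k.+1 cn (leq_trans kn nt1)).1 mulr1.
apply/esym/fsbig_widen => [_ [k /= kn <-]|s /= []].
  by rewrite in_itv/= jt.
rewrite in_itv/= => /andP[s0 st] ns.
have s1 := le_trans st t1.
rewrite jump_eq0 ?mulr0// ?s0// => -[//|k] /andP[_ kn].
apply/eqP => ks; apply: ns; exists k => //=.
by apply: (leq_trans kn); exact: nmono _ _ (ltW s0) st t1.
Qed.

End jump_times.

(** * Jointly measurable processes *)

Section measurable_processes.
Context {R : realType} {d : measure_display} {Z : measurableType d}.
Implicit Types (H K : R -> Z -> R) (N : R -> Z -> nat).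

(** Processes carry meaning on [0, 1] only. Extending by 0 gives total functions on the product
    space, and turns an integral over [0, t] into one over the whole space. *)
Definition cut (t : R) H (p : R * Z) : R :=
  if 0 <= p.1 <= t then H p.1 p.2 else 0.

Definition measurable_process H : Prop := measurable_fun [set: R * Z] (cut 1 H).

Lemma measurable_time_le (t : R) :
  measurable_fun [set: R * Z] (fun p => 0 <= p.1 <= t).
Proof.
by apply: measurable_and; apply: measurable_fun_ler => //; exact: measurable_fst.
Qed.

Lemma measurable_cut t H : t <= 1 -> measurable_process H ->
  measurable_fun [set: R * Z] (cut t H).
Proof.
move=> t1 mH.
rewrite (_ : cut t H = fun p => if 0 <= p.1 <= t then cut 1 H p else 0).
  by apply: measurable_fun_ifT => //; exact: measurable_time_le.
apply/funext => -[s z]; rewrite /cut /=; case: ifPn => // /andP[s0 st].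
by rewrite s0 (le_trans st).
Qed.

Lemma measurable_processP H :
  measurable_fun (`[0, 1] `*` [set: Z] : set (R * Z)) (fun p => H p.1 p.2) <->
  measurable_process H.
Proof.
rewrite measurable_restrictT; last exact: measurableX.
rewrite /measurable_process; set f := _ \_ _.
suff -> : f = cut 1 H by [].
apply/funext => -[s z]; rewrite /f /patch /cut /=.
have [s01|/negP s01] := boolP (0 <= s <= 1).
  by rewrite mem_set//; split => //=; rewrite in_itv.
by rewrite memNset// => -[]; rewrite /= in_itv.
Qed.

Lemma measurable_process_op2 (op : R -> R -> R) H K :
  measurable_fun [set: R * R] (fun p => op p.1 p.2) ->
  measurable_process H -> measurable_process K ->
  measurable_process (fun s z => op (H s z) (K s z)).
Proof.
move=> mop mH mK; rewrite /measurable_process (_ : cut _ _ = fun p =>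
  if 0 <= p.1 <= 1 then op (cut 1 H p) (cut 1 K p) else 0).
  apply: measurable_fun_ifT => //; first exact: measurable_time_le.
  exact: (measurableT_comp mop (measurable_fun_pair mH mK)).
by apply/funext => -[s z]; rewrite /cut/=; case: ifP.
Qed.

Lemma measurable_processB H K : measurable_process H -> measurable_process K ->
  measurable_process (fun s z => H s z - K s z).
Proof.
apply: (@measurable_process_op2 (fun x y => x - y)).
by apply: measurable_funB; [exact: measurable_fst|exact: measurable_snd].
Qed.

Lemma measurable_processM H K : measurable_process H -> measurable_process K ->
  measurable_process (fun s z => H s z * K s z).
Proof.
apply: (@measurable_process_op2 *%R).
by apply: measurable_funM; [exact: measurable_fst|exact: measurable_snd].
Qed.

Lemma measurable_processX H : measurable_process H ->
  measurable_process (fun s z => H s z ^+ 2).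
Proof. by move=> mH; under eq_fun do under eq_fun do rewrite expr2; exact: measurable_processM. Qed.

Lemma measurable_section_cut t H z : t <= 1 -> measurable_process H ->
  measurable_fun [set: R] (fun s => cut t H (s, z)).
Proof. by move=> t1 /(measurable_cut t1) mH; exact: measurableT_comp. Qed.

Lemma integral_cut t H z : t <= 1 -> measurable_process H ->
  (\int[lebesgue_measure]_(s in `[0%R, t]) (H s z)%:E =
   \int[unit_lebesgue]_s (cut t H (s, z))%:E)%E.
Proof.
move=> t1 mH; rewrite integral_unit_lebesgue; last first.
  by apply/measurable_EFinP; exact: measurable_section_cut.
rewrite integral_mkcond [RHS]integral_mkcond.
apply: eq_integral => s _; rewrite /patch /cut /= !mem_setE !in_itv/=.
by case: ifPn => [/andP[s0 st]|]; [rewrite s0 (le_trans st)|rewrite if_same].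
Qed.

Lemma int_ds_cut H t z : t <= 1 -> measurable_process H ->
  int_ds (H ^~ z) t = fine (\int[unit_lebesgue]_s (cut t H (s, z))%:E)%E.
Proof. by move=> t1 mH; rewrite /int_ds /Rintegral integral_cut. Qed.

(** Tonelli is applied to the positive and negative parts separately, so no integrability of the
    paths is required. *)
Lemma measurable_int_ds H t : t <= 1 -> measurable_process H ->
  measurable_fun [set: Z] (fun z => int_ds (H ^~ z) t).
Proof.
move=> t1 mH; under eq_fun do rewrite int_ds_cut//.
have mcut : measurable_fun [set: R * Z] (EFin \o cut t H).
  by apply/measurable_EFinP; exact: measurable_cut.
apply: (@measurableT_comp _ _ _ _ _ _ (@fine R)); first exact: fine_measurable.
rewrite (_ : (fun z => _) = (fun z =>
    \int[unit_lebesgue]_s ((EFin \o cut t H)^\+ (s, z)) -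
    \int[unit_lebesgue]_s ((EFin \o cut t H)^\- (s, z)))%E); last first.
  by apply/funext => z; rewrite integralE; congr (_ - _)%E; apply: eq_integral => s _; rewrite ?funeposE ?funenegE.
apply: emeasurable_funB.
- apply: (@measurable_fun_fubini_tonelli_G _ _ _ _ _ unit_lebesgue
    ((EFin \o cut t H)^\+)%E) => //.
  exact: measurable_funepos.
- apply: (@measurable_fun_fubini_tonelli_G _ _ _ _ _ unit_lebesgue
    ((EFin \o cut t H)^\-)%E) => //.
  exact: measurable_funeneg.
Qed.

Definition counting_process N : Prop :=
  (forall z, counting_path (N ^~ z)) /\
  (forall t, 0 <= t <= 1 -> measurable_fun [set: Z] (fun z => (N t z)%:R : R)).

Lemma measurable_counting_le N k t : counting_process N -> 0 <= t <= 1 ->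
  measurable [set z | (k <= N t z)%N].
Proof.
move=> [_ mN] t01; rewrite -[X in measurable X]setTI.
rewrite (_ : [set z | _] = (fun z => (N t z)%:R : R) @^-1` `[k%:R, +oo[).
  exact: mN.
by apply/seteqP; split => z /=; rewrite in_itv/= andbT ler_nat.
Qed.

Lemma measurable_counting_leq N k t : counting_process N -> 0 <= t <= 1 ->
  measurable_fun [set: Z] (fun z => (k <= N t z)%N).
Proof.
move=> cN t01; apply: (measurable_fun_bool true) => //.
rewrite setTI (_ : _ @^-1` _ = [set z | (k <= N t z)%N]).
  exact: measurable_counting_le.
by apply/seteqP; split => z.
Qed.

Lemma measurable_jump_time N k : counting_process N ->
  measurable_fun [set: Z] (fun z => jump_time (N ^~ z) k).
Proof.
move=> cN; have [cp mN] := cN.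
apply: (measurability _ (RGenOInfty.measurableE R)) => //.
move=> _ [_ [x ->] <-]; rewrite setTI.
rewrite (_ : _ @^-1` _ = ~` [set z | jump_time (N ^~ z) k <= x]); last first.
  by apply/seteqP; split => z /=; rewrite in_itv/= andbT ltNge => /negP.
apply: measurableC.
have m1 : measurable [set z | (k <= N 1%R z)%N].
  by apply: measurable_counting_le => //; rewrite ler01 lexx.
have [x0|x0] := ltP x 0.
  rewrite (_ : [set z | _] = set0)//; apply/seteqP; split => z //=.
  by rewrite leNgt (lt_le_trans x0)// jump_time_ge0.
have [x1|x1] := leP x 1.
  rewrite (_ : [set z | _] = [set z | (k <= N x z)%N]).
    by apply: measurable_counting_le => //; rewrite x0.
  by apply/seteqP; split => z /=; rewrite jump_time_le// x0.
have le1 z : (k <= N 1%R z)%N -> jump_time (N ^~ z) k <= 1.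
  by rewrite jump_time_le ?ler01 ?lexx.
(* For [x] between 1 and 2 the event says that the jump of rank [k] occurs at all; from 2 on, the
   default value of [jump_time] makes it the whole space. *)
have [x2|x2] := ltP x 2.
  rewrite (_ : [set z | _] = [set z | (k <= N 1%R z)%N])//.
  apply/seteqP; split => z /=.
    apply: contraLR => kN; rewrite /jump_time (negbTE kN).
    by rewrite -ltNge.
  by move=> /le1/le_trans; apply; exact: ltW.
rewrite (_ : [set z | _] = setT)//; apply/seteqP; split => z //= _.
have [/le1/le_trans->//|kN] := boolP (k <= N 1%R z)%N; first exact: ltW.
by rewrite /jump_time (negbTE kN).
Qed.

Lemma measurable_at_jump_time N H k : counting_process N ->
  measurable_process H ->
  measurable_fun [set: Z] (fun z => cut 1 H (jump_time (N ^~ z) k, z)).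
Proof.
move=> cN mH; apply: (measurableT_comp mH).
by apply: measurable_fun_pair => //; exact: measurable_jump_time.
Qed.

Lemma int_dN_cut N H t z : counting_process N -> 0 <= t <= 1 ->
  int_dN (H ^~ z) (N ^~ z) t =
  \sum_(k < N t z) cut 1 H (jump_time (N ^~ z) k.+1, z).
Proof.
move=> [cp _] /andP[t0 t1]; rewrite int_dNE ?t0//.
apply: eq_bigr => k _; rewrite /cut /= jump_time_ge0 jump_time_le//.
  rewrite (leq_trans (ltn_ord k))//; case: (cp z) => _ nm _ _.
  by apply: (nm t 1).
by rewrite ler01 lexx.
Qed.

Lemma measurable_int_dN N H t : counting_process N -> 0 <= t <= 1 ->
  measurable_process H ->
  measurable_fun [set: Z] (fun z => int_dN (H ^~ z) (N ^~ z) t).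
Proof.
move=> cN t01 mH; under eq_fun do rewrite int_dN_cut//.
(* The number of summands depends on [z]. Truncating at [m] gives a fixed number of measurable
   terms, and the sequence is stationary once [m] reaches [N t z]. *)
apply: (@measurable_fun_cvg _ _ _ _ (fun m z => \sum_(k < m)
   if (k.+1 <= N t z)%N then cut 1 H (jump_time (N ^~ z) k.+1, z) else 0)).
  move=> m; apply: measurable_sum => k; apply: measurable_fun_ifT => //.
  - exact: measurable_counting_leq.
  - exact: measurable_at_jump_time.
move=> z _; apply: cvg_near_cst; exists (N t z) => // m /= Nm.
rewrite -big_mkcond/= [RHS](big_ord_widen _ (fun k =>
  cut 1 H (jump_time (N ^~ z) k.+1, z)) Nm).
by [].
Qed.

(** The process is a pointwise limit of step processes that hold, on each interval of a uniform
    grid, the value at its left end point. Left continuity gives the convergence; time 0 lies in no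
    half-open interval and gets its own term. *)
Lemma caglad_measurable_process H : (forall z, caglad (H ^~ z)) ->
  (forall t, 0 <= t <= 1 -> measurable_fun [set: Z] (H t)) ->
  measurable_process H.
Proof.
move=> cH mH.
pose h m (p : R * Z) : R := (if p.1 == 0 then H 0 p.2 else 0) +
  \sum_(k < m.+1) (if k%:R / m.+1%:R < p.1 <= k.+1%:R / m.+1%:R
                   then H (k%:R / m.+1%:R) p.2 else 0).
apply: (@measurable_fun_cvg _ _ _ _ (fun m p => h m p)).
  have mst s : 0 <= s <= 1 -> measurable_fun [set: R * Z] (fun p => H s p.2).
    by move=> s01; apply: (measurableT_comp (mH _ s01)); exact: measurable_snd.
  move=> m; apply: measurable_funD.
    apply: measurable_fun_ifT => //; last by apply: mst; rewrite lexx ler01.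
    by apply: measurable_fun_eqr => //; exact: measurable_fst.
  apply: measurable_sum => k; apply: measurable_fun_ifT => //.
    apply: measurable_and; first by apply: measurable_fun_ltr => //; exact: measurable_fst.
    by apply: measurable_fun_ler => //; exact: measurable_fst.
  by apply: mst; rewrite divr_ge0//= ler_pdivrMr// mul1r ler_nat ltnW.
move=> [t z] _; rewrite /cut /=.
have kt0 m k : (0 <= k%:R / m.+1%:R :> R) by rewrite divr_ge0.
have [/andP[t0 t1]|nt] := boolP (0 <= t <= 1); last first.
  apply: cvg_near_cst; near=> m; rewrite /h /= ifF ?big1 ?addr0// => [k _|].
    rewrite ifF//; apply: contraNF nt => /andP[kt tk]; rewrite (le_trans _ (ltW kt))//=.
    by rewrite (le_trans tk)// ler_pdivrMr// mul1r ler_nat.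
  by apply: contraNF nt => /eqP ->; rewrite lexx ler01.
have [->|tn0] := eqVneq t 0.
  apply: cvg_near_cst; near=> m; rewrite /h /= eqxx big1 ?addr0// => k _.
  by rewrite ifF// ltNge kt0.
have {t0 tn0}tgt0 : 0 < t by rewrite lt_neqAle eq_sym tn0.
have [/(_ t) + _] := cH z; rewrite tgt0 t1 => /(_ isT) /cvgrPdist_lt cvt.
apply/cvgrPdist_lt => e e0; have := cvt _ e0.
rewrite near_withinE => -[r /= r0 hr].
near=> m.
have [K [Km /andP[K1 K2]]] : exists K : nat, (K < m.+1)%N /\ K%:R / m.+1%:R < t <= K.+1%:R / m.+1%:R.
  pose P k := t <= k.+1%:R / m.+1%:R.
  have Pex : exists k, P k by exists m; rewrite /P divff.
  case: (ex_minnP Pex) => k Pk kmin; exists k.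
  rewrite ltnS kmin//; last by rewrite /P divff.
  split => //; rewrite -/(P k) Pk andbT; case: k Pk kmin => [|k] Pk kmin; first by rewrite mul0r.
  by rewrite ltNge; apply/negP => /kmin; rewrite ltnn.
rewrite /h /= gt_eqF// add0r (bigD1 (Ordinal Km))//= K1 K2 /= big1 ?addr0 => [|k kK].
  apply: hr => //=; rewrite ger0_norm ?subr_ge0 ?ltW//.
  rewrite ltrBlDr (le_lt_trans K2)// -natr1 mulrDl addrC ltrD2r mul1r.
  near: m; exact: near_infty_natSinv_lt (PosNum r0).
rewrite ifF//; apply/negP => /andP[k1 k2].
case/eqP: kK; apply/val_inj => /=; apply/eqP; rewrite eqn_leq.
have := lt_le_trans k1 K2; rewrite ltr_pM2r ?invr_gt0// ltr_nat ltnS => ->.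
by have := lt_le_trans K1 k2; rewrite ltr_pM2r ?invr_gt0// ltr_nat ltnS => ->.
Unshelve. all: by end_near. Qed.

End measurable_processes.

Section comp_process.
Context {R : realType} {d d' : measure_display} {Z : measurableType d}
  {Y : measurableType d'}.

Lemma measurable_process_comp (H : R -> Z -> R) (phi : Y -> Z) :
  measurable_fun [set: Y] phi -> measurable_process H ->
  measurable_process (fun s y => H s (phi y)).
Proof.
move=> mphi mH; rewrite /measurable_process.
rewrite (_ : cut _ _ = cut 1 H \o (fun p => (p.1, phi p.2)))//.
apply: measurableT_comp => //; apply: measurable_fun_pair => //.
by apply: measurableT_comp.
Qed.

Lemma counting_process_comp (N : R -> Z -> nat) (phi : Y -> Z) :
  measurable_fun [set: Y] phi -> counting_process N ->
  counting_process (fun s y => N s (phi y)).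
Proof.
move=> mphi [cp mN]; split=> [y|t t01]; first exact: cp.
exact: (measurableT_comp (mN t t01)).
Qed.

End comp_process.

(** * Predictable processes *)

Section integral_nnsfun_mul.
Import finmap HBNNSimple.
Context {d : measure_display} {T : measurableType d} {R : realType}.
Variables (mu : {measure set T -> \bar R}) (E : set T) (f k : T -> R).
Hypotheses (mE : measurable E) (intf : mu.-integrable E (EFin \o f))
  (mk : measurable_fun E k).

Lemma integral_nnsfun_mul (g : {nnsfun R >-> R}) :
  (\int[mu]_(x in E) (g (k x) * f x)%:E =
   \sum_(y <- fset_set (range g))
     y%:E * \int[mu]_(x in E `&` k @^-1` (g @^-1` [set y])) (f x)%:E)%E.
Proof.
pose A y := k @^-1` (g @^-1` [set y]).
have mA y : measurable (E `&` A y) by exact: mk.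
have iA y : mu.-integrable E (fun x => (f x)%:E * (\1_(A y) x)%:E)%E.
  rewrite (_ : (fun x => _) = (EFin \o f) \_ (A y)); last first.
    apply/funext => x; rewrite /patch/= indicE; case: (x \in A y);
    by rewrite ?mule1 ?mule0.
  rewrite integrable_mkcond// restrict_comp ?EFin0//=.
  have := integrableS mE (mA y) (@subIsetl _ _ _) intf.
  rewrite integrable_mkcond//; apply: eq_integrable => // x _.
  by rewrite /patch /= in_setI; case: (x \in E); case: (x \in A y).
transitivity (\int[mu]_(x in E) \sum_(y <- fset_set (range g))
    (y%:E * ((f x)%:E * (\1_(A y) x)%:E)))%E.
  apply: eq_integral => x _; rewrite fimfunE fsbig_finite//= mulr_suml sumEFin.
  by congr EFin; apply: eq_bigr => y _; rewrite -mulrA [f x * _]mulrC.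
rewrite integral_sum//; last by move=> y; exact: integrableZl.
apply: eq_bigr => y _; rewrite integralZl//; congr (_ * _)%E.
rewrite integral_mkcondr; apply: eq_integral => x _.
by rewrite /patch/= indicE; case: (x \in A y); rewrite ?mule1 ?mule0.
Qed.

End integral_nnsfun_mul.

Section integral_comp_eq.
Import finmap HBNNSimple.
Context {d1 d2 : measure_display} {T1 : measurableType d1}
  {T2 : measurableType d2} {R : realType}.
Variables (mu1 : {measure set T1 -> \bar R}) (mu2 : {measure set T2 -> \bar R}).
Variables (E1 : set T1) (E2 : set T2) (f1 k1 : T1 -> R) (f2 k2 : T2 -> R).
Hypotheses (mE1 : measurable E1) (mE2 : measurable E2).
Hypotheses (mk1 : measurable_fun E1 k1) (mk2 : measurable_fun E2 k2).
Hypotheses (if1 : mu1.-integrable E1 (EFin \o f1))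
  (if2 : mu2.-integrable E2 (EFin \o f2)).
Hypotheses (ikf1 : mu1.-integrable E1 (fun x => (k1 x * f1 x)%:E))
  (ikf2 : mu2.-integrable E2 (fun x => (k2 x * f2 x)%:E)).
Hypothesis eqB : forall B : set R, measurable B ->
  (\int[mu1]_(x in E1 `&` k1 @^-1` B) (f1 x)%:E =
   \int[mu2]_(x in E2 `&` k2 @^-1` B) (f2 x)%:E)%E.

Let mhf d (T : measurableType d) (mu : {measure set T -> \bar R}) E
    (f k : T -> R) (h : R -> R) : measurable_fun [set: R] h ->
  measurable_fun E k -> mu.-integrable E (EFin \o f) ->
  measurable_fun E (fun x => (h (k x) * f x)%:E).
Proof.
move=> mh mk /measurable_int/measurable_EFinP mf.
by apply/measurable_EFinP; apply: measurable_funM => //; exact: measurableT_comp.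
Qed.

Let dct d (T : measurableType d) (mu : {measure set T -> \bar R}) E
    (f k : T -> R) (h : R -> R) (g : nat -> {nnsfun R >-> R}) :
  measurable E -> measurable_fun E k -> mu.-integrable E (EFin \o f) ->
  measurable_fun [set: R] h ->
  mu.-integrable E (fun x => (k x * f x)%:E) ->
  (forall y, g n y @[n --> \oo] --> h y) ->
  (forall n y, `|g n y| <= `|y|) ->
  (\int[mu]_(x in E) (g n (k x) * f x)%:E)%E @[n --> \oo] -->
    (\int[mu]_(x in E) (h (k x) * f x)%:E)%E.
Proof.
move=> mE mk intf mh intkf gh gle.
have [] := @dominated_convergence _ _ _ mu E mE
  (fun n x => (g n (k x) * f x)%:E) (fun x => (h (k x) * f x)%:E)
  (fun x => `|(k x * f x)%:E|%E); last by [].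
- by move=> n; apply: (mhf _ mk intf); exact: measurable_funPT.
- exact: mhf mh mk intf.
- apply: aeW => x _; apply: cvg_EFin; first by near=> n.
  by apply: cvgMl; exact: gh.
- exact: integrable_abse.
- by apply: aeW => x n _; rewrite /= lee_fin !normrM ler_wpM2r.
Unshelve. all: by end_near. Qed.

Let main (h : R -> R) : measurable_fun [set: R] h -> (forall y, 0 <= h y) ->
  (forall y, h y <= `|y|) ->
  (\int[mu1]_(x in E1) (h (k1 x) * f1 x)%:E =
   \int[mu2]_(x in E2) (h (k2 x) * f2 x)%:E)%E.
Proof.
move=> mh h0 hle.
have mh' : measurable_fun [set: R] (EFin \o h) by exact/measurable_EFinP.
pose g := nnsfun_approx measurableT mh'.
have gh y : g n y @[n --> \oo] --> h y.
  have /(@cvg_nnsfun_approx _ _ _ _ measurableT _ mh')/(_ y I) :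
    forall x, [set: R] x -> (0%R <= (EFin \o h) x)%E by move=> x _; rewrite lee_fin.
  by move/fine_cvg.
have gle n y : `|g n y| <= `|y|.
  rewrite ger0_norm//; apply: le_trans (hle y).
  rewrite -(cvg_lim _ (gh y))//; apply: (nondecreasing_cvgn_le (u_ := fun n => g n y)).
  - by move=> a b ab; apply/lefP; exact: nd_nnsfun_approx.
  - by apply/cvg_ex; exists (h y).
have c1 := dct mE1 mk1 if1 mh ikf1 gh gle.
have c2 := dct mE2 mk2 if2 mh ikf2 gh gle.
apply: (cvg_unique _ c1); rewrite // (_ : (fun n => _) = (fun n =>
    \int[mu2]_(x in E2) (g n (k2 x) * f2 x)%:E))%E//.
apply/funext => n; rewrite !integral_nnsfun_mul//.
by apply: eq_bigr => y _; rewrite eqB.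
Qed.

Let split d (T : measurableType d) (mu : {measure set T -> \bar R}) E
    (f k : T -> R) :
  measurable E -> measurable_fun E k -> mu.-integrable E (EFin \o f) ->
  mu.-integrable E (fun x => (k x * f x)%:E) ->
  (\int[mu]_(x in E) (k x * f x)%:E =
   \int[mu]_(x in E) (Num.max (k x) 0 * f x)%:E -
   \int[mu]_(x in E) (Num.max (- k x) 0 * f x)%:E)%E.
Proof.
move=> mE mk intf intkf.
rewrite -integralB_EFin//.
- apply: eq_integral => x _; rewrite -EFinB -mulrBl; congr (_ * _)%:E.
  by rewrite maxEle; case: leP => k0; rewrite maxEle; case: leP => // k0'; lra.
- apply: (le_integrable _ _ _ intkf) => // [|x _].
    apply: (mhf (h := fun y => Num.max y 0) _ mk intf).
    exact: measurable_maxr.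
  rewrite /= lee_fin !normrM ler_wpM2r// ger0_norm ?le_max ?lexx ?orbT//.
  by rewrite ge_max normr_ge0 ler_norm.
- apply: (le_integrable _ _ _ intkf) => // [|x _].
    apply: (mhf (h := fun y => Num.max (- y) 0) _ mk intf).
    by apply: measurable_maxr => //; exact: oppr_measurable.
  rewrite /= lee_fin !normrM ler_wpM2r// ger0_norm ?le_max ?lexx ?orbT//.
  by rewrite ge_max normr_ge0 -normrN ler_norm.
Qed.

(** The hypothesis [eqB] says that the signed measures with densities [f1] and [f2] have the same
    image under [k1] and [k2]. Integrating simple functions, and then the positive and negative
    parts of the identity as dominated limits of them, gives the claim. *)
Lemma integral_comp_eq :
  (\int[mu1]_(x in E1) (k1 x * f1 x)%:E =
   \int[mu2]_(x in E2) (k2 x * f2 x)%:E)%E.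
Proof.
rewrite split// [RHS]split//; congr (_ - _)%E.
- apply: (main (h := fun y => Num.max y 0)) => [||y].
  + exact: measurable_maxr.
  + by move=> y; rewrite le_max lexx orbT.
  + by rewrite ge_max normr_ge0 ler_norm.
- apply: (main (h := fun y => Num.max (- y) 0)) => [||y].
  + by apply: measurable_maxr => //; exact: oppr_measurable.
  + by move=> y; rewrite le_max lexx orbT.
  + by rewrite ge_max normr_ge0 -normrN ler_norm.
Qed.

End integral_comp_eq.

Section predictable_sets.
Context {R : realType} {d : measure_display} {T : measurableType d}.
Implicit Types (F : R -> set (set T)) (Q : set (R * T)).

Definition predictable_sets F : set (set (R * T)) :=
  <<s `[0, 1] `*` [set: T], predictable_rectangles F >>.

Lemma measurable_unit_slab : measurable (`[0, 1] `*` [set: T] : set (R * T)).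
Proof. exact: measurableX. Qed.

Lemma predictable_rectangles_sub F Q : is_filtration F ->
  predictable_rectangles F Q -> measurable Q /\ Q `<=` `[0, 1] `*` [set: T].
Proof.
move=> [Fs _] [[A F0A <-]|[s [t [A [s0 st t1 FsA ->]]]]].
  have [_ F0m] : sigma_algebra [set: T] (F 0) /\ F 0 `<=` measurable.
    by apply: Fs; rewrite lexx ler01.
  split; first by apply: measurableX => //; exact: F0m.
  by move=> [u w] /= [-> _]; rewrite in_itv/= lexx ler01.
have [_ Fsm] : sigma_algebra [set: T] (F s) /\ F s `<=` measurable.
  by apply: Fs; rewrite s0 (le_trans (ltW st)).
split; first by apply: measurableX => //; exact: Fsm.
move=> [u w] /= []; rewrite !in_itv/= => /andP[su ut] _.
by rewrite (le_trans s0 (ltW su)) (le_trans ut).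
Qed.

Lemma predictable_sets_sub F Q : is_filtration F -> predictable_sets F Q ->
  measurable Q /\ Q `<=` `[0, 1] `*` [set: T].
Proof.
move=> hF; have : predictable_sets F `<=`
  [set Q : set (R * T) | measurable Q /\ Q `<=` `[0, 1] `*` [set: T]]; last exact.
apply: smallest_sub => [|A]; last exact: predictable_rectangles_sub.
split.
- by split.
- move=> A [mA AD]; split; last by move=> x [].
  by apply: measurableD => //; exact: measurable_unit_slab.
- move=> A mA; split; first by apply: bigcup_measurable => k _; exact: (mA k).1.
  by apply: bigcup_sub => k _; exact: (mA k).2.
Qed.

Lemma predictable_measurable_process F (H : R -> T -> R) :
  is_filtration F -> predictable F H -> measurable_process H.
Proof.
move=> hF pH; apply/measurable_processP => _ B mB.
by have [] := predictable_sets_sub hF (pH B mB).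
Qed.

Lemma predictable_rectangles_setI F : is_filtration F ->
  setI_closed (predictable_rectangles F).
Proof.
move=> [Fs Fm].
have FI s : 0 <= s <= 1 -> setI_closed (F s).
  by move=> /Fs[/(sigma_algebraP (fun X _ => @subsetT _ X))[]].
have F0 : F 0 set0.
  by have [[]] : sigma_algebra [set: T] (F 0) /\ F 0 `<=` measurable
    by apply: Fs; rewrite lexx ler01.
have disj (s t : R) (A B : set T) : 0 <= s ->
  ([set 0] `*` A) `&` (`]s, t] `*` B) = set0.
  move=> s0; apply/seteqP; split => [[u w] /= [[-> _] []]|//].
  by rewrite in_itv/= ltNge s0.
move=> _ _ [[A FA <-]|[s [t [A [s0 st t1 FA ->]]]]]
  [[B FB <-]|[s' [t' [B [s0' st' t1' FB ->]]]]].
- left; exists (A `&` B); first by apply: FI => //; rewrite lexx ler01.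
  by rewrite -setXI setIid.
- by left; exists set0 => //; rewrite setX0 disj.
- by left; exists set0 => //; rewrite setX0 setIC disj.
(* A rectangle needs [s < t], so an empty intersection is written as the product of the singleton 0
   with the empty set. *)
- have [lt|le] := ltP (Num.max s s') (Num.min t t'); last first.
    left; exists set0 => //; rewrite setX0; apply/esym/seteqP; split => //.
    move=> [u w] /= [[+ _] [+ _]]; rewrite !in_itv/= => /andP[su ut] /andP[su' ut'].
    have : Num.max s s' < Num.min t t'.
      by rewrite gt_max !lt_min !(lt_le_trans su)// !(lt_le_trans su').
    by rewrite ltNge le.
  have m0 : 0 <= Num.max s s' by rewrite le_max s0.
  have m1 : Num.max s s' <= 1.
    by rewrite ge_max (ltW (lt_le_trans st t1)) (ltW (lt_le_trans st' t1')).
  right; exists (Num.max s s'), (Num.min t t'), (A `&` B); split => //.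
  + by rewrite ge_min t1.
  + apply: FI; first by rewrite m0.
    * by apply: (Fm s) => //; rewrite le_max lexx.
    * by apply: (Fm s') => //; rewrite le_max lexx orbT.
  + rewrite -setXI; congr (_ `*` _); apply/seteqP; split => u /=;
      rewrite !in_itv/= gt_max le_min.
    * by move=> [/andP[-> ->] /andP[-> ->]].
    * by move=> /andP[/andP[-> ->] /andP[-> ->]].
Qed.

End predictable_sets.

Section predictable_integral_eq.
Context {d1 d2 d : measure_display} {T1 : measurableType d1}
  {T2 : measurableType d2} {T : measurableType d} {R : realType}.
Variables (mu1 : {measure set T1 -> \bar R}) (mu2 : {measure set T2 -> \bar R}).
Variables (p1 : T1 -> R * T) (p2 : T2 -> R * T) (f1 : T1 -> R) (f2 : T2 -> R).
Variable F : R -> set (set T).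
Let D : set (R * T) := `[0, 1] `*` [set: T].
Hypotheses (mp1 : measurable_fun [set: T1] p1) (mp2 : measurable_fun [set: T2] p2).
Hypotheses (if1 : mu1.-integrable (p1 @^-1` D) (EFin \o f1))
  (if2 : mu2.-integrable (p2 @^-1` D) (EFin \o f2)).
Hypothesis hF : is_filtration F.
Hypothesis eqF : forall Q, predictable_rectangles F Q ->
  (\int[mu1]_(x in p1 @^-1` Q) (f1 x)%:E = \int[mu2]_(x in p2 @^-1` Q) (f2 x)%:E)%E.

Let mpre d' (S : measurableType d') (p : S -> R * T) Q :
  measurable_fun [set: S] p -> measurable Q -> measurable (p @^-1` Q).
Proof. by move=> mp mQ; rewrite -[X in measurable X]setTI; exact: mp. Qed.

Let intD d' (S : measurableType d') (mu : {measure set S -> \bar R}) p f A B :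
  measurable_fun [set: S] p -> mu.-integrable (p @^-1` D) (EFin \o f) ->
  A `<=` D -> B `<=` A -> measurable A -> measurable B ->
  (\int[mu]_(x in p @^-1` (A `\` B)) (f x)%:E =
   \int[mu]_(x in p @^-1` A) (f x)%:E - \int[mu]_(x in p @^-1` B) (f x)%:E)%E.
Proof.
move=> mp intf AD BA mA mB.
have mD : measurable (p @^-1` D) by apply: mpre => //; exact: measurable_unit_slab.
have intfin C : measurable C -> C `<=` D ->
    (\int[mu]_(x in p @^-1` C) (f x)%:E)%E \is a fin_num.
  move=> mC CD; apply: integrable_fin_num; first exact: mpre.
  by apply: (integrableS mD) => //; [exact: mpre|exact: preimage_subset].
suff -> : (\int[mu]_(x in p @^-1` A) (f x)%:E =
    \int[mu]_(x in p @^-1` (A `\` B)) (f x)%:E + \int[mu]_(x in p @^-1` B) (f x)%:E)%E.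
  by rewrite addeK// intfin//; exact: subset_trans BA AD.
have AE : p @^-1` A = p @^-1` (A `\` B) `|` p @^-1` B.
  by rewrite -preimage_setU setUC setDUK.
rewrite [in LHS]AE integral_setU//.
- by apply: mpre => //; exact: measurableD.
- exact: mpre.
- rewrite -AE; apply: (measurable_funS mD); first exact: preimage_subset.
  exact: measurable_int intf.
- by apply/disj_setPS => x [[_ nB]].
Qed.

Let intcup d' (S : measurableType d') (mu : {measure set S -> \bar R}) p f
    (A : (set (R * T))^nat) :
  measurable_fun [set: S] p -> mu.-integrable (p @^-1` D) (EFin \o f) ->
  nondecreasing_seq A -> (forall n, measurable (A n)) -> (forall n, A n `<=` D) ->
  (\int[mu]_(x in p @^-1` (A n)) (f x)%:E)%E @[n --> \oo] -->
  (\int[mu]_(x in p @^-1` (\bigcup_n A n)) (f x)%:E)%E.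
Proof.
move=> mp intf ndA mA AD.
have mD : measurable (p @^-1` D) by apply: mpre => //; exact: measurable_unit_slab.
have mU : measurable (\bigcup_n A n) by exact: bigcup_measurable.
have UD : \bigcup_n A n `<=` D by exact: bigcup_sub.
have toD C : C `<=` D -> (\int[mu]_(x in p @^-1` C) (f x)%:E =
    \int[mu]_(x in p @^-1` D) ((EFin \o f) \_ (p @^-1` C)) x)%E.
  move=> CD; rewrite -integral_mkcondr; congr (integral _ _ _).
  by rewrite -preimage_setI setIidr.
rewrite toD// (_ : (fun n => _) = (fun n =>
  \int[mu]_(x in p @^-1` D) ((EFin \o f) \_ (p @^-1` (A n))) x))%E; last first.
  by apply/funext => n; rewrite toD.
have mf C : measurable C -> measurable_fun (p @^-1` D) ((EFin \o f) \_ (p @^-1` C)).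
  move=> mC; apply/(measurable_restrict _ _ _).1 => //; first exact: mpre.
  exact: (measurable_funS mD (@subIsetl _ _ _) (measurable_int _ intf)).
have [] := @dominated_convergence _ _ _ mu (p @^-1` D) mD
  (fun n => (EFin \o f) \_ (p @^-1` (A n))) ((EFin \o f) \_ (p @^-1` (\bigcup_n A n)))
  (fun x => `|(f x)%:E|%E); last by [].
- by move=> n; exact: mf.
- exact: mf.
- apply: aeW => x _; have [[n _ An]|nU] := pselect ((\bigcup_n A n) (p x)).
    apply: cvg_near_cst; exists n => // m /= nm.
    rewrite /patch !mem_set//; first by exists n.
    by have /subsetPset Anm := ndA _ _ nm; exact: Anm.
  apply: cvg_near_cst; near=> n; rewrite /patch !memNset// => An.
  by apply: nU; exists n.
- exact: integrable_abse.
- apply: aeW => x n _; rewrite /patch; case: ifP => // _.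
  by rewrite abse0 abse_ge0.
Unshelve. all: by end_near. Qed.

(** The sets on which the integrals agree form a lambda-system on the unit slab, and rectangles are
    stable under intersection. Integrability of the densities permits the subtraction for
    differences and dominated convergence for increasing unions. *)
Lemma predictable_sets_integral_eq Q : predictable_sets F Q ->
  (\int[mu1]_(x in p1 @^-1` Q) (f1 x)%:E = \int[mu2]_(x in p2 @^-1` Q) (f2 x)%:E)%E.
Proof.
pose H := [set Q | [/\ measurable Q, Q `<=` D &
  (\int[mu1]_(x in p1 @^-1` Q) (f1 x)%:E = \int[mu2]_(x in p2 @^-1` Q) (f2 x)%:E)%E]].
have rH : predictable_rectangles F `<=` H.
  move=> A rA; have [mA AD] := predictable_rectangles_sub hF rA.
  by split => //; exact: eqF.
suff : predictable_sets F `<=` H by move=> /[apply] -[].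
apply: lambda_system_subset => //.
- exact: predictable_rectangles_setI.
- split.
  + by move=> A [].
  + have FT : F 0 setT.
      have [[F0 FC _] _] : sigma_algebra [set: T] (F 0) /\ F 0 `<=` measurable.
        by apply: (hF.1 0); rewrite lexx ler01.
      by rewrite -(setD0 [set: T]); exact: FC.
    (* The slab is not itself a rectangle, but a disjoint union of two. *)
    have DE : D = (([set 0] `*` [set: T]) `|` (`]0, 1] `*` [set: T])).
      apply/seteqP; split => -[u w] /=.
        move=> [/= + _]; rewrite in_itv/= => /andP[u0 u1]; case: (eqVneq u 0) => [->|un]; first by left.
        right; split => //=; apply/andP; split; last exact: u1.
        by rewrite bnd_simp lt_neqAle eq_sym un; exact: u0.
      move=> [[-> _]|[]]; first by split => //=; rewrite in_itv/= lexx ler01.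
      by rewrite in_itv/= => /andP[/ltW u0 u1] _; split => //=; rewrite in_itv/= u0 u1.
    change (H D); rewrite DE.
    have r1 : predictable_rectangles F ([set 0] `*` [set: T]) by left; exists setT.
    have r2 : predictable_rectangles F (`]0, 1] `*` [set: T]).
      by right; exists 0, 1, setT.
    have [m1 s1 e1] := rH _ r1; have [m2 s2 e2] := rH _ r2.
    split; first exact: measurableU.
      by move=> x [/s1|/s2].
    have sU : ([set 0] `*` [set: T]) `|` (`]0, 1] `*` [set: T]) `<=` D.
      by move=> x [/s1|/s2].
    have dj : [disjoint ([set 0] `*` [set: T] : set (R * T)) & `]0, 1] `*` [set: T]].
      by apply/disj_setPS => -[u w] /= [[-> _]]; rewrite in_itv/= ltxx => -[].
    rewrite !preimage_setU !integral_setU ?e1 ?e2//; do ?exact: mpre.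
    * rewrite -preimage_setU; apply: (measurable_funS _ _ (measurable_int _ if2)); last exact: preimage_subset.
      by apply: mpre => //; exact: measurable_unit_slab.
    * by apply/disj_setPS => x [/= ? ?]; move/disj_setPS : dj; apply; split; eassumption.
    * rewrite -preimage_setU; apply: (measurable_funS _ _ (measurable_int _ if1)); last exact: preimage_subset.
      by apply: mpre => //; exact: measurable_unit_slab.
    * by apply/disj_setPS => x [/= ? ?]; move/disj_setPS : dj; apply; split; eassumption.
  + move=> A B BA [mA AD eA] [mB BD eB]; split; first exact: measurableD.
      by move=> x [/AD].
    by rewrite !intD// eA eB.
  + move=> A ndA HA; split.
    * by apply: bigcup_measurable => k _; case: (HA k).
    * by apply: bigcup_sub => k _; case: (HA k).
    * have mA n : measurable (A n) by case: (HA n).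
      have AD n : A n `<=` D by case: (HA n).
      have c1 := intcup mp1 if1 ndA mA AD; have c2 := intcup mp2 if2 ndA mA AD.
      apply: (cvg_unique _ c1); rewrite // (_ : (fun n => _) = (fun n =>
        \int[mu2]_(x in p2 @^-1` (A n)) (f2 x)%:E))%E//.
      by apply/funext => n; case: (HA n).
- by move=> X /(predictable_sets_sub hF)[].
Qed.

(** It serves twice: with [p1] sending a jump to its time and outcome and [p2] the identity, for
    compensation; with both maps the identity and second density 0, for orthogonality. *)
Lemma predictable_integral_eq (H : R -> T -> R) : predictable F H ->
  mu1.-integrable (p1 @^-1` D) (fun x => (H (p1 x).1 (p1 x).2 * f1 x)%:E) ->
  mu2.-integrable (p2 @^-1` D) (fun x => (H (p2 x).1 (p2 x).2 * f2 x)%:E) ->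
  (\int[mu1]_(x in p1 @^-1` D) (H (p1 x).1 (p1 x).2 * f1 x)%:E =
   \int[mu2]_(x in p2 @^-1` D) (H (p2 x).1 (p2 x).2 * f2 x)%:E)%E.
Proof.
move=> pH i1 i2.
have mHD := (measurable_processP _).2 (predictable_measurable_process hF pH).
have mH d' (S : measurableType d') (p : S -> R * T) : measurable_fun [set: S] p ->
    measurable_fun (p @^-1` D) (fun x => H (p x).1 (p x).2).
  move=> mp; apply: (measurable_comp (F := D)) mHD _ => //.
  - exact: measurable_unit_slab.
  - by move=> _ [x Dx <-].
  - exact: measurable_funTS.
apply: (@integral_comp_eq _ _ _ _ _ mu1 mu2 _ _ f1
  (fun x => H (p1 x).1 (p1 x).2) f2 (fun x => H (p2 x).1 (p2 x).2)) => //.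
- by apply: mpre => //; exact: measurable_unit_slab.
- by apply: mpre => //; exact: measurable_unit_slab.
- exact: mH.
- exact: mH.
- by move=> B mB; exact: (predictable_sets_integral_eq (pH B mB)).
Qed.

End predictable_integral_eq.

(** * Compensation of a counting process *)

Definition nat_count {R : realType} (A : set nat) : \bar R := counting A.

Section nat_count.
Context {R : realType}.

HB.instance Definition _ := Measure.copy (@nat_count R) (@counting nat R).

(* The library makes [counting] a sigma-finite content only. *)
HB.instance Definition _ :=
  @Measure_isSigmaFinite.Build _ _ R (@nat_count R) (sigma_finite_counting R).

End nat_count.

Section marks.
Context {R : realType} {d : measure_display} {T : measurableType d}.
Variables (P : probability T R) (N : R -> T -> nat).
Hypothesis cN : counting_process N.
Implicit Types (H : R -> T -> R).

Lemma integral_counting_fin (a : nat -> R) m : (forall k, (m <= k)%N -> a k = 0) ->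
  (\int[counting]_k (a k)%:E = (\sum_(k < m) a k)%:E :> \bar R)%E.
Proof.
move=> am0.
have pos (b : nat -> R) : (forall k, 0 <= b k) -> (forall k, (m <= k)%N -> b k = 0) ->
    (\int[counting]_k (b k)%:E = (\sum_(k < m) b k)%:E :> \bar R)%E.
  move=> b0 bm0; rewrite ge0_integral_count; last by move=> k; rewrite lee_fin.
  apply: lim_near_cst => //; exists m => // n /= mn.
  rewrite sumEFin big_mkord; congr EFin.
  rewrite [RHS](big_ord_widen _ b mn) [RHS]big_mkcond/=.
  by apply: eq_bigr => i _; case: ltnP => // /bm0.
rewrite integralE.
under eq_integral do rewrite funeposE -EFin_max.
under [X in (_ - X)%E]eq_integral do rewrite funenegE -EFinN -EFin_max.
rewrite !pos; last 4 first.
- by move=> k; rewrite le_max lexx orbT.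
- by move=> k /am0 ->; rewrite oppr0 maxxx.
- by move=> k; rewrite le_max lexx orbT.
- by move=> k /am0 ->; rewrite maxxx.
rewrite -EFinB -sumrB; congr EFin; apply: eq_bigr => k _.
by rewrite maxEle; case: leP => k0; rewrite maxEle; case: leP => // k0'; lra.
Qed.

(* A point process is handled as a measure on the space of (rank, outcome)
   pairs, a pair being sent to the time of the jump of this rank. *)
Definition mark (q : nat * T) : R * T := (jump_time (N ^~ q.2) q.1.+1, q.2).

Lemma measurable_mark : measurable_fun [set: nat * T] mark.
Proof.
apply: measurable_fun_pair; last exact: measurable_snd.
move=> _ B mB; rewrite setTI.
rewrite (_ : _ @^-1` _ = \bigcup_k ([set k] `*`
   ((fun w => jump_time (N ^~ w) k.+1) @^-1` B))).
  apply: bigcup_measurable => k _; apply: measurableX => //.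
  by rewrite -[X in measurable X]setTI; apply: measurable_jump_time.
apply/seteqP; split => [[k w] /= Bkw|[k w] [j _ [/= <-]]]//.
by exists k.
Qed.

Lemma measurable_cut_mark t H : t <= 1 -> measurable_process H ->
  measurable_fun [set: nat * T] (fun q => cut t H (mark q)).
Proof.
by move=> t1 mH; apply: measurableT_comp measurable_mark; exact: measurable_cut.
Qed.

Lemma cut_mark t H k w : 0 <= t <= 1 ->
  cut t H (mark (k, w)) = if (k < N t w)%N then cut 1 H (jump_time (N ^~ w) k.+1, w) else 0.
Proof.
move=> t01; have [t0 t1] := andP t01; rewrite /cut /= jump_time_ge0 /=.
rewrite -(jump_time_le _ (cN.1 w) t01).
by case: ifP => // /le_trans/(_ t1) ->.
Qed.

(** Ranks above [N t w] have a jump time beyond [t], possibly the default 2, and [cut] discards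
    them. *)
Lemma sum_cut_mark t H w : 0 <= t <= 1 ->
  (\int[@nat_count R]_k (cut t H (mark (k, w)))%:E =
   (int_dN (H ^~ w) (N ^~ w) t)%:E)%E.
Proof.
move=> t01; rewrite int_dN_cut// (@integral_counting_fin _ (N t w)).
  by congr EFin; apply: eq_bigr => k _; rewrite cut_mark// ltn_ord.
by move=> k; rewrite cut_mark// leqNgt => /negbTE ->.
Qed.

Lemma abs_cut t H p : `|cut t H p| = cut t (fun s w => `|H s w|) p.
Proof. by rewrite /cut; case: ifP => //; rewrite normr0. Qed.

Lemma ge0_integral_mark t H : 0 <= t <= 1 -> measurable_process H ->
  (forall p, 0 <= cut t H p) ->
  (\int[@nat_count R \x P]_q (cut t H (mark q))%:E =
   \int[P]_w (int_dN (H ^~ w) (N ^~ w) t)%:E)%E.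
Proof.
move=> t01 mH H0; rewrite (fubini_tonelli2 (fun q => (cut t H (mark q))%:E)).
- by apply: eq_integral => w _; rewrite /fubini_G sum_cut_mark.
- by apply/measurable_EFinP; apply: measurable_cut_mark => //; case/andP: t01.
- by move=> q; rewrite lee_fin.
Qed.

Lemma measurable_process_norm H : measurable_process H ->
  measurable_process (fun s w => `|H s w|).
Proof.
move=> mH; rewrite /measurable_process -(_ : (fun p => `|cut 1 H p|) = cut 1 _).
  exact: measurableT_comp.
by apply/funext => p; rewrite abs_cut.
Qed.

Lemma integrable_mark t H : 0 <= t <= 1 -> measurable_process H ->
  P.-integrable [set: T] (fun w => (int_dN (fun s => `|H s w|) (N ^~ w) t)%:E) ->
  (@nat_count R \x P)%E.-integrable [set: nat * T] (fun q => (cut t H (mark q))%:E).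
Proof.
move=> t01 mH /integrableP[mI ltI]; apply/integrableP; split.
  by apply/measurable_EFinP; apply: measurable_cut_mark => //; case/andP: t01.
under eq_integral do rewrite abse_EFin abs_cut.
rewrite ge0_integral_mark//.
- apply: le_lt_trans ltI; apply: ge0_le_integral => //.
  + move=> w _; rewrite lee_fin (int_dN_cut (fun s w => `|H s w|) _ cN t01); apply: sumr_ge0 => k _.
    by rewrite -abs_cut.
  + by apply: measurableT_comp.
  + by move=> w _; exact: lee_abs.
- exact: measurable_process_norm.
- by move=> p; rewrite -abs_cut.
Qed.

Lemma integral_mark t H : 0 <= t <= 1 -> measurable_process H ->
  P.-integrable [set: T] (fun w => (int_dN (fun s => `|H s w|) (N ^~ w) t)%:E) ->
  (\int[@nat_count R \x P]_q (cut t H (mark q))%:E =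
   \int[P]_w (int_dN (H ^~ w) (N ^~ w) t)%:E)%E.
Proof.
move=> t01 mH iH; rewrite -(integral21_prod_meas1 (f := fun q => (cut t H (mark q))%:E)).
  by apply: eq_integral => w _; rewrite /fubini_G sum_cut_mark.
exact: integrable_mark.
Qed.

Lemma le_int_dN H t w c : 0 <= t <= 1 ->
  (forall k, (k < N t w)%N -> `|H (jump_time (N ^~ w) k.+1) w| <= c) ->
  `|int_dN (H ^~ w) (N ^~ w) t| <= c * (N t w)%:R.
Proof.
move=> t01 Hc; rewrite int_dNE; [|by case: cN|by []].
apply: le_trans (ler_norm_sum _ _ _) _.
rewrite mulr_natr -[X in _ *+ X]card_ord -sumr_const.
by apply: ler_sum => k _; exact: Hc.
Qed.

End marks.

Section compensator.
Context {R : realType} {d : measure_display} {T : measurableType d}.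
Variables (P : probability T R) (F : R -> set (set T)) (N : R -> T -> nat).
Hypotheses (hF : is_filtration F) (cN : counting_process N).
Implicit Types (H l : R -> T -> R).

Local Notation kappa := (@unit_lebesgue R \x P)%E.

Lemma patch_cut d' (S : measurableType d') (p : S -> R * T) H :
  (fun x => (H (p x).1 (p x).2)%:E) \_ (p @^-1` (`[0, 1] `*` [set: T])) =
  (fun x => (cut 1 H (p x))%:E : \bar R).
Proof.
apply/funext => x; rewrite /patch /cut; case: ifPn => xD.
  by move: xD; rewrite inE /= => -[]; rewrite /= in_itv/= => ->.
rewrite ifF//; apply: contraNF xD => x01; rewrite inE /=.
by split => //=; rewrite in_itv.
Qed.

Lemma counting_path_mono (n : R -> nat) s t : counting_path n ->
  0 <= s -> s <= t -> t <= 1 -> (n s <= n t)%N.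
Proof. by case=> _ nm _ _; exact: nm. Qed.

Lemma int_dN_indic (s t : R) w : 0 <= s -> s <= t -> t <= 1 ->
  int_dN (fun u => (s < u)%R%:R) (N ^~ w) t = (N t w)%:R - (N s w)%:R.
Proof.
move=> s0 st t1; have t0 := le_trans s0 st; have s1 := le_trans st t1.
rewrite int_dNE ?t0//; last by case: cN.
rewrite (eq_bigr (fun k : 'I_(N t w) => (~~ (k.+1 <= N s w)%N)%:R)); last first.
  by move=> k _; rewrite ltNge (jump_time_le _ (cN.1 w)) ?s0.
have Nst : (N s w <= N t w)%N.
  by apply: (counting_path_mono (n := N ^~ w)) => //; case: cN.
rewrite -(big_mkord xpredT (fun k => (~~ (k.+1 <= N s w)%N)%:R)).
rewrite (big_cat_nat (leq0n _) Nst)//= big_nat_cond big1 ?add0r; last first.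
  by move=> k /andP[/andP[_ ->]].
rewrite big_nat_cond (eq_bigr (fun => 1)) => [|k /andP[/andP[]]]; last first.
  by rewrite leqNgt => /negbTE ->.
by rewrite -big_nat_cond sumr_const_nat natrB.
Qed.

(** The Doleans measures of [N] and of [l ds] agree on predictable rectangles; this is the form
    taken by the martingale property of the compensated process. *)
Definition compensates l : Prop := forall s t A, 0 <= s -> s < t -> t <= 1 -> F s A ->
  (\int[P]_(w in A) ((N t w)%:R - (N s w)%:R)%:E =
   \int[kappa]_(p in `]s, t] `*` A) (l p.1 p.2)%:E)%E.

Lemma filtration_measurable t A : 0 <= t <= 1 -> F t A -> measurable A.
Proof. by move=> t01; have [_] := hF.1 t t01; apply. Qed.

Lemma kappa_set0 A : measurable A -> kappa ([set 0] `*` A) = 0%E.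
Proof. by move=> mA; rewrite product_measure1E//= unit_lebesgue_set1 mul0e. Qed.

(** Each side integrates [H] against a Doleans measure: the image of rank times [P] under [mark],
    and the measure of density [l] with respect to [kappa]. Agreement on rectangles extends to
    predictable integrands. *)
Lemma compensated_integral l H : predictable F l ->
  P.-integrable [set: T] (fun w => (N 1 w)%:R%:E) ->
  kappa.-integrable [set: R * T] (fun p => (cut 1 l p)%:E) ->
  compensates l -> predictable F H ->
  P.-integrable [set: T] (fun w => (int_dN (fun s => `|H s w|) (N ^~ w) 1)%:E) ->
  kappa.-integrable [set: R * T] (fun p => (cut 1 (fun s w => H s w * l s w) p)%:E) ->
  (\int[P]_w (int_dN (H ^~ w) (N ^~ w) 1)%:E =
   \int[kappa]_p (cut 1 (fun s w => H s w * l s w) p)%:E)%E.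
Proof.
move=> pl iN il comp pH iH iHl.
have mH := predictable_measurable_process hF pH.
have I01 : 0 <= (1 : R) <= 1 by rewrite ler01 lexx.
have mm := measurable_mark cN.
have mD := @measurable_unit_slab R _ T.
have ml := predictable_measurable_process hF pl.
have mmD : measurable (mark N @^-1` (`[0, 1] `*` [set: T])).
  by rewrite -[X in measurable X]setTI; exact: mm.
rewrite -(integral_mark cN)//.
rewrite -(patch_cut (mark N)) -(patch_cut id (fun s w => H s w * l s w)).
rewrite -!integral_mkcond.
have := @predictable_integral_eq _ _ _ _ _ T R (@nat_count R \x P)%E kappa
  (mark N) id (cst 1) (fun p => l p.1 p.2) F mm (@measurable_id _ _ _) _ _ hF _ H pH.
under eq_integral do rewrite mulr1.
apply.
- apply/(integrable_mkcond _ mmD); rewrite (patch_cut (mark N) (fun _ _ => 1)).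
  apply: integrable_mark => //.
    by rewrite /measurable_process; apply/measurable_processP.
  under eq_fun do rewrite normr1.
  apply: eq_integrable iN => // w _; rewrite int_dNE//; last by case: cN.
  by rewrite sumr_const card_ord.
- by apply/(integrable_mkcond _ mD); rewrite (patch_cut id l).
- move=> Q [[A F0A <-]|[s [t [A [s0 st t1 FsA ->]]]]].
    have mA : measurable A by apply: filtration_measurable F0A; rewrite lexx ler01.
    have m0A : measurable ([set 0] `*` A : set (R * T)) by exact: measurableX.
    (* At time 0 both measures vanish: jump times are positive and a single instant is Lebesgue
       null. *)
    rewrite (_ : mark N @^-1` _ = set0); last first.
      apply/seteqP; split => [[k w] /= [/= k0 _]|//].
      by have := jump_time_gt0 (cN.1 w) (ltn0Sn k); rewrite k0 ltxx.
    rewrite integral_set0 preimage_id null_set_integral//; last exact: kappa_set0.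
    apply/measurable_EFinP.
    apply: (measurable_funS mD _ ((measurable_processP l).2 ml)).
    by move=> [u w] [/= -> _]; split => //=; rewrite in_itv/= lexx ler01.
  have s01 : 0 <= s <= 1 by rewrite s0 (le_trans (ltW st)).
  have mA : measurable A by exact: filtration_measurable FsA.
  have t01 : 0 <= t <= 1 by rewrite t1 (le_trans s0 (ltW st)).
  rewrite preimage_id -comp//.
  (* Counting the marks in the rectangle amounts to integrating the indicator of []s, t]] against
     [dN] on the event [A], that is, the increment of [N]. *)
  transitivity (\int[@nat_count R \x P]_q
      (cut t (fun u w => (s < u)%R%:R * \1_A w) (mark N q))%:E)%E.
    rewrite integral_mkcond; apply: eq_integral => -[k w] _.
    rewrite /patch /cut /mark /= jump_time_ge0/=.
    rewrite (_ : _ \in _ = (s < jump_time (N ^~ w) k.+1 <= t) && (w \in A)); last first.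
      apply/idP/idP; first by rewrite inE => -[/=]; rewrite in_itv/= => -> /mem_set.
      by move=> /andP[st' wA]; rewrite inE; split; [rewrite /= in_itv/=|exact: set_mem].
    rewrite indicE; case: (jump_time _ _ <= t); last by rewrite andbF.
    by rewrite andbT; case: (s < _) => //=; rewrite ?mul0r// mul1r; case: (w \in A).
  rewrite ge0_integral_mark//.
  - rewrite [RHS]integral_mkcond; apply: eq_integral => w _.
    rewrite /patch; rewrite indicE; case: (w \in A).
      under eq_fun do rewrite mulr1.
      by rewrite int_dN_indic// ltW.
    by rewrite int_dNE//; [rewrite big1// => k _; rewrite mulr0|case: cN].
  - apply/measurable_processP; apply: measurable_funTS; apply: measurable_funM.
      rewrite (_ : (fun p => _) = fun p : R * T => if s < p.1 then 1 else 0 : R).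
        apply: measurable_fun_ifT => //.
        by apply: measurable_fun_ltr => //; exact: measurable_fst.
      by apply/funext => p; case: (s < _).
    apply: (@measurableT_comp _ _ _ _ _ _ (\1_A : T -> R)); last exact: measurable_snd.
    exact: measurable_indic.
  - by move=> [u w]; rewrite /cut /=; case: ifP => // _; rewrite mulr_ge0.
- rewrite (_ : (fun x => _) = (fun x => (H (mark N x).1 (mark N x).2)%:E)).
  by apply/(integrable_mkcond _ mmD); rewrite (patch_cut (mark N) H); exact: integrable_mark.
  by apply/funext => x; rewrite mulr1.
- by apply/(integrable_mkcond _ mD); rewrite (patch_cut id (fun s w => H s w * l s w)).
Qed.

End compensator.

Section local_martingale.
Context {R : realType} {d : measure_display} {T : measurableType d}.
Variables (P : probability T R) (F : R -> set (set T)) (N : R -> T -> nat).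
Hypotheses (hF : is_filtration F) (cN : counting_process N).
Implicit Types (H l : R -> T -> R).

Local Notation kappa := (@unit_lebesgue R \x P)%E.

Lemma le_cut_norm u (l : R -> T -> R) p : u <= 1 -> `|cut u l p| <= `|cut 1 l p|.
Proof.
move=> u1; rewrite /cut; case: ifPn => [/andP[p0 pu]|_]; last by rewrite normr0.
by rewrite p0 (le_trans pu).
Qed.

(** Kept in the extended reals so that it dominates all the integrals [int_ds] of a path, whether or
    not that path is integrable. *)
Definition path_mass l (w : T) : \bar R :=
  (\int[unit_lebesgue]_s `|(cut 1 l (s, w))%:E|)%E.

Lemma path_mass_ge0 l w : (0 <= path_mass l w)%E.
Proof. exact: integral_ge0. Qed.

Lemma le_int_ds l u w : measurable_process l -> u <= 1 ->
  (`|(int_ds (l ^~ w) u)%:E| <= path_mass l w)%E.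
Proof.
move=> ml u1; rewrite int_ds_cut//.
(* Since [fine] sends infinite values to 0, the estimate survives for paths that are not
   integrable. *)
have fle (x : \bar R) : (`|(fine x)%:E| <= `|x|)%E.
  by case: x => [r| |] //=; rewrite normr0 leey.
apply: le_trans (fle _) _.
have mc v : v <= 1 -> measurable_fun [set: R] (fun s => (cut v l (s, w))%:E).
  by move=> v1; apply/measurable_EFinP; exact: measurable_section_cut.
apply: le_trans (le_abse_integral _ _ _) _ => //; first exact: mc.
apply: ge0_le_integral => //.
- by apply: measurableT_comp => //; exact: mc.
- by apply: measurableT_comp => //; exact: mc.
- by move=> s _; rewrite lee_fin le_cut_norm.
Qed.

Lemma integrable_path_mass l : kappa.-integrable [set: R * T] (fun p => (cut 1 l p)%:E) ->
  P.-integrable [set: T] (path_mass l).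
Proof.
move=> /integrableP[ml il].
have ma : measurable_fun [set: R * T] (fun p => `|(cut 1 l p)%:E|%E) by exact: measurableT_comp.
apply/integrableP; split.
  exact: (@measurable_fun_fubini_tonelli_G _ _ _ _ _ unit_lebesgue _ ma).
under eq_integral do rewrite gee0_abs ?path_mass_ge0//.
by rewrite -(fubini_tonelli2 (fun p => `|(cut 1 l p)%:E|%E)).
Qed.

Lemma integrable_le_fun (f : T -> R) (g : T -> \bar R) (A : set T) :
  measurable A -> measurable_fun [set: T] f -> P.-integrable [set: T] g ->
  (forall w, `|(f w)%:E| <= g w)%E -> P.-integrable A (EFin \o f).
Proof.
move=> mA mf ig fg; apply: (integrableS measurableT) => //.
apply: (le_integrable _ _ _ ig) => //; first exact/measurable_EFinP.
by move=> w _; apply: le_trans (fg w) (lee_abs _).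
Qed.

(* The increments stopped at [tau k] have mean zero and are dominated by
   2 (N_1 + \int |l|). *)
Lemma local_martingale_increment (tau : nat -> T -> R) l s t A :
  measurable_process l ->
  (forall k w, 0 <= tau k w) ->
  {ae P, forall w, forall k, tau k w <= tau k.+1 w} ->
  {ae P, forall w, exists k, 1 <= tau k w} ->
  let X u w := (N u w)%:R - int_ds (l ^~ w) u in
  (forall k, martingale P F (fun u w => X (Num.min u (tau k w)) w)) ->
  P.-integrable [set: T] (fun w => (N 1 w)%:R%:E) ->
  kappa.-integrable [set: R * T] (fun p => (cut 1 l p)%:E) ->
  0 <= s -> s <= t -> t <= 1 -> F s A ->
  (\int[P]_(w in A) (X t w - X s w)%:E = 0)%E.
Proof.
move=> ml tau0 tau_mono tau1 X mart iN il s0 st t1 FsA.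
have t0 := le_trans s0 st; have s1 := le_trans st t1.
have mA : measurable A by apply: filtration_measurable FsA => //; rewrite s0.
pose f k w := X (Num.min t (tau k w)) w - X (Num.min s (tau k w)) w.
have ce k : is_condexp P (F s) (fun w => X (Num.min t (tau k w)) w)
    (fun w => X (Num.min s (tau k w)) w) by have [_] := mart k; apply.
have if0 k : (\int[P]_(w in A) (f k w)%:E = 0)%E.
  have [i1 i2 _ /(_ A FsA) e] := ce k.
  have i1A : P.-integrable A (EFin \o (fun w => X (Num.min t (tau k w)) w)).
    exact: (integrableS measurableT mA (@subsetT _ A) i1).
  have i2A : P.-integrable A (EFin \o (fun w => X (Num.min s (tau k w)) w)).
    exact: (integrableS measurableT mA (@subsetT _ A) i2).
  rewrite /f; under eq_integral do rewrite EFinB.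
  rewrite (integralB_EFin mA i1A i2A).
  rewrite e.
  apply: subee.
  exact: (integrable_fin_num mA i2A).
pose g w := (2%:E * ((N 1 w)%:R%:E + path_mass l w))%E.
have ig : P.-integrable [set: T] g.
  by apply: integrableZl => //; apply: integrableD => //; exact: integrable_path_mass.
have boundX u w : 0 <= u -> u <= 1 -> (`|(X u w)%:E| <= (N 1 w)%:R%:E + path_mass l w)%E.
  move=> u0 u1; rewrite /X EFinB; apply: le_trans (lee_abs_sub _ _) _.
  apply: leeD; last exact: le_int_ds.
  rewrite abse_EFin lee_fin ger0_norm// ler_nat.
  by apply: (counting_path_mono (n := N ^~ w)) => //; case: cN.
have mX u : 0 <= u -> u <= 1 -> measurable_fun [set: T] (X u).
  move=> u0 u1; apply: measurable_funB; last exact: measurable_int_ds.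
  by apply: cN.2; rewrite u0.
have [] := @dominated_convergence _ _ _ P A mA (fun k w => (f k w)%:E)
  (fun w => (X t w - X s w)%:E) g.
- move=> k; have [/measurable_int/measurable_EFinP m1 /measurable_int/measurable_EFinP m2 _ _] := ce k.
  by apply/measurable_EFinP/measurable_funTS; exact: measurable_funB.
- by apply/measurable_EFinP/measurable_funTS; apply: measurable_funB; apply: mX.
- apply: filterS2 tau_mono tau1 => w mono [k0 k1] _.
  apply: cvg_near_cst; exists k0 => // k /= kk0.
  have tk : 1 <= tau k w.
    apply: le_trans k1 _; elim: k kk0 => [|k IH]; first by rewrite leqn0 => /eqP ->.
    by rewrite leq_eqVlt => /orP[/eqP ->//|]; rewrite ltnS => /IH/le_trans; apply.
  by rewrite /f !min_l// (le_trans _ tk).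
- exact: (integrableS measurableT mA (@subsetT _ A) ig).
- apply: aeW => w k _; rewrite /f /g EFinB; apply: le_trans (lee_abs_sub _ _) _.
  rewrite (_ : 2%:E = 1%:E + 1%:E)%E; last by rewrite -EFinD.
  rewrite ge0_muleDl// !mul1e; apply: leeD; apply: boundX;
    by rewrite ?le_min ?tau0 ?andbT// ge_min ?t1 ?s1.
move=> _ _; rewrite (_ : [sequence _]_n = cst 0%E).
  by move/(cvg_unique (@ereal_hausdorff R) (cvg_cst 0%E)).
by apply/funext => k /=; rewrite if0.
Qed.

(** Under the integrability hypotheses the increments of the local martingale have mean zero on
    events of [F s]. Fubini then identifies the mean increment of [int_ds] with the integral of [l]
    over the rectangle, [cut t l - cut s l] being [l] restricted to []s, t]]. *)
Lemma intensity_compensates l : is_intensity P F N l ->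
  P.-integrable [set: T] (fun w => (N 1 w)%:R%:E) ->
  kappa.-integrable [set: R * T] (fun p => (cut 1 l p)%:E) ->
  compensates P F N l.
Proof.
move=> [pl _ [tau [stau tau_mono tau1 mart]]] iN il s t A s0 st t1 FsA.
have ml := predictable_measurable_process hF pl.
have t0 := le_trans s0 (ltW st); have s1 := le_trans (ltW st) t1.
have mA : measurable A by apply: filtration_measurable FsA => //; rewrite s0.
have := @local_martingale_increment tau l s t A ml (fun k => (stau k).1)
  tau_mono tau1 mart iN il s0 (ltW st) t1 FsA.
have mN u : 0 <= u -> u <= 1 -> measurable_fun [set: T] (fun w => (N u w)%:R : R).
  by move=> u0 u1; apply: cN.2; rewrite u0.
have mds u : u <= 1 -> measurable_fun [set: T] (fun w => int_ds (l ^~ w) u).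
  by move=> u1; exact: measurable_int_ds.
have i1 : P.-integrable A (EFin \o (fun w => (N t w)%:R - (N s w)%:R)).
  apply: (integrable_le_fun _ _ iN) => //; first by apply: measurable_funB; exact: mN.
  move=> w; have nst : (N s w <= N t w)%N.
    by apply: (counting_path_mono (n := N ^~ w)) => //; [case: cN|exact: ltW].
  rewrite abse_EFin lee_fin -natrB// ger0_norm// ler_nat (leq_trans (leq_subr _ _))//.
  by apply: (counting_path_mono (n := N ^~ w)) => //; case: cN.
have i2 : P.-integrable A (EFin \o (fun w => int_ds (l ^~ w) t - int_ds (l ^~ w) s)).
  apply: (@integrable_le_fun _ (fun w => path_mass l w + path_mass l w)%E) => //.
  - by apply: measurable_funB; exact: mds.
  - by apply: integrableD => //; exact: integrable_path_mass.
  - move=> w; rewrite EFinB; apply: le_trans (lee_abs_sub _ _) _.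
    by apply: leeD; exact: le_int_ds.
rewrite (eq_integral (fun w => ((N t w)%:R - (N s w)%:R)%:E -
    (int_ds (l ^~ w) t - int_ds (l ^~ w) s)%:E)%E); last first.
  by move=> w _; rewrite -EFinB; congr EFin; rewrite opprB addrACA -opprB opprK; ring.
have fin1 := integrable_fin_num mA i1; have fin2 := integrable_fin_num mA i2.
rewrite (integralB_EFin mA i1 i2) => e0.
have -> : (\int[P]_(w in A) ((N t w)%:R - (N s w)%:R)%:E =
    \int[P]_(w in A) (int_ds (l ^~ w) t - int_ds (l ^~ w) s)%:E)%E.
  move: e0; rewrite -(fineK fin1) -(fineK fin2) -EFinB => -[] /eqP.
  by rewrite subr_eq0 => /eqP ->.
have mstA : measurable (`]s, t] `*` A : set (R * T)) by exact: measurableX.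
pose h (p : R * T) := (cut t l p - cut s l p) * \1_A p.2.
have hE : (fun p => (l p.1 p.2)%:E) \_ (`]s, t] `*` A) = (fun p : R * T => (h p)%:E : \bar R).
  apply/funext => -[u w]; rewrite /patch /h /cut /= indicE.
  have [wA|wA] := boolP (w \in A); last first.
    rewrite mulr0 memNset// => -[_ /= Aw]; by rewrite mem_set in wA.
  rewrite mulr1; have [u0|u0] := leP 0 u; last first.
    rewrite subrr memNset// => -[/=]; rewrite in_itv/= => /andP[su _] _.
    by move: (lt_trans su u0); rewrite ltNge s0.
  have [us|us] := leP u s.
    rewrite (le_trans us (ltW st)) subrr memNset// => -[/=].
    by rewrite in_itv/= ltNge us.
  rewrite subr0; have [ut|ut] := leP u t.
    rewrite mem_set//; split; last exact: set_mem.
    by rewrite /= in_itv/= us.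
  by rewrite memNset// => -[/=]; rewrite in_itv/= us leNgt ut.
have ih : kappa.-integrable [set: R * T] (fun p => (h p)%:E).
  rewrite -hE -integrable_mkcond//.
  have mD := @measurable_unit_slab R _ T.
  apply: (integrableS mD) => //.
    move=> [u w] [/=]; rewrite in_itv/= => /andP[su ut] _; split => //=.
    by rewrite in_itv/= (le_trans s0 (ltW su)) (le_trans ut).
  by apply/(integrable_mkcond _ mD); rewrite (patch_cut id l).
rewrite [RHS]integral_mkcond hE -(integral21_prod_meas1 ih) [LHS]integral_mkcond.
apply: ae_eq_integral => //.
- apply/(measurable_restrictT _ mA).1; apply/measurable_EFinP/measurable_funTS.
  by apply: measurable_funB; exact: mds.
- exact: (measurable_fubini_G ih).
have := ae_integrable2 il; apply: filterS => w iw _.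
have icut u : u <= 1 -> unit_lebesgue.-integrable [set: R] (fun s => (cut u l (s, w))%:E).
  move=> u1; apply: (le_integrable _ _ _ iw) => //.
    by apply/measurable_EFinP; exact: measurable_section_cut.
  by move=> x _; rewrite lee_fin le_cut_norm.
rewrite /fubini_G /h /patch /= indicE; case: ifPn => wA; last first.
  by rewrite integral0_eq// => x _; rewrite mulr0.
under eq_integral do rewrite mulr1.
rewrite [RHS](integralB_EFin measurableT (icut _ t1) (icut _ s1)).
rewrite !int_ds_cut// EFinB !fineK//; apply: integrable_fin_num => //; exact: icut.
Qed.

End local_martingale.

(** * Moments of a counting process with bounded intensity *)

Section limn_einf_bounds.
Context {R : realType}.
Implicit Types (u : (\bar R)^nat) (b : \bar R).

Lemma limn_einf_le u b : (forall n, (u n <= b)%E) -> (limn_einf u <= b)%E.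
Proof.
move=> ub; rewrite limn_einf_lim; apply: lime_le; first exact: is_cvg_einfs.
near=> n; apply: le_trans (ub n); apply: ereal_inf_lbound.
by exists n => /=.
Unshelve. all: by end_near. Qed.

Lemma limn_einf_ge u b : (\forall n \near \oo, (b <= u n)%E) -> (b <= limn_einf u)%E.
Proof.
move=> [n0 _ bu]; rewrite limn_einf_lim; apply: lime_ge; first exact: is_cvg_einfs.
exists n0 => // n /= nn; apply: le_ereal_inf_tmp => _ [m /= nm <-].
by apply: bu; exact: leq_trans nm.
Qed.

End limn_einf_bounds.

Section ae_lemmas.
Context {R : realType} {d : measure_display} {T : measurableType d}.
Variable mu : {measure set T -> \bar R}.

Lemma ae_le_integral (f g : T -> R) : mu.-integrable [set: T] (EFin \o f) ->
  mu.-integrable [set: T] (EFin \o g) -> {ae mu, forall x, f x <= g x} ->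
  (\int[mu]_x (f x)%:E <= \int[mu]_x (g x)%:E)%E.
Proof.
move=> intf intg fg.
have mf : measurable_fun [set: T] f by apply/measurable_EFinP; exact: measurable_int intf.
have mg : measurable_fun [set: T] g by apply/measurable_EFinP; exact: measurable_int intg.
have mh : measurable_fun [set: T] (EFin \o (fun x => Num.min (f x) (g x))).
  by apply/measurable_EFinP; exact: measurable_minr.
have fh : ae_eq mu [set: T] (EFin \o f) (EFin \o (fun x => Num.min (f x) (g x))).
  by apply: filterS fg => x fgx _ /=; rewrite min_l.
rewrite (ae_eq_integral _ _ measurableT _ _ fh)//; last exact/measurable_EFinP.
apply: le_integral => //.
  have [_ h] := integrableP _ _ _ intf.
  apply/integrableP; split => //.
  rewrite (ae_eq_integral _ _ measurableT _ _ (ae_eq_abse (ae_eq_sym fh)))//.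
  - exact: measurableT_comp.
  - by apply: measurableT_comp => //; exact/measurable_EFinP.
by move=> x _; rewrite lee_fin ge_min lexx orbT.
Qed.

End ae_lemmas.

Section ae_product.
Context {R : realType} {d1 d2 : measure_display} {T1 : measurableType d1}
  {T2 : measurableType d2}.
Variables (P1 : probability T1 R) (P2 : probability T2 R).

Lemma ae_product2 (Q : T2 -> Prop) : {ae P2, forall y, Q y} ->
  {ae (P1 \x P2)%E, forall p, Q p.2}.
Proof.
move=> [A [mA A0 QA]]; exists ([set: T1] `*` A); split.
- exact: measurableX.
- by rewrite product_measure1E//= A0 mule0.
- by move=> [x y] /= nQ; split => //=; apply: QA.
Qed.

Lemma product_probability_setT : (P1 \x P2)%E setT = 1%E.
Proof. by rewrite -setXTT product_measure1E//= !probability_setT mule1. Qed.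

Lemma integrable_product_cst (c : R) :
  (P1 \x P2)%E.-integrable [set: T1 * T2] (EFin \o cst c).
Proof.
apply/integrableP; split; first by apply/measurable_EFinP.
by rewrite (eq_integral (cst `|c%:E|))%E// integral_cst//= product_probability_setT mule1 ltry.
Qed.

End ae_product.

Section constant_process.
Context {R : realType} {d : measure_display} {T : measurableType d}.
Implicit Types H : R -> T -> R.

Lemma measurable_process_cst (c : R) : measurable_process (fun (_ : R) (_ : T) => c).
Proof. by apply/measurable_processP. Qed.

Lemma integrable_cut_cst (z : T) (c : R) :
  unit_lebesgue.-integrable [set: R] (fun s => (cut 1 (fun _ _ => c) (s, z))%:E).
Proof.
apply: (@le_integrable _ _ _ _ _ measurableT _ (EFin \o cst c)) => //.
  apply/measurable_EFinP; apply: measurable_section_cut => //.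
  exact: measurable_process_cst.
  by move=> s _; rewrite lee_fin /cut /=; case: ifP => // _; rewrite normr0.
exact: finite_measure_integrable_cst.
Qed.

Lemma integral_cut_cst (z : T) (c : R) :
  (\int[unit_lebesgue]_s (cut 1 (fun _ _ => c) (s, z))%:E = c%:E)%E.
Proof.
rewrite -(integral_cut (H := fun _ _ => c))//; last first.
  exact: measurable_process_cst.
by rewrite integral_cst//= lebesgue_measure_itv/= lte_fin ltr01 oppr0 adde0 mule1.
Qed.

Lemma integrable_cut_path H w : measurable_process H ->
  lebesgue_measure.-integrable `[0, 1] (fun s : R => (H s w)%:E) ->
  unit_lebesgue.-integrable [set: R] (fun s => (cut 1 H (s, w))%:E).
Proof.
move=> mH /integrableP[_ fin]; apply/integrableP; split.
  by apply/measurable_EFinP; exact: measurable_section_cut.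
under eq_integral do rewrite abse_EFin abs_cut.
rewrite -integral_cut//; exact: measurable_process_norm.
Qed.

End constant_process.

Section bounded_intensity.
Context {R : realType} {d : measure_display} {T : measurableType d}.
Variables (P : probability T R) (F : R -> set (set T)) (N : R -> T -> nat).
Hypotheses (hF : is_filtration F) (cN : counting_process N).
Variables (l : R -> T -> R) (C : R).
Hypotheses (C0 : 0 <= C) (intens : is_intensity P F N l).
Hypothesis lC : {ae P, forall w, forall t, 0 <= t <= 1 -> l t w <= C}.

Local Notation kappa := (@unit_lebesgue R \x P)%E.

Let ml : measurable_process l.
Proof. by case: intens => pl _ _; exact: predictable_measurable_process pl. Qed.

(** Almost surely this is [C - l]; the maximum matters on a null set only. Being nonnegative
    everywhere, it has an integral before [l] is known to be integrable. *)
Let defect (s : R) (w : T) : R := Num.max (C - l s w) 0.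

Let m_defect : measurable_process defect.
Proof.
apply: (measurable_process_op2 (op := fun x y => Num.max (C - x) y)
  (K := fun _ _ => 0)) => //; last by apply/measurable_processP.
apply: measurable_maxr; last exact: measurable_snd.
by apply: measurable_funB => //; exact: measurable_fst.
Qed.

Let cut_defect_ge0 p : 0 <= cut 1 defect p.
Proof. by rewrite /cut; case: ifP => // _; rewrite le_max lexx orbT. Qed.

Let mdefect (w : T) : \bar R := (\int[unit_lebesgue]_s (cut 1 defect (s, w))%:E)%E.

Let mdefect_ge0 w : (0 <= mdefect w)%E.
Proof. by apply: integral_ge0 => s _; rewrite lee_fin. Qed.

Let mdefect_meas : measurable_fun [set: T] mdefect.
Proof.
apply: (@measurable_fun_fubini_tonelli_G _ _ _ _ _ unit_lebesgue
  (fun p => (cut 1 defect p)%:E)) => //.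
exact/measurable_EFinP.
Qed.

Let int_ds_le u w : lebesgue_measure.-integrable `[0, 1] (fun s : R => (l s w)%:E) ->
  (forall t, 0 <= t <= 1 -> l t w <= C) -> u <= 1 -> int_ds (l ^~ w) u <= C.
Proof.
move=> il lw u1; rewrite int_ds_cut//.
have ic := integrable_cut_path ml il.
have icu : unit_lebesgue.-integrable [set: R] (fun s => (cut u l (s, w))%:E).
  apply: (le_integrable _ _ _ ic) => //.
    by apply/measurable_EFinP; exact: measurable_section_cut.
  by move=> x _; rewrite lee_fin le_cut_norm.
rewrite -lee_fin fineK; last exact: (integrable_fin_num measurableT icu).
rewrite -(integral_cut_cst w C); apply: le_integral => //.
  exact: integrable_cut_cst.
move=> s _; rewrite lee_fin /cut /=; case: ifPn => [/andP[s0 su]|_].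
  by rewrite s0 (le_trans su)//= lw// s0 (le_trans su).
by case: ifP.
Qed.

Let int_ds_defect w : lebesgue_measure.-integrable `[0, 1] (fun s : R => (l s w)%:E) ->
  (forall t, 0 <= t <= 1 -> l t w <= C) ->
  ((C - int_ds (l ^~ w) 1)%:E = mdefect w)%E.
Proof.
move=> il lw; rewrite int_ds_cut//.
have ic := integrable_cut_path ml il.
rewrite EFinB fineK; last exact: (integrable_fin_num measurableT ic).
rewrite -{1}(integral_cut_cst w C) -(integralB_EFin measurableT _ ic)//.
  apply: eq_integral => s _; rewrite -EFinB /cut /defect /=.
  case: ifP => [s01|_]; last by rewrite subrr.
  by rewrite max_l// subr_ge0 lw.
exact: integrable_cut_cst.
Qed.

(* The stopped local martingales are bounded below by -C, which allows Fatou's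
   lemma along the localizing sequence. *)
Lemma expectation_count_le : (\int[P]_w (N 1 w)%:R%:E <= C%:E)%E /\
  kappa.-integrable [set: R * T] (fun p => (cut 1 l p)%:E).
Proof.
have [pl il [tau [stau tau_mono tau1 mart]]] := intens.
pose X u w := (N u w)%:R - int_ds (l ^~ w) u.
have tau0 k w : 0 <= tau k w by exact: (stau k).1.
have X0 w : X 0 w = 0.
  rewrite /X; case: (cN.1 w) => -> _ _ _.
  by rewrite /int_ds set_itv1 Rintegral_set1 subrr.
have iX k : P.-integrable [set: T] (EFin \o (fun w => X (Num.min 1 (tau k w)) w)).
  by have [_ /(_ 0 1 (lexx _) ler01 (lexx _))[]] := mart k.
have EX k : (\int[P]_w (X (Num.min 1 (tau k w)) w)%:E = 0)%E.
  have [_ /(_ 0 1 (lexx _) ler01 (lexx _))[_ _ _]] := mart k.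
  have FT : F 0 setT.
    have [[F0 FC _] _] : sigma_algebra [set: T] (F 0) /\ F 0 `<=` measurable.
      by apply: (hF.1 0); rewrite lexx ler01.
    by rewrite -(setD0 [set: T]); exact: FC.
  move=> /(_ _ FT) ->; rewrite integral0_eq// => w _.
  by rewrite min_l// -/(X 0 w) X0.
(* Almost surely the maximum is [X + C] at the stopped time, as [N >= 0] and the integral of [l] is
   at most [C]; hence each [g k] has mean exactly [C]. *)
pose g k w := (Num.max (X (Num.min 1 (tau k w)) w + C) 0)%:E.
have mX k : measurable_fun [set: T] (fun w => X (Num.min 1 (tau k w)) w).
  by apply/measurable_EFinP; exact: measurable_int (iX k).
have mg k : measurable_fun [set: T] (g k).
  apply/measurable_EFinP; apply: measurable_maxr => //; exact: measurable_funD.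
have g0 k w : (0 <= g k w)%E by rewrite lee_fin le_max lexx orbT.
have Eg k : (\int[P]_w g k w = C%:E)%E.
  transitivity (\int[P]_w ((X (Num.min 1 (tau k w)) w)%:E + C%:E))%E.
    apply: ae_eq_integral => //.
      by apply: emeasurable_funD => //; exact/measurable_EFinP.
    apply: filterS2 il lC => w ilw lw _; rewrite /g -EFinD max_l//.
    rewrite /X -addrA addr_ge0// addrC subr_ge0.
    by apply: int_ds_le => //; rewrite ge_min lexx.
  rewrite integralD//; [|exact: iX|exact: finite_measure_integrable_cst].
  by rewrite EX add0e integral_cst//= probability_setT mule1.
(* This is almost surely [X 1 w + C], the limit of [g]. Fatou bounds its mean by [C], and thereby
   controls the count and the defect at once. *)
pose Y w := ((N 1 w)%:R%:E + mdefect w)%E.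
have mN1 : measurable_fun [set: T] (fun w => (N 1 w)%:R : R).
  by apply: cN.2; rewrite ler01 lexx.
have mN1E : measurable_fun [set: T] (fun w => (N 1 w)%:R%:E : \bar R).
  exact/measurable_EFinP.
have EY : (\int[P]_w Y w <= C%:E)%E.
  have -> : (\int[P]_w Y w = \int[P]_w limn_einf (g ^~ w))%E.
    apply: ae_eq_integral => //.
    - exact: emeasurable_funD.
    - rewrite (_ : (fun w => _) = (fun w => - limn_esup (fun k => - g k w))%E).
        apply: measurableT_comp => //; apply: measurable_fun_limn_esup.
        by move=> j; exact: measurableT_comp.
      by apply/funext => w; rewrite [in RHS](limn_esupN (g ^~ w)) oppeK.
    - apply: filterS3 (filterI il lC) tau_mono tau1 => w [ilw lw] mono [k0 k1] _.
      apply/esym; rewrite (@cvg_limn_einf_sup _ _ (Y w))//.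
      apply: cvg_near_cst; exists k0 => // k /= kk0.
      have tk : 1 <= tau k w.
        apply: le_trans k1 _; elim: k kk0 => [|k IH]; first by rewrite leqn0 => /eqP ->.
        by rewrite leq_eqVlt => /orP[/eqP ->//|]; rewrite ltnS => /IH/le_trans; apply.
      rewrite /g min_l// /Y -int_ds_defect// -EFinD /X max_l.
        by rewrite -addrA [- _ + _]addrC.
      by rewrite -addrA addr_ge0// addrC subr_ge0; exact: int_ds_le.
  apply: le_trans (fatou _ measurableT mg _) _ => //.
  rewrite (_ : (fun k => _) = cst C%:E); last by apply/funext => k.
  by rewrite (@cvg_limn_einf_sup _ _ C%:E)//; exact: cvg_cst.
have EN : (\int[P]_w (N 1 w)%:R%:E + \int[P]_w mdefect w <= C%:E)%E.
  by rewrite -ge0_integralD.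
have N0 : (0 <= \int[P]_w (N 1 w)%:R%:E)%E by exact: integral_ge0.
have D0 : (0 <= \int[P]_w mdefect w)%E by exact: integral_ge0.
split; first by apply: le_trans EN; rewrite leeDl.
have mcl : measurable_fun [set: R * T] (fun p => (cut 1 l p)%:E) by exact/measurable_EFinP.
apply/integrable21ltyP => //.
(* From [l <= C] and [0 <= C] follows [|l| <= C + (C - l)], even where [l] is negative, so the
   finite mean of the defect makes [l] integrable. *)
apply: (@le_lt_trans _ _ (\int[P]_w (C%:E + mdefect w))%E).
  apply: ae_ge0_le_integral => //.
  - by move=> w _; exact: integral_ge0.
  - apply: (@measurable_fun_fubini_tonelli_G _ _ _ _ _ unit_lebesgue
      (fun p => `|(cut 1 l p)%:E|)%E) => //; exact: measurableT_comp.
  - by move=> w _; rewrite adde_ge0.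
  - exact: emeasurable_funD.
  - apply: filterS lC => w lw _; rewrite -{1}(integral_cut_cst w C) -ge0_integralD//.
    + apply: ge0_le_integral => //.
      * by apply/measurable_EFinP; apply: measurableT_comp => //; exact: measurable_section_cut.
      * apply: emeasurable_funD; apply/measurable_EFinP; apply: measurable_section_cut => //.
        exact: measurable_process_cst.
      * move=> s _; rewrite -EFinD lee_fin /cut/=; case: ifP => [s01|_]; last by rewrite normr0 addr0.
        have := lw _ s01; rewrite /defect => ls; rewrite max_l ?subr_ge0//.
        by rewrite ler_norml; apply/andP; split; move: C0 ls; set y := l s w => *; lra.
    + by move=> s _; rewrite lee_fin /cut/=; case: ifP.
    + by apply/measurable_EFinP; apply: measurable_section_cut => //; exact: measurable_process_cst.
    + by move=> s _; rewrite lee_fin.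
    + by apply/measurable_EFinP; exact: measurable_section_cut.
rewrite ge0_integralD// integral_cst//= probability_setT mule1.
rewrite lte_add_pinfty ?ltry//; apply: le_lt_trans (ltry C); apply: le_trans EN.
by rewrite leeDr.
Qed.

End bounded_intensity.

Section second_moment.
Context {R : realType} {d : measure_display} {T : measurableType d}.
Variables (P : probability T R) (F : R -> set (set T)) (N : R -> T -> nat).
Hypotheses (hF : is_filtration F) (cN : counting_process N).
Hypothesis aN : adapted F (fun t w => (N t w)%:R).
Variables (l : R -> T -> R) (C : R).
Hypotheses (C0 : 0 <= C) (intens : is_intensity P F N l).
Hypothesis lC : {ae P, forall w, forall t, 0 <= t <= 1 -> l t w <= C}.

Local Notation kappa := (@unit_lebesgue R \x P)%E.

Let after k (s : R) (w : T) : R := (jump_time (N ^~ w) k.+1 < s)%R%:R.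

(** The set of times strictly after the jump is a countable union, over the rationals [q] in [0, 1),
    of rectangles []q, 1]] times the event that the jump occurred by time [q]. That event lies in
    the filtration at [q] by adaptedness. *)
Lemma predictable_after_jump k : predictable F (after k).
Proof.
pose D : set (R * T) := `[0, 1] `*` [set: T].
pose Q := D `&` [set p | jump_time (N ^~ p.2) k.+1 < p.1].
have PQ : predictable_sets F Q.
  pose A n : set (R * T) := if unpickle n is Some q then
    if 0 <= (ratr q : R) < 1 then `]ratr q, 1] `*` [set w | (k.+1 <= N (ratr q) w)%N]
    else set0 else set0.
  have -> : Q = \bigcup_n A n.
    apply/seteqP; split => [[s w] [[/= + _] ts]|[s w] [n _]].
      rewrite in_itv/= => /andP[s0 s1].
      have [q] := rat_in_itvoo ts; rewrite in_itv/= => /andP[tq qs].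
      have q0 : 0 <= (ratr q : R) by rewrite (le_trans (jump_time_ge0 _ _) (ltW tq)).
      have q1 : (ratr q : R) < 1 by rewrite (lt_le_trans qs).
      exists (pickle q); first exact: I.
      rewrite /A pickleK q0 q1; split; first by rewrite /= in_itv/= qs.
      by rewrite /= -(jump_time_le _ (cN.1 w)) ?q0 ?ltW.
    rewrite /A; case: unpickle => // q; case: ifPn => // /andP[q0 q1] [/=].
    rewrite in_itv/= => /andP[qs s1] Nq; split.
      by split => //=; rewrite in_itv/= s1 (le_trans q0 (ltW qs)).
    by apply: le_lt_trans qs; rewrite (jump_time_le _ (cN.1 w)) ?q0 ?ltW.
  apply: sigma_algebra_bigcup => n; rewrite /A; case: unpickle => [q|]; last exact: sigma_algebra0.
  case: ifPn => [/andP[q0 q1]|_]; last exact: sigma_algebra0.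
  apply: sub_sigma_algebra; right; exists (ratr q), 1, [set w | (k.+1 <= N (ratr q) w)%N].
  split => //.
  rewrite (_ : [set w | _] = (fun w => (N (ratr q) w)%:R : R) @^-1` `[k.+1%:R, +oo[%classic).
    by apply: aN; [rewrite q0 ltW|exact: measurable_itv].
  by apply/seteqP; split => w /=; rewrite in_itv/= andbT ler_nat.
have P0 := @sigma_algebra0 _ D (predictable_rectangles F).
have PD : predictable_sets F D by rewrite -(setD0 D); exact: sigma_algebraCD.
move=> B mB; rewrite -/(predictable_sets F) -/D.
have [B1|B1] := pselect (B 1); have [B0|B0] := pselect (B 0).
- rewrite (_ : D `&` _ = D)//; apply: setIidl => -[s w] _ /=.
  by rewrite /after; case: (_ < _).
- rewrite (_ : D `&` _ = Q)//; congr (_ `&` _); apply/seteqP; split => -[s w] /=;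
  by rewrite /after; case: (_ < _).
- rewrite (_ : D `&` _ = D `\` Q); first exact: sigma_algebraCD.
  apply/seteqP; split => -[s w] /= [Dsw]; rewrite /after.
    by move=> Bts; split => // -[_ /= ts]; rewrite ts in Bts.
  move=> nQ; split => //; have -> : (jump_time (N ^~ w) k.+1 < s) = false; last by [].
  by apply/negP => ts; apply: nQ; split.
- rewrite (_ : D `&` _ = set0)//; apply/seteqP; split => -[s w] //= [_].
  by rewrite /after; case: (_ < _).
Qed.

Let I01 : 0 <= (1 : R) <= 1. Proof. by rewrite ler01 lexx. Qed.

Let mN1 : measurable_fun [set: T] (fun w => (N 1 w)%:R : R).
Proof. exact: cN.2. Qed.

Let EN : (\int[P]_w (N 1 w)%:R%:E <= C%:E)%E.
Proof. by have [] := expectation_count_le hF cN C0 intens lC. Qed.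

Let iN : P.-integrable [set: T] (fun w => (N 1 w)%:R%:E).
Proof.
apply/integrableP; split; first exact/measurable_EFinP.
under eq_integral do rewrite abse_EFin ger0_norm//.
exact: le_lt_trans EN (ltry _).
Qed.

Let il : kappa.-integrable [set: R * T] (fun p => (cut 1 l p)%:E).
Proof. by have [] := expectation_count_le hF cN C0 intens lC. Qed.

Let pl : predictable F l. Proof. by case: intens. Qed.

Let ml : measurable_process l.
Proof. exact: predictable_measurable_process pl. Qed.

Let m_after k : measurable_process (after k).
Proof. exact: predictable_measurable_process (predictable_after_jump k). Qed.

Let after_ge0 k s w : 0 <= after k s w. Proof. by []. Qed.

Let cut_after_ge0 k p : 0 <= cut 1 (after k) p.
Proof. by rewrite /cut; case: ifP. Qed.

Let after_le1 k s w : after k s w <= 1.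
Proof. by rewrite /after; case: (_ < _). Qed.

Let i_after k : kappa.-integrable [set: R * T] (fun p => (cut 1 (after k) p)%:E).
Proof.
apply: (@le_integrable _ _ _ _ _ measurableT _ (EFin \o cst 1)) => //.
- by apply/measurable_EFinP; exact: m_after.
- move=> p _; rewrite lee_fin normr1 /cut; case: ifP => _; last by rewrite normr0.
  by rewrite ger0_norm.
- exact: integrable_product_cst.
Qed.

Let after_moment k :
  (\int[P]_w (int_dN (after k ^~ w) (N ^~ w) 1)%:E <=
   C%:E * \int[kappa]_p (cut 1 (after k) p)%:E)%E.
Proof.
have i1 : kappa.-integrable [set: R * T]
    (fun p => (cut 1 (fun s w => after k s w * l s w) p)%:E).
  apply: (le_integrable _ _ _ il) => //.
    by apply/measurable_EFinP; exact: (measurable_processM (m_after k) ml).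
  move=> p _; rewrite lee_fin /cut; case: ifP => // _.
  by rewrite normrM ger0_norm// ler_piMl.
rewrite (compensated_integral hF cN pl iN il)//.
- rewrite -integralZl//; under [leRHS]eq_integral do rewrite -EFinM.
  apply: ae_le_integral => //; first exact: (integrableZl measurableT C (i_after k)).
  apply: filterS (ae_product2 _ lC) => -[s w] /= lw; rewrite /cut /=.
  by case: ifPn => [s01|_]; [rewrite mulrC ler_wpM2r// lw|rewrite mulr0].
- exact: intensity_compensates.
- exact: predictable_after_jump.
- apply: (le_integrable _ _ _ iN) => //.
    apply/measurable_EFinP; apply: measurable_int_dN => //.
    exact: measurable_process_norm.
  move=> w _; rewrite lee_fin [leRHS]ger0_norm// -[leRHS]mul1r.
  apply: (le_int_dN (H := fun s w => `|after k s w|) cN I01) => // j _.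
  by rewrite normr_id ger0_norm.
Qed.

Lemma sum_ltn m n : (\sum_(0 <= k < m) (k < n) = minn m n)%N.
Proof.
elim: m => [|m IH]; first by rewrite big_geq// min0n.
by rewrite big_nat_recr//= IH; lia.
Qed.

Lemma measurable_sum_count (a : nat -> R) :
  measurable_fun [set: T] (fun w => \sum_(j < N 1 w) a j).
Proof.
apply: (@measurable_fun_cvg _ _ _ _ (fun m w => \sum_(j < m)
   if (j.+1 <= N 1%R w)%N then a j else 0)).
  move=> m; apply: measurable_sum => k; apply: measurable_fun_ifT => //.
  exact: measurable_counting_leq.
move=> w _; apply: cvg_near_cst; exists (N 1 w) => // m /= Nm.
by rewrite -big_mkcond/= [RHS](big_ord_widen _ a Nm).
Qed.

Lemma sum_after_le m p : \sum_(k < m) cut 1 (after k) p <= (N 1 p.2)%:R.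
Proof.
case: p => s w /=.
apply: (@le_trans _ _ (\sum_(k < m) ((k < N 1%R w)%N)%:R)).
  apply: ler_sum => k _; rewrite /cut /=; case: ifPn => // /andP[s0 s1].
  rewrite /after; case: ltP => // ts.
  rewrite (_ : (k < N 1%R w)%N)// -(jump_time_le _ (cN.1 w))//.
  exact: le_trans (ltW ts) s1.
rewrite -natr_sum ler_nat -(big_mkord xpredT (fun k => nat_of_bool (k < N 1%R w)%N)).
by rewrite sum_ltn geq_minr.
Qed.

(** At the jump of rank [j + 1] exactly the [j] earlier jumps lie strictly before, so the first [m]
    processes [after k] add up to at least [minn j m] there. *)
Lemma sum_after_jumps m w :
  \sum_(j < N 1 w) (minn j m)%:R <=
  \sum_(k < m) int_dN (after k ^~ w) (N ^~ w) 1 :> R.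
Proof.
rewrite [leRHS](eq_bigr (fun k : 'I_m => \sum_(j < N 1 w)
    after k (jump_time (N ^~ w) j.+1) w)); last first.
  by move=> k _; rewrite (int_dNE _ (cN.1 w)).
rewrite exchange_big/=; apply: ler_sum => j _.
apply: (@le_trans _ _ (\sum_(k < m) ((k < j)%N)%:R)).
  rewrite -natr_sum ler_nat -(big_mkord xpredT (fun k => nat_of_bool (k < j)%N)).
  by rewrite sum_ltn minnC.
apply: ler_sum => k _; case: ltnP => // kj; rewrite /after.
have jN : (0 < j.+1 <= N 1%R w)%N by rewrite ltn_ord.
have kN : (0 < k.+1 <= N 1%R w)%N by rewrite (ltn_trans kj).
rewrite ltNge (jump_time_le _ (cN.1 w)).
  have [_ ->] := jump_at_jump_time (cN.1 w) kN.
  by rewrite -ltnNge ltnS kj.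
by rewrite jump_time_ge0 (jump_time_le _ (cN.1 w)).
Qed.

(* N_1 (N_1 - 1) / 2 is the integral of the predictable process N_{s-}, the sum
   of the [after k], against N. *)
Lemma second_moment_count_le :
  (\int[P]_w ((N 1 w)%:R ^+ 2)%:E <= (C + 2 * C ^+ 2)%:E)%E.
Proof.
(* Truncation at [m] lets only finitely many processes [after k] enter, with a bound uniform in [m];
   Fatou removes the truncation. *)
pose S m w : R := \sum_(j < N 1 w) (minn j m)%:R.
have mS m : measurable_fun [set: T] (fun w => S m w)
  by exact: (measurable_sum_count (fun j => (minn j m)%:R)).
have ES m : (\int[P]_w (S m w)%:E <= (C ^+ 2)%:E)%E.
  apply: (@le_trans _ _ (\int[P]_w (\sum_(k < m) int_dN (after k ^~ w) (N ^~ w) 1)%:E)%E).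
    apply: ge0_le_integral => //.
    - by move=> w _; rewrite lee_fin sumr_ge0.
    - exact/measurable_EFinP.
    - apply/measurable_EFinP; apply: measurable_sum => k; exact: measurable_int_dN.
    - by move=> w _; rewrite lee_fin sum_after_jumps.
  under eq_integral do rewrite -sumEFin.
  rewrite ge0_integral_sum//; last 2 first.
  - by move=> k; apply/measurable_EFinP; exact: measurable_int_dN.
  - by move=> k w _; rewrite lee_fin (int_dNE _ (cN.1 w))// sumr_ge0.
  apply: (@le_trans _ _ (\sum_(k < m) (C%:E * \int[kappa]_p (cut 1 (after k) p)%:E))%E).
    exact: lee_sum.
  rewrite -ge0_sume_distrr; last first.
    by move=> k _; apply: integral_ge0 => p _; rewrite lee_fin.
  rewrite expr2 EFinM lee_wpmul2l ?lee_fin// -ge0_integral_sum//; last 2 first.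
  - by move=> k; apply/measurable_EFinP; exact: m_after.
  - by move=> k p _; rewrite lee_fin.
  apply: le_trans EN.
  have mN2 : measurable_fun [set: R * T] (fun p => (N 1 p.2)%:R%:E : \bar R).
    by apply/measurable_EFinP; apply: (measurableT_comp mN1); exact: measurable_snd.
  have -> : (\int[P]_w (N 1 w)%:R%:E = \int[kappa]_p (N 1 p.2)%:R%:E)%E.
    rewrite (fubini_tonelli2 (fun p => (N 1 p.2)%:R%:E))//.
    apply: eq_integral => w _; rewrite -[LHS]mule1.
    by rewrite -(@probability_setT _ _ _ (@unit_lebesgue R)) -integral_cst.
  apply: ge0_le_integral => //.
  - by move=> p _; apply: sume_ge0 => k _; rewrite lee_fin.
  - by apply: emeasurable_sum => k; apply/measurable_EFinP; exact: m_after.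
  - by move=> p _; rewrite sumEFin lee_fin sum_after_le.
have lim w : limn_einf (fun m => (S m w)%:E) = (\sum_(j < N 1 w) j%:R)%:E :> \bar R.
  rewrite (@cvg_limn_einf_sup _ _ (\sum_(j < N 1 w) j%:R)%:E)//.
  apply: cvg_near_cst; exists (N 1 w) => // m /= Nm; congr EFin.
  apply: eq_bigr => j _; congr (_%:R); apply/minn_idPl.
  exact: leq_trans (ltnW (ltn_ord j)) Nm.
(* The two terms have means at most [C] and [2 * C ^+ 2], the origin of the final constant. *)
have sq w : ((N 1 w)%:R ^+ 2 = (N 1 w)%:R + 2 * \sum_(j < N 1 w) j%:R :> R).
  elim: (N 1 w) => [|n IH]; first by rewrite big_ord0 expr2 !mulr0 addr0.
  by rewrite big_ord_recr/= mulrDr addrA -natr1 sqrrD IH; ring.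
have mq : measurable_fun [set: T] (fun w => \sum_(j < N 1 w) j%:R : R).
  exact: (measurable_sum_count (fun j => j%:R)).
have q0 w : (0 : R) <= \sum_(j < N 1 w) j%:R by exact: sumr_ge0.
have Eq : (\int[P]_w (\sum_(j < N 1 w) j%:R)%:E <= (C ^+ 2)%:E)%E.
  under eq_integral do rewrite -lim.
  apply: le_trans (fatou P measurableT _ _) _.
  - by move=> m; exact/measurable_EFinP.
  - by move=> m w _; rewrite lee_fin sumr_ge0.
  - exact: limn_einf_le.
under eq_integral do rewrite sq EFinD EFinM.
rewrite ge0_integralD//; last 3 first.
- exact/measurable_EFinP.
- by move=> w _; rewrite mule_ge0// lee_fin.
- by apply: emeasurable_funM => //; exact/measurable_EFinP.
rewrite ge0_integralZl//; last 2 first.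
- exact/measurable_EFinP.
- by move=> w _; rewrite lee_fin.
by rewrite (EFinD C) (EFinM 2) leeD// lee_wpmul2l.
Qed.

End second_moment.

(** * Orthogonality of the residual process *)

Section predictable_ops.
Context {R : realType} {d : measure_display} {T : measurableType d}.
Variables (F : R -> set (set T)) (hF : is_filtration F).
Implicit Types H K : R -> T -> R.
Let D : set (R * T) := `[0, 1] `*` [set: T].

Lemma predictable_setsI A B : predictable_sets F A -> predictable_sets F B ->
  predictable_sets F (A `&` B).
Proof.
move=> PA PB.
have -> : A `&` B = D `\` ((D `\` A) `|` (D `\` B)).
  rewrite setDUr !setDD (setIidr (predictable_sets_sub hF PA).2).
  by rewrite (setIidr (predictable_sets_sub hF PB).2).
apply: sigma_algebraCD; rewrite -bigcup2E; apply: sigma_algebra_bigcup => -[|[|n]] /=.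
- exact: sigma_algebraCD.
- exact: sigma_algebraCD.
- exact: sigma_algebra0.
Qed.

Lemma predictable_setsU A B : predictable_sets F A -> predictable_sets F B ->
  predictable_sets F (A `|` B).
Proof.
move=> PA PB; rewrite -bigcup2E; apply: sigma_algebra_bigcup => -[|[|n]] //=.
exact: sigma_algebra0.
Qed.

Lemma predictable_setsT : predictable_sets F D.
Proof. by rewrite -(setD0 D); apply: sigma_algebraCD; exact: sigma_algebra0. Qed.

(* A function is measurable for the trace on the unit slab of a sigma-algebra
   as soon as its sublevel sets are, so that the operations on processes reduce
   to those on an auxiliary measurable type. *)
Lemma predictable_op2 (op : R -> R -> R) H K :
  measurable_fun [set: R * R] (fun p => op p.1 p.2) ->
  predictable F H -> predictable F K ->
  predictable F (fun s w => op (H s w) (K s w)).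
Proof.
move=> mop pH pK B mB.
have mopB : measurable ((fun p : R * R => op p.1 p.2) @^-1` B).
  by rewrite -[X in measurable X]setTI; exact: mop.
pose Z := [set A : set (R * R) | predictable_sets F
  (D `&` [set p | A (H p.1 p.2, K p.1 p.2)])].
suff : measurable `<=` Z by move=> /(_ _ mopB).
rewrite measurable_prod_measurableType; apply: smallest_sub.
  split.
  - rewrite /Z /= (_ : _ `&` _ = set0); first exact: sigma_algebra0.
    by apply/seteqP; split => // x [].
  - move=> A ZA; rewrite /Z /= (_ : _ `&` _ =
      D `\` (D `&` [set p | A (H p.1 p.2, K p.1 p.2)])).
      exact: sigma_algebraCD.
    apply/seteqP; split => [x [Dx [_ nA]]|x [Dx nA]]; first by split => // -[].
    by split => //; split => // Ax; apply: nA.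
  - move=> A ZA; rewrite /Z /= (_ : _ `&` _ =
      \bigcup_n (D `&` [set p | A n (H p.1 p.2, K p.1 p.2)])).
      exact: sigma_algebra_bigcup.
    by rewrite -setI_bigcupr.
move=> _ [A mA [A' mA' <-]]; rewrite /Z /= (_ : _ `&` _ =
  (D `&` [set p | A (H p.1 p.2)]) `&` (D `&` [set p | A' (K p.1 p.2)])).
  by apply: predictable_setsI; [exact: pH|exact: pK].
by apply/seteqP; split => [x [Dx [a b]]|x [[Dx a] [_ b]]].
Qed.

Lemma predictableB H K : predictable F H -> predictable F K ->
  predictable F (fun s w => H s w - K s w).
Proof.
apply: (predictable_op2 (op := fun x y => x - y)).
by apply: measurable_funB; [exact: measurable_fst|exact: measurable_snd].
Qed.

Lemma predictable_time (t : R) : 0 <= t <= 1 ->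
  predictable F (fun s _ => if s <= t then 1 else 0).
Proof.
move=> /andP[t0 t1].
have FT : F 0 setT.
  have [[F0 FC _] _] : sigma_algebra [set: T] (F 0) /\ F 0 `<=` measurable.
    by apply: (hF.1 0); rewrite lexx ler01.
  by rewrite -(setD0 [set: T]); exact: FC.
have Pt : predictable_sets F (`[0, t] `*` [set: T]).
  have -> : (`[0, t] `*` [set: T] : set (R * T)) =
      ([set 0] `*` [set: T]) `|` (if 0 < t then `]0, t] `*` [set: T] else set0).
    apply/seteqP; split => [[u w] [/= + _]|[u w]].
      rewrite in_itv/= => /andP[u0 ut].
      have [->|un] := eqVneq u 0; first by left.
      have {un u0}u0 : 0 < u by rewrite lt_neqAle eq_sym un.
      by right; rewrite (lt_le_trans u0 ut); split => //=; rewrite in_itv/= u0.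
    move=> [[/= -> _]|]; first by split => //=; rewrite in_itv/= lexx.
    case: ifP => // _ [/=]; rewrite in_itv/= => /andP[/ltW u0 ut] _.
    by split => //=; rewrite in_itv/= u0.
  apply: predictable_setsU.
    by apply: sub_sigma_algebra; left; exists setT.
  case: ifPn => [tgt0|_]; last exact: sigma_algebra0.
  by apply: sub_sigma_algebra; right; exists 0, t, setT.
have tD : `[0, t] `*` [set: T] `<=` D by exact: (predictable_sets_sub hF Pt).2.
move=> B mB; rewrite -/(predictable_sets F) -/D.
have inD u w : D (u, w) -> (`[0, t] `*` [set: T]) (u, w) <-> u <= t.
  move=> [/=]; rewrite in_itv/= => /andP[u0 u1] _; split => [[/=]|ut].
    by rewrite in_itv/= => /andP[].
  by split => //=; rewrite in_itv/= u0.
have [B1|B1] := pselect (B 1); have [B0|B0] := pselect (B 0).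
- rewrite (_ : D `&` _ = D); first exact: predictable_setsT.
  by apply: setIidl => -[u w] _ /=; case: ifP.
- rewrite (_ : D `&` _ = `[0, t] `*` [set: T])//; apply/seteqP; split => [[u w] [Du /=]|[u w] tu].
    by case: ifP => // ut _; apply/(inD _ _ Du).
  have Du := tD _ tu; split => //=; by rewrite ((inD _ _ Du).1 tu).
- rewrite (_ : D `&` _ = D `\` (`[0, t] `*` [set: T])).
    by apply: sigma_algebraCD.
  apply/seteqP; split => [[u w] [Du /=]|[u w] [Du ntu]].
    by case: ifPn => // ut _; split => // /(inD _ _ Du); exact/negP.
  by split => //=; rewrite ifF//; apply/negP => /(inD _ w Du).
- rewrite (_ : D `&` _ = set0); first exact: sigma_algebra0.
  by apply/seteqP; split => -[u w] //= [_]; case: ifP.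
Qed.

(** The integrand is annihilated after [t]. This reduces integrals up to [t] to integrals up to 1,
    the horizon of [compensated_integral], while keeping predictability. *)
Definition stopped (t : R) H (s : R) (w : T) : R := H s w * (if s <= t then 1 else 0).

Lemma predictable_stopped t H : 0 <= t <= 1 -> predictable F H ->
  predictable F (stopped t H).
Proof.
move=> t01 pH; apply: (predictable_op2 (op := *%R)) => //; last exact: predictable_time.
by apply: measurable_funM; [exact: measurable_fst|exact: measurable_snd].
Qed.

Lemma cut_stopped t H p : t <= 1 -> cut 1 (stopped t H) p = cut t H p.
Proof.
move=> t1; rewrite /cut /stopped; case: ifPn => [/andP[-> s1]/=|].
  by case: ifP; rewrite ?mulr1 ?mulr0.
rewrite negb_and => /orP[/negbTE -> //|s1]; rewrite ifF//.
by apply: contraNF s1 => /andP[_ /le_trans ->].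
Qed.

End predictable_ops.

Section expectation_integrals.
Context {R : realType} {d : measure_display} {T : measurableType d}.
Variables (P : probability T R) (N : R -> T -> nat).
Hypothesis cN : counting_process N.
Implicit Types H K : R -> T -> R.

Local Notation kappa := (@unit_lebesgue R \x P)%E.

Lemma integrable_cut t H : t <= 1 -> measurable_process H ->
  kappa.-integrable [set: R * T] (fun p => (cut 1 H p)%:E) ->
  kappa.-integrable [set: R * T] (fun p => (cut t H p)%:E).
Proof.
move=> t1 mH iH; apply: (le_integrable _ _ _ iH) => //.
  by apply/measurable_EFinP; exact: measurable_cut.
by move=> p _; rewrite lee_fin le_cut_norm.
Qed.

Lemma expectation_int_ds t H : t <= 1 -> measurable_process H ->
  kappa.-integrable [set: R * T] (fun p => (cut 1 H p)%:E) ->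
  P.-integrable [set: T] (fun w => (int_ds (H ^~ w) t)%:E) /\
  (\int[P]_w (int_ds (H ^~ w) t)%:E = \int[kappa]_p (cut t H p)%:E)%E.
Proof.
move=> t1 mH iH; have iHt := integrable_cut t1 mH iH.
have mds : measurable_fun [set: T] (fun w => (int_ds (H ^~ w) t)%:E).
  by apply/measurable_EFinP; exact: measurable_int_ds.
split.
  apply: (le_integrable _ mds _ (integrable_path_mass iH)) => // w _.
  apply: le_trans (le_int_ds _ mH t1) (lee_abs _).
rewrite -(integral21_prod_meas1 iHt); apply: ae_eq_integral => //.
  exact: (measurable_fubini_G iHt).
have := ae_integrable2 iHt; apply: filterS => w iw _.
by rewrite /fubini_G int_ds_cut// fineK//; exact: (integrable_fin_num measurableT iw).
Qed.

Lemma integrable_int_dN t H c : 0 <= t <= 1 -> measurable_process H ->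
  P.-integrable [set: T] (fun w => (N 1 w)%:R%:E) -> 0 <= c ->
  {ae P, forall w, forall k, (k < N 1 w)%N -> `|H (jump_time (N ^~ w) k.+1) w| <= c} ->
  P.-integrable [set: T] (fun w => (int_dN (H ^~ w) (N ^~ w) t)%:E).
Proof.
move=> t01 mH iN c0 Hc; have [t0 t1] := andP t01.
have mI : measurable_fun [set: T] (fun w => (int_dN (H ^~ w) (N ^~ w) t)%:E).
  by apply/measurable_EFinP; exact: measurable_int_dN.
apply/integrableP; split => //.
have /integrableP[mc finc] := integrableZl measurableT c iN.
apply: le_lt_trans finc; apply: ae_ge0_le_integral => //.
- by apply: measurableT_comp.
- by apply: measurableT_comp.
apply: filterS Hc => w Hc _.
have Ntw : (N t w <= N 1%R w)%N by apply: (counting_path_mono (n := N ^~ w)) => //; exact: cN.1.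
rewrite lee_fin (@le_trans _ _ (c * (N t w)%:R))//.
  by apply: le_int_dN => // k kN; apply: Hc; exact: leq_trans Ntw.
by rewrite ger0_norm ?mulr_ge0// ler_wpM2l// ler_nat.
Qed.

Lemma int_dNB H K t w : 0 <= t <= 1 ->
  int_dN (fun s => H s w - K s w) (N ^~ w) t =
  int_dN (H ^~ w) (N ^~ w) t - int_dN (K ^~ w) (N ^~ w) t.
Proof. by move=> t01; rewrite !(int_dNE _ (cN.1 w))// sumrB. Qed.

Lemma int_dN_stopped t H w : 0 <= t <= 1 ->
  int_dN (stopped t H ^~ w) (N ^~ w) 1 = int_dN (H ^~ w) (N ^~ w) t.
Proof.
move=> t01; have [t0 t1] := andP t01.
have I01 : 0 <= (1 : R) <= 1 by rewrite ler01 lexx.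
rewrite !(int_dNE _ (cN.1 w))//.
have Ntw : (N t w <= N 1%R w)%N by apply: (counting_path_mono (n := N ^~ w)) => //; exact: cN.1.
rewrite [RHS](big_ord_widen _ (fun k => H (jump_time (N ^~ w) k.+1) w) Ntw) [RHS]big_mkcond/=.
apply: eq_bigr => k _; rewrite /stopped (jump_time_le _ (cN.1 w))//.
by case: ifP; rewrite ?mulr1 ?mulr0.
Qed.

End expectation_integrals.

Section residual_orthogonality.
Context {R : realType} {d : measure_display} {T : measurableType d}.
Variables (P : probability T R) (F : R -> set (set T)) (hF : is_filtration F).
Variables X Pi : R -> T -> R.
Hypotheses (mX : measurable_process X) (hPi : predictable_projection P F X Pi).

Local Notation kappa := (@unit_lebesgue R \x P)%E.
Let G s w := X s w - Pi s w.

Hypothesis iG : kappa.-integrable [set: R * T] (fun p => (cut 1 G p)%:E).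

Let mG : measurable_process G.
Proof.
by apply: measurable_processB => //; exact: predictable_measurable_process hPi.1.
Qed.

(* It suffices to consider the indicator of ]s, t] x A with A in F_s, and then A
   belongs to F_{u-} for every u in ]s, t]. *)
Lemma residual_orthogonal (W : R -> T -> R) : predictable F W ->
  kappa.-integrable [set: R * T] (fun p => (cut 1 (fun s w => W s w * G s w) p)%:E) ->
  (\int[kappa]_p (cut 1 (fun s w => W s w * G s w) p)%:E = 0)%E.
Proof.
move=> pW iWG.
have mD := @measurable_unit_slab R _ T.
rewrite -(patch_cut id (fun s w => W s w * G s w)) -integral_mkcond.
(* The density [G] is compared with the density 0, both against [kappa], which leaves only
   rectangles to be checked. *)
transitivity (\int[kappa]_(p in id @^-1` (`[0%R, 1%R] `*` [set: T])) (W p.1 p.2 * 0)%:E)%E; last first.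
  by apply: integral0_eq => x _; rewrite mulr0.
apply: (@predictable_integral_eq _ _ _ _ _ T R kappa kappa id id
  (fun p => G p.1 p.2) (cst 0) F (@measurable_id _ _ _) (@measurable_id _ _ _) _ _ hF _ W pW).
- by apply/(integrable_mkcond _ mD); rewrite (patch_cut id G).
- exact: integrable0.
- move=> Q PQ; have [mQ QD] := predictable_rectangles_sub hF PQ.
  rewrite [RHS]integral0_eq//.
  case: PQ mQ QD => [[A F0A <-]|[s [t [A [s0 st t1 FsA ->]]]]] mQ QD.
    have mA : measurable A by apply: (filtration_measurable hF) F0A; rewrite lexx ler01.
    rewrite preimage_id null_set_integral//; last exact: kappa_set0.
    apply/measurable_EFinP.
    exact: (measurable_funS mD QD ((measurable_processP G).2 mG)).
  rewrite preimage_id.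
  have s01 : 0 <= s <= 1 by rewrite s0 (le_trans (ltW st)).
  have mA : measurable A by exact: filtration_measurable FsA.
  pose h (p : R * T) : \bar R := ((fun p => (G p.1 p.2)%:E) \_ (`]s, t] `*` A)) p.
  have ih : kappa.-integrable [set: R * T] h.
    rewrite /h -integrable_mkcond//; apply: (integrableS mD) => //.
    by apply/(integrable_mkcond _ mD); rewrite (patch_cut id G).
  rewrite integral_mkcond -/h -(integral12_prod_meas1 ih) integral0_eq// => u _.
  have [us|us] := boolP (s < u <= t); last first.
    rewrite /fubini_F integral0_eq// => w _; rewrite /h /patch memNset// => -[/=].
    by rewrite in_itv/= (negbTE us).
  have [su ut] := andP us.
  have u01 : 0 <= u <= 1 by rewrite (le_trans s0 (ltW su)) (le_trans ut).
  have [iX iPi _ eqA] := hPi.2 u u01.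
  rewrite /fubini_F (eq_integral ((fun w => (G u w)%:E) \_ A)); last first.
    move=> w _; rewrite /h /patch /=.
    suff -> : (u, w) \in `]s, t] `*` A = (w \in A) by [].
    apply/idP/idP; first by move=> /set_mem[_ /= Aw]; exact: mem_set.
    by move=> /set_mem Aw; rewrite inE; split => //=; rewrite in_itv/= su.
  rewrite -integral_mkcond.
  have iXA : P.-integrable A (EFin \o X u) by exact: (integrableS measurableT mA (@subsetT _ A) iX).
  have iPiA : P.-integrable A (EFin \o Pi u) by exact: (integrableS measurableT mA (@subsetT _ A) iPi).
  rewrite /G; under eq_integral do rewrite EFinB.
  rewrite (integralB_EFin mA iXA iPiA) eqA.
    by apply: subee; exact: (integrable_fin_num mA iPiA).
  apply: sub_sigma_algebra; right; exists s => //=.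
  by rewrite s0.
- by apply/(integrable_mkcond _ mD); rewrite (patch_cut id (fun s w => W s w * G s w)).
- rewrite (_ : (fun x => _) = cst 0%E); first exact: integrable0.
  by apply/funext => x; rewrite /= mulr0.
Qed.

End residual_orthogonality.

(** * The bias is the product of the two estimation errors *)

Section ae_integrable.
Context {R : realType} {d : measure_display} {T : measurableType d}.
Variable mu : {measure set T -> \bar R}.

Lemma ae_le_integrable (f g : T -> R) : measurable_fun [set: T] f ->
  mu.-integrable [set: T] (EFin \o g) -> {ae mu, forall x, `|f x| <= `|g x|} ->
  mu.-integrable [set: T] (EFin \o f).
Proof.
move=> mf /integrableP[mg fing] fg; apply/integrableP; split; first exact/measurable_EFinP.
apply: le_lt_trans fing; apply: ae_ge0_le_integral => //.
- by apply: measurableT_comp => //; exact/measurable_EFinP.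
- exact: measurableT_comp.
- by apply: filterS fg => x fgx _; rewrite lee_fin.
Qed.

End ae_integrable.

Section bias.
Context {R : realType} {d : measure_display} {T : measurableType d}.
Variables (P : probability T R) (F : R -> set (set T)) (N : R -> T -> nat).
Hypotheses (hF : is_filtration F) (cN : counting_process N).
Hypothesis iN : P.-integrable [set: T] (fun w => (N 1 w)%:R%:E).
Variables X Pi l : R -> T -> R.

Local Notation kappa := (@unit_lebesgue R \x P)%E.

Hypotheses (mX : measurable_process X) (hPi : predictable_projection P F X Pi).
Hypotheses (hl : is_intensity P F N l)
  (il : kappa.-integrable [set: R * T] (fun p => (cut 1 l p)%:E)).
Let G s w := X s w - Pi s w.
Variables (C C' : R).
Hypotheses (C0 : 0 <= C) (C'0 : 0 <= C').
Hypothesis bG : {ae P, forall w, forall t, 0 <= t <= 1 -> `|G t w| <= C'}.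

Variables lh Ph : R -> T -> R.
Hypotheses (plh : predictable F lh) (pPh : predictable F Ph).
Let Gh s w := X s w - Ph s w.
Hypothesis bGhN : {ae P, forall w, forall k, (k < N 1 w)%N ->
  `|Gh (jump_time (N ^~ w) k.+1) w| <= C'}.
Hypothesis bGh : {ae kappa, forall p, `|cut 1 Gh p| <= C'}.
Hypothesis blh : {ae kappa, forall p, `|cut 1 lh p| <= C}.

Let pPi : predictable F Pi := hPi.1.
Let mPi : measurable_process Pi := predictable_measurable_process hF pPi.
Let mPh : measurable_process Ph := predictable_measurable_process hF pPh.
Let mlh : measurable_process lh := predictable_measurable_process hF plh.
Let pl : predictable F l. Proof. by case: hl. Qed.
Let ml : measurable_process l := predictable_measurable_process hF pl.
Let mG : measurable_process G := measurable_processB mX mPi.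
Let mGh : measurable_process Gh := measurable_processB mX mPh.

Let bGk : {ae kappa, forall p, `|cut 1 G p| <= C'}.
Proof.
apply: filterS (ae_product2 _ bG) => -[s w] /= Gw.
by rewrite /cut /=; case: ifPn => [/Gw//|]; rewrite normr0.
Qed.

Let bGN : {ae P, forall w, forall k, (k < N 1 w)%N ->
  `|G (jump_time (N ^~ w) k.+1) w| <= C'}.
Proof.
apply: filterS bG => w Gw k kN; apply: Gw.
by rewrite jump_time_ge0 (jump_time_le _ (cN.1 w))// ler01 lexx.
Qed.

Let cutM H K p : cut 1 (fun s (w : T) => H s w * K s w) p = cut 1 H p * cut 1 K p :> R.
Proof. by rewrite /cut; case: ifP; rewrite ?mul0r. Qed.

Let cutB H K p : cut 1 (fun s (w : T) => H s w - K s w) p = cut 1 H p - cut 1 K p :> R.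
Proof. by rewrite /cut; case: ifP; rewrite ?subrr. Qed.

Let iM H K (c : R) : 0 <= c -> measurable_process H -> measurable_process K ->
  {ae kappa, forall p, `|cut 1 H p| <= c} ->
  kappa.-integrable [set: R * T] (fun p => (cut 1 K p)%:E) ->
  kappa.-integrable [set: R * T] (fun p => (cut 1 (fun s w => H s w * K s w) p)%:E).
Proof.
move=> c0 mH mK bH iK.
apply: (@ae_le_integrable _ _ _ kappa _ (fun p => c * cut 1 K p)).
- exact: measurable_processM.
- exact: (integrableZl measurableT c iK).
- by apply: filterS bH => p Hp; rewrite cutM !normrM (ger0_norm c0) ler_wpM2r.
Qed.

Let ibd H (c : R) : 0 <= c -> measurable_process H ->
  {ae kappa, forall p, `|cut 1 H p| <= c} ->
  kappa.-integrable [set: R * T] (fun p => (cut 1 H p)%:E).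
Proof.
move=> c0 mH bH; apply: (@ae_le_integrable _ _ _ kappa _ (cst c)).
- exact: mH.
- exact: integrable_product_cst.
- by apply: filterS bH => p Hp; rewrite /= (ger0_norm c0).
Qed.

(** This is [Gh - G]. The covariate [X] cancels, so the difference is predictable for [F] although
    neither residual need be, and the [F]-intensity compensates it. *)
Let U s w := Pi s w - Ph s w.
Let pU : predictable F U. Proof. exact: (predictableB hF). Qed.
Let mU : measurable_process U := predictable_measurable_process hF pU.
Let V s w := l s w - lh s w.
Let pV : predictable F V. Proof. exact: (predictableB hF). Qed.
Let mV : measurable_process V := predictable_measurable_process hF pV.

Let UE s w : U s w = Gh s w - G s w.
Proof. by rewrite /U /Gh /G; ring. Qed.

Let bU : {ae kappa, forall p, `|cut 1 U p| <= C' + C'}.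
Proof.
apply: filterS2 bGh bGk => p h1 h2.
have -> : cut 1 U p = cut 1 Gh p - cut 1 G p.
  by rewrite -cutB /cut UE.
by apply: le_trans (ler_normB _ _) _; exact: lerD.
Qed.

Let ilh := ibd C0 mlh blh.
Let iV : kappa.-integrable [set: R * T] (fun p => (cut 1 V p)%:E).
Proof.
rewrite (_ : (fun p => _) = (fun p => (cut 1 l p)%:E - (cut 1 lh p)%:E)%E).
  exact: integrableB.
by apply/funext => p; rewrite -EFinB -cutB.
Qed.

Let iUl := iM (addr_ge0 C'0 C'0) mU ml bU il.
Let iUV := iM (addr_ge0 C'0 C'0) mU mV bU iV.
Let iGhlh := iM C'0 mGh mlh bGh ilh.
Let iGl := iM C'0 mG ml bGk il.
Let iGV := iM C'0 mG mV bGk iV.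

Variable t : R.
Hypothesis t01 : 0 <= t <= 1.
Let t1 : t <= 1. Proof. by case/andP: t01. Qed.

Let iGh_dN := integrable_int_dN cN t01 mGh iN C'0 bGhN.
Let iG_dN := integrable_int_dN cN t01 mG iN C'0 bGN.

Definition dM_integral H K w := int_dM (H ^~ w) (N ^~ w) (K ^~ w) t.

Lemma integrable_dM : P.-integrable [set: T] (EFin \o dM_integral G l).
Proof.
have [i2 _] := expectation_int_ds t1 (measurable_processM mG ml) iGl.
exact: (integrableB measurableT iG_dN i2).
Qed.

Lemma integrable_bias : kappa.-integrable [set: R * T]
  (fun p => (cut t (fun s w => U s w * V s w) p)%:E).
Proof. by apply: integrable_cut iUV => //; exact: measurable_processM. Qed.

Let expectation_dN_diff :
  (\int[P]_w (int_dN (Gh ^~ w) (N ^~ w) t) - \int[P]_w (int_dN (G ^~ w) (N ^~ w) t) =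
   \int[kappa]_p cut t (fun s w => U s w * l s w) p)%R.
Proof.
rewrite -(RintegralB measurableT iGh_dN iG_dN).
rewrite (@eq_Rintegral _ _ _ P setT (fun w => int_dN (stopped t U ^~ w) (N ^~ w) 1)); last first.
  move=> w _; rewrite (int_dN_stopped cN)// -int_dNB//.
  by congr int_dN; apply/funext => s; rewrite UE.
have mS : measurable_process (stopped t U).
  exact: predictable_measurable_process (predictable_stopped hF t01 pU).
rewrite /Rintegral (compensated_integral hF cN pl iN il) //.
- congr fine; apply: eq_integral => p _; congr EFin.
  rewrite -[RHS](cut_stopped _ _ t1); congr cut; apply/funext => s; apply/funext => w.
  by rewrite /stopped mulrAC.
- exact: intensity_compensates.
- exact: predictable_stopped.
- apply: (@integrable_int_dN _ _ _ _ _ cN 1 (fun s w => `|stopped t U s w|) (C' + C')) => //.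
  + by rewrite ler01 lexx.
  + exact: measurable_process_norm.
  + exact: addr_ge0.
  + apply: filterS2 bGhN bGN => w h1 h2 k kN; rewrite normr_id /stopped.
    rewrite normrM (@le_trans _ _ `|U (jump_time (N ^~ w) k.+1) w|)//.
      by rewrite ler_piMr//; case: ifP; rewrite ?normr1 ?normr0.
    by rewrite UE; apply: le_trans (ler_normB _ _) _; apply: lerD; [exact: h1|exact: h2].
- rewrite (_ : (fun p => _) = (fun p => (cut t (fun s w => U s w * l s w) p)%:E)).
    by apply: integrable_cut iUl => //; exact: measurable_processM.
  apply/funext => p; congr EFin.
  rewrite -[RHS](cut_stopped _ _ t1); congr cut; apply/funext => s; apply/funext => w.
  by rewrite /stopped mulrAC.
Qed.

(* The integrand of the difference is U (dN - l ds) + V G ds + U V ds, and the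
   first two terms have mean zero. *)
Lemma bias_eq :
  (\int[P]_w dM_integral Gh lh w - \int[P]_w dM_integral G l w =
   \int[kappa]_p cut t (fun s w => U s w * V s w) p)%R.
Proof.
have [i1 e1] := expectation_int_ds t1 (measurable_processM mGh mlh) iGhlh.
have [i2 e2] := expectation_int_ds t1 (measurable_processM mG ml) iGl.
rewrite /dM_integral /int_dM (RintegralB measurableT iGh_dN i1) (RintegralB measurableT iG_dN i2).
have {}e1 : (\int[P]_w int_ds (fun s => Gh s w * lh s w) t =
    \int[kappa]_p cut t (fun s w => Gh s w * lh s w) p)%R by rewrite /Rintegral e1.
have {}e2 : (\int[P]_w int_ds (fun s => G s w * l s w) t =
    \int[kappa]_p cut t (fun s w => G s w * l s w) p)%R by rewrite /Rintegral e2.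
have e3 := expectation_dN_diff.
have e4 : (\int[kappa]_p cut t (fun s w => V s w * G s w) p = 0)%R.
  have iG : kappa.-integrable [set: R * T] (fun p => (cut 1 G p)%:E) by exact: ibd bGk.
  have st p : cut 1 (fun s w => stopped t V s w * G s w) p = cut t (fun s w => V s w * G s w) p.
    rewrite -[RHS](cut_stopped _ _ t1); congr cut; apply/funext => s; apply/funext => w.
    by rewrite /stopped mulrAC.
  rewrite /Rintegral (eq_integral (fun p => (cut 1 (fun s w => stopped t V s w * G s w) p)%:E)); last first.
    by move=> p _; rewrite st.
  rewrite (residual_orthogonal hF mX hPi iG (predictable_stopped hF t01 pV))//.
  rewrite (_ : (fun p => _) = (fun p => (cut t (fun s w => V s w * G s w) p)%:E)); last first.
    by apply/funext => p; rewrite st.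
  apply: integrable_cut => //; first exact: measurable_processM.
  rewrite (_ : (fun p => _) = (fun p => (cut 1 (fun s w => G s w * V s w) p)%:E))//.
  by apply/funext => p; rewrite !cutM mulrC.
have jUl := integrable_cut t1 (measurable_processM mU ml) iUl.
have jUV := integrable_cut t1 (measurable_processM mU mV) iUV.
have jGhlh := integrable_cut t1 (measurable_processM mGh mlh) iGhlh.
have jGl := integrable_cut t1 (measurable_processM mG ml) iGl.
(* This comes from expanding [Gh * lh = (G + U) * (l - V)]. *)
have e5 : (\int[kappa]_p cut t (fun s w => V s w * G s w) p =
   ((\int[kappa]_p cut t (fun s w => U s w * l s w) p +
    \int[kappa]_p cut t (fun s w => G s w * l s w) p) -
    \int[kappa]_p cut t (fun s w => Gh s w * lh s w) p) -
    \int[kappa]_p cut t (fun s w => U s w * V s w) p)%R.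
  rewrite -(RintegralD measurableT jUl jGl).
  rewrite -(RintegralB measurableT (integrableD measurableT jUl jGl) jGhlh).
  rewrite -(RintegralB measurableT (integrableB measurableT (integrableD measurableT jUl jGl) jGhlh) jUV).
  apply: eq_Rintegral => p _; rewrite /cut; case: ifP => _; last by rewrite addr0 !subr0.
  by rewrite UE /V; ring.
move: e5; rewrite e4 => /esym/eqP; rewrite subr_eq0 => /eqP <-.
by rewrite e1 e2 -e3; ring.
Qed.

End bias.

(** * Independence and joint laws *)

Section joint_law.
Context {R : realType} {d d1 d2 : measure_display} {T : measurableType d}
  {T1 : measurableType d1} {T2 : measurableType d2}.
Variables (P : probability T R) (mu : probability T1 R) (nu : probability T2 R).
Variables (f : T -> T1) (g : T -> T2).
Hypotheses (mf : measurable_fun [set: T] f) (mg : measurable_fun [set: T] g).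
Hypothesis fg : forall A B, measurable A -> measurable B ->
  P (f @^-1` A `&` g @^-1` B) = (mu A * nu B)%E.

Let pair w := (f w, g w).
Let mpair : measurable_fun [set: T] pair := measurable_fun_pair mf mg.
#[local] HB.instance Definition _ := isMeasurableFun.Build _ _ _ _ pair mpair.
Let law : probability (T1 * T2)%type R := distribution P (pair : {mfun _ >-> _}).

Lemma joint_lawE S : measurable S -> (mu \x nu)%E S = P [set w | S (f w, g w)].
Proof.
by move=> mS; apply: etrans (product_measure_unique (m' := law) _ mS) _.
Qed.

Lemma ge0_integral_joint_law (h : T1 * T2 -> \bar R) :
  measurable_fun [set: T1 * T2] h -> (forall z, 0 <= h z)%E ->
  (\int[mu \x nu]_z h z = \int[P]_w h (f w, g w))%E.
Proof.
move=> mh h0; rewrite (eq_measure_integral law); first by rewrite ge0_integral_distribution.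
by move=> S mS _; exact: joint_lawE.
Qed.

Lemma integrable_joint_law (h : T1 * T2 -> \bar R) :
  measurable_fun [set: T1 * T2] h ->
  (mu \x nu)%E.-integrable [set: T1 * T2] h <->
  P.-integrable [set: T] (fun w => h (f w, g w)).
Proof.
move=> mh; have mhp : measurable_fun [set: T] (fun w => h (f w, g w)).
  exact: (measurableT_comp mh mpair).
have e : (\int[mu \x nu]_z `|h z| = \int[P]_w `|h (f w, g w)|)%E.
  by rewrite (ge0_integral_joint_law (h := fun z => `|h z|%E))//; exact: measurableT_comp.
split=> /integrableP[_ fin]; apply/integrableP; split => //; first by rewrite -e.
by apply: le_lt_trans fin; rewrite e.
Qed.

Lemma integral_joint_law (h : T1 * T2 -> \bar R) :
  (mu \x nu)%E.-integrable [set: T1 * T2] h ->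
  (\int[mu \x nu]_z h z = \int[P]_w h (f w, g w))%E.
Proof.
move=> ih; have mh := measurable_int _ ih.
rewrite (eq_measure_integral law); last by move=> S mS _; exact: joint_lawE.
by rewrite integral_distribution//; apply/(integrable_joint_law mh).
Qed.

Lemma ae_joint_law (S : set (T1 * T2)) : measurable S ->
  {ae (mu \x nu)%E, forall z, S z} <-> {ae P, forall w, S (f w, g w)}.
Proof.
move=> mS; have mSC := measurableC mS.
have mpS : measurable [set w | (~` S) (f w, g w)].
  by rewrite -[X in measurable X]setTI; exact: mpair.
split=> [/(negligibleP _ mSC) S0|/(negligibleP _ mpS) S0].
  by apply/(negligibleP _ mpS); apply: etrans _ S0; apply/esym; exact: joint_lawE.
by apply/(negligibleP _ mSC); apply: etrans (joint_lawE mSC) _.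
Qed.

End joint_law.

Section independence_dynkin.
Context {R : realType} {d d1 : measure_display} {T : measurableType d}
  {T1 : measurableType d1}.
Variables (P : probability T R) (f : T -> T1) (G : set (set T1)) (E : set T).
Hypotheses (mf : measurable_fun [set: T] f) (mE : measurable E).
Hypotheses (GE : @measurable _ T1 = <<s G >>) (GI : setI_closed G).

Lemma independent_dynkin :
  (forall A, G A -> P (f @^-1` A `&` E) = (P (f @^-1` A) * P E)%E) ->
  forall A, measurable A -> P (f @^-1` A `&` E) = (P (f @^-1` A) * P E)%E.
Proof.
have mpre A : measurable A -> measurable (f @^-1` A).
  by move=> mA; rewrite -[X in measurable X]setTI; exact: mf.
have finE : P E \is a fin_num by exact: fin_num_measure.
move=> GP A mA; move: (mA); rewrite {1}GE.
apply: (dynkin_induction (P := fun A => P (f @^-1` A `&` E) = (P (f @^-1` A) * P E)%E)) => //.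
- by rewrite preimage_setT setTI probability_setT mul1e.
- move=> B mB eB; rewrite preimage_setC probability_setC; last exact: mpre.
  have finB : P (f @^-1` B) \is a fin_num by apply: fin_num_measure; exact: mpre.
  rewrite muleBl// ?fin_num_adde_defl// mul1e -eB setIC -setDE.
  rewrite measureD//; [by rewrite setIC|exact: mpre|].
  by rewrite ltey_eq finE.
- move=> F mF tF eF; rewrite preimage_bigcup setI_bigcupl.
  have tF' : trivIset setT (fun n => f @^-1` F n)
    by move=> j k _ _ [x [Fj Fk]]; apply: tF => //; exists (f x).
  rewrite measure_bigcup//; last 2 first.
  + by move=> i _; apply: measurableI => //; exact: mpre.
  + by apply: trivIset_setIr.
  rewrite measure_bigcup//; last by move=> i _; exact: mpre.
  rewrite muleC -(fineK finE) -nneseriesZl//.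
  by apply: eq_eseriesr => i _; rewrite fineK// [RHS]muleC; exact: eF.
Qed.

End independence_dynkin.

Section independent_tuple.
Context {R : realType} {d d' : measure_display} {T : measurableType d}
  {T' : measurableType d'} {I : choiceType}.
Variables (P : probability T R) (Y : I -> T -> T').
Hypotheses (mY : forall i, measurable_fun [set: T] (Y i))
  (indY : independent_family P Y).

Let cylinders n : set (set (n.-tuple T')) :=
  [set A | exists2 B : 'I_n -> set T', (forall k, measurable (B k)) &
     A = [set x | forall k, B k (tnth x k)]].

Let measurable_cylinder n A : @cylinders n A -> measurable A.
Proof.
move=> [B mB ->].
rewrite (_ : [set x | _] = \bigcap_(k in [set: 'I_n]) (fun x => tnth x k) @^-1` B k).
  apply: fin_bigcap_measurable => // k _.
  by rewrite -[X in measurable X]setTI; apply: measurable_tnth.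
by apply/seteqP; split => x /= h k; [move=> _; exact: h|exact: h].
Qed.

Let cylindersE n : @measurable _ (n.-tuple T') = <<s @cylinders n >>.
Proof.
apply/seteqP; split.
  apply: smallest_sub; first exact: smallest_sigma_algebra.
  move=> A; rewrite -bigcup_seq => -[/= k _ [B mB <-]].
  apply: sub_sigma_algebra; exists (fun j => if j == k then B else setT).
    by move=> j; case: ifP.
  rewrite setTI; apply/seteqP; split => x /= h; last by have := h k; rewrite eqxx.
  by move=> j; case: eqP => // ->.
apply: smallest_sub; first exact: sigma_algebra_measurable.
by move=> A; exact: measurable_cylinder.
Qed.

Let cylindersI n : setI_closed (@cylinders n).
Proof.
move=> _ _ [A mA ->] [B mB ->]; exists (fun k => A k `&` B k).
  by move=> k; exact: measurableI.
apply/seteqP; split => [x [h h'] k|x h]; first by split; [exact: h|exact: h'].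
by split => k; case: (h k).
Qed.

Variables (n : nat) (o : n.-tuple I) (i : I).
Hypotheses (uo : uniq o) (io : i \notin o).

Let tup w := [tuple Y (tnth o k) w | k < n].

Lemma measurable_tuple_family : measurable_fun [set: T] tup.
Proof.
apply/measurable_fun_tnthP => k.
by rewrite (_ : _ \o _ = Y (tnth o k))//; apply/funext => w /=; rewrite tnth_mktuple.
Qed.

(** Cylinders generate the sigma-algebra of tuples and are stable under intersection; on them the
    claim is the product formula for the distinct indices [i :: o]. *)
Lemma independent_tuple A B : measurable A -> measurable B ->
  P (tup @^-1` A `&` Y i @^-1` B) = (P (tup @^-1` A) * P (Y i @^-1` B))%E.
Proof.
move=> mA mB.
have mYB : measurable (Y i @^-1` B) by rewrite -[X in measurable X]setTI; exact: mY.
apply: (independent_dynkin measurable_tuple_family mYB (cylindersE n) (@cylindersI n)) mA.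
move=> _ [C mC ->].
(* One constraint per index: [B0] at [i], the matching side of the cylinder along [o], nothing
   elsewhere. Distinctness of the entries of [o] makes the choice of [k] unambiguous. *)
pose D (B0 : set T') j : set T' :=
  if j == i then B0 else if [pick k | tnth o k == j] is Some k then C k else setT.
have mD B0 : measurable B0 -> forall j, measurable (D B0 j).
  by move=> mB0 j; rewrite /D; case: ifP => // _; case: pickP.
have Dk B0 k : D B0 (tnth o k) = C k.
  rewrite /D ifF; last by apply: contraNF io => /eqP <-; exact: mem_tnth.
  case: pickP => [k' /eqP kk'|/(_ k)]; last by rewrite eqxx.
  by congr C; exact: (tuple_uniqP _ uo _ _ kk').
have DiE B0 : D B0 i = B0 by rewrite /D eqxx.
have us : uniq (i :: o) by rewrite /= io uo.
have pre B0 : tup @^-1` [set x | forall k, C k (tnth x k)] `&` Y i @^-1` B0 =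
    \bigcap_(j in [set` i :: o]) (Y j @^-1` D B0 j).
  apply/seteqP; split => [w [/= Cw B0w] j|w h].
    rewrite /= inE => /orP[/eqP ->|/tnthP[k ->]]; first by rewrite DiE.
    by rewrite Dk; have := Cw k; rewrite tnth_mktuple.
  split => [k|]; last by have := h i; rewrite /= DiE; apply; rewrite inE eqxx.
  have := h (tnth o k); rewrite /= Dk tnth_mktuple; apply.
  by rewrite inE mem_tnth orbT.
have fin B0 : measurable B0 -> P (Y i @^-1` B0) \is a fin_num.
  by move=> mB0; apply: fin_num_measure; rewrite -[X in measurable X]setTI; exact: mY.
(* It is used for [B0 = B] and for [B0 = setT]; the latter identifies the remaining product with the
   probability of the tuple event. *)
have prodE B0 : measurable B0 ->
    P (tup @^-1` [set x | forall k, C k (tnth x k)] `&` Y i @^-1` B0) =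
    (P (Y i @^-1` B0) * (\prod_(j <- o) fine (P (Y j @^-1` D setT j)))%:E)%E.
  move=> mB0; rewrite pre indY//; last exact: mD.
  rewrite big_cons EFinM DiE fineK; last exact: fin.
  congr (_ * _%:E)%E; apply: eq_big_seq => j jo; rewrite /D.
  case: eqP => // ji; have := io; by rewrite -ji jo.
rewrite prodE// muleC; congr (_ * _)%E.
by have := prodE _ measurableT; rewrite preimage_setT setIT probability_setT mul1e => ->.
Qed.

End independent_tuple.

(** * Conditional variance *)

Section conditional_variance.
Context {R : realType} {d d1 d2 : measure_display} {T : measurableType d}
  {T1 : measurableType d1} {T2 : measurableType d2}.
Variables (P : probability T R) (mu : probability T1 R) (nu : probability T2 R).

Section section_mean.
Variable h : T1 * T2 -> R.
Hypothesis mh : measurable_fun [set: T1 * T2] h.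

(** The conditional mean of [h] given its first argument, under a product law. It is real for every
    [x], an infinite integral being read as 0. *)
Definition section_mean (x : T1) : R := (\int[nu]_y h (x, y))%R.

Lemma measurable_section_mean : measurable_fun [set: T1] section_mean.
Proof.
have mE : measurable_fun [set: T1 * T2] (EFin \o h) by exact/measurable_EFinP.
apply: (@measurableT_comp _ _ _ _ _ _ (@fine R)); first exact: fine_measurable.
rewrite (_ : (fun x => _) = (fun x =>
    \int[nu]_y ((EFin \o h)^\+ (x, y)) - \int[nu]_y ((EFin \o h)^\- (x, y)))%E); last first.
  by apply/funext => x; rewrite integralE; congr (_ - _)%E; apply: eq_integral => y _;
    rewrite ?funeposE ?funenegE.
apply: emeasurable_funB.
- apply: (measurable_fun_fubini_tonelli_F (m2 := nu) ((EFin \o h)^\+)%E) => //.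
  exact: measurable_funepos.
- apply: (measurable_fun_fubini_tonelli_F (m2 := nu) ((EFin \o h)^\-)%E) => //.
  exact: measurable_funeneg.
Qed.

Definition centered (z : T1 * T2) : R := h z - section_mean z.1.

Lemma measurable_centered : measurable_fun [set: T1 * T2] centered.
Proof.
apply: measurable_funB => //.
by apply: (measurableT_comp measurable_section_mean); exact: measurable_fst.
Qed.

Let mhx x : measurable_fun [set: T2] (fun y => h (x, y)).
Proof. exact: measurableT_comp. Qed.

Let sq_int x : (\int[nu]_y (h (x, y) ^+ 2)%:E < +oo)%E ->
  nu.-integrable [set: T2] (fun y => (h (x, y) ^+ 2)%:E).
Proof.
move=> fin; apply/integrableP; split.
  by apply/measurable_EFinP; exact: measurable_funX.
by under eq_integral do rewrite gee0_abs ?lee_fin ?sqr_ge0//.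
Qed.

Let int_sq x : (\int[nu]_y (h (x, y) ^+ 2)%:E < +oo)%E ->
  nu.-integrable [set: T2] (fun y => (h (x, y))%:E).
Proof.
move=> /sq_int i2.
have i1 : nu.-integrable [set: T2] (fun y => (1 + h (x, y) ^+ 2)%:E).
  have := integrableD measurableT (finite_measure_integrable_cst nu 1 measurableT) i2.
  by apply: eq_integrable.
apply: (le_integrable _ _ _ i1) => //; first exact/measurable_EFinP.
move=> y _; rewrite lee_fin [leRHS]ger0_norm ?addr_ge0 ?sqr_ge0//.
set a := h (x, y); have h1 := sqr_ge0 (a - 1); have h2 := sqr_ge0 (a + 1).
have h3 := sqr_ge0 a.
by rewrite ler_norml; apply/andP; split; nra.
Qed.

Lemma integrable_centered x : (\int[nu]_y (h (x, y) ^+ 2)%:E < +oo)%E ->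
  nu.-integrable [set: T2] (fun y => (centered (x, y))%:E).
Proof.
move=> /int_sq i1.
exact: (integrableB measurableT i1 (finite_measure_integrable_cst nu (section_mean x) measurableT)).
Qed.

Lemma integral_centered x : (\int[nu]_y (h (x, y) ^+ 2)%:E < +oo)%E ->
  (\int[nu]_y centered (x, y) = 0)%R.
Proof.
move=> /int_sq i1; rewrite /centered /=.
rewrite (RintegralB measurableT i1 (finite_measure_integrable_cst nu _ measurableT)).
by rewrite Rintegral_cst//= probability_setT mulr1 subrr.
Qed.

Lemma integral_centered_sqr_le x : (\int[nu]_y (h (x, y) ^+ 2)%:E < +oo)%E ->
  (\int[nu]_y (centered (x, y) ^+ 2)%:E <= \int[nu]_y (h (x, y) ^+ 2)%:E)%E.
Proof.
move=> fin; have i1 := int_sq fin; have i2 := sq_int fin.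
set m := section_mean x.
have im := finite_measure_integrable_cst nu (m ^+ 2) measurableT.
have i3 : nu.-integrable [set: T2] (fun y => ((2 * m) * h (x, y))%:E).
  exact: (integrableZl measurableT (2 * m) i1).
have i4 : nu.-integrable [set: T2] (fun y => (h (x, y) ^+ 2 - (2 * m) * h (x, y))%:E).
  exact: (integrableB measurableT i2 i3).
have -> : (\int[nu]_y (centered (x, y) ^+ 2)%:E =
    \int[nu]_y ((h (x, y) ^+ 2 - (2 * m) * h (x, y))%:E + (m ^+ 2)%:E))%E.
  apply: eq_integral => y _; rewrite -EFinD /centered /= -/m; congr EFin; ring.
rewrite (integralD measurableT i4 im) (integralB_EFin measurableT i2 i3).
rewrite [X in (_ - X)%E](_ : _ = (2 * m * m)%:E); last first.
  rewrite (eq_integral (fun y => (2 * m)%:E * (h (x, y))%:E)%E)//.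
  rewrite integralZl// [RHS]EFinM; congr (_ * _)%E.
  by rewrite /m /section_mean /Rintegral fineK//; exact: (integrable_fin_num measurableT i1).
rewrite [X in (_ + X)%E](_ : _ = (m ^+ 2)%:E); last first.
  by rewrite -[RHS]mule1 -(probability_setT nu) -integral_cst.
have fin2 := integrable_fin_num measurableT i2.
rewrite -(fineK fin2) -EFinB -EFinD lee_fin.
have := sqr_ge0 m; lra.
Qed.

End section_mean.

Variables (h : T1 * T2 -> R) (K : R).
Hypothesis mh : measurable_fun [set: T1 * T2] h.
Hypothesis hK : (\int[mu \x nu]_z (h z ^+ 2)%:E <= K%:E)%E.
Variables (n : nat) (J : {set 'I_n}) (f : T -> T1) (Y : 'I_n -> T -> T2).
Hypotheses (mf : measurable_fun [set: T] f)
  (mY : forall j, measurable_fun [set: T] (Y j)).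
Hypothesis fY : forall j A B, j \in J -> measurable A -> measurable B ->
  P (f @^-1` A `&` Y j @^-1` B) = (mu A * nu B)%E.
Hypothesis fYY : forall i j (A : set (T1 * T2)) B, i \in J -> j \in J -> i != j ->
  measurable A -> measurable B ->
  P ((fun w => (f w, Y i w)) @^-1` A `&` Y j @^-1` B) =
  (P ((fun w => (f w, Y i w)) @^-1` A) * nu B)%E.

Let u := centered h.
Let mu_ : measurable_fun [set: T1 * T2] u := measurable_centered mh.
Let U j w := u (f w, Y j w).

Let mU j : measurable_fun [set: T] (U j).
Proof. by apply: measurableT_comp => //; exact: measurable_fun_pair. Qed.

Let mh2 : measurable_fun [set: T1 * T2] (fun z => (h z ^+ 2)%:E).
Proof. by apply/measurable_EFinP; exact: measurable_funX. Qed.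

Let ae_sq : {ae mu, forall x, (\int[nu]_y (h (x, y) ^+ 2)%:E < +oo)%E}.
Proof.
have ih : (mu \x nu)%E.-integrable [set: T1 * T2] (fun z => (h z ^+ 2)%:E).
  apply/integrableP; split => //.
  under eq_integral do rewrite gee0_abs ?lee_fin ?sqr_ge0//.
  exact: le_lt_trans hK (ltry _).
apply: filterS (ae_integrable1 ih) => x /integrableP[_].
by under eq_integral do rewrite gee0_abs ?lee_fin ?sqr_ge0//.
Qed.

Let EU2 j : j \in J -> (\int[P]_w (U j w ^+ 2)%:E <= K%:E)%E.
Proof.
move=> jJ; have mu2 : measurable_fun [set: T1 * T2] (fun z => (u z ^+ 2)%:E).
  by apply/measurable_EFinP; exact: measurable_funX.
rewrite -(ge0_integral_joint_law mf (mY j) (fun A B => @fY j A B jJ) mu2); last first.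
  by move=> z; rewrite lee_fin sqr_ge0.
apply: le_trans hK.
rewrite (fubini_tonelli1 (fun z => (u z ^+ 2)%:E))//; last by move=> z; rewrite lee_fin sqr_ge0.
rewrite (fubini_tonelli1 (fun z => (h z ^+ 2)%:E))//; last by move=> z; rewrite lee_fin sqr_ge0.
apply: ae_ge0_le_integral => //.
- by move=> x _; apply: integral_ge0 => y _; rewrite lee_fin sqr_ge0.
- by apply: (measurable_fun_fubini_tonelli_F (fun z => (u z ^+ 2)%:E)) => // z; rewrite lee_fin sqr_ge0.
- by move=> x _; apply: integral_ge0 => y _; rewrite lee_fin sqr_ge0.
- by apply: (measurable_fun_fubini_tonelli_F (fun z => (h z ^+ 2)%:E)) => // z; rewrite lee_fin sqr_ge0.
- by apply: filterS ae_sq => x fin _; exact: integral_centered_sqr_le.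
Qed.

Let iU2 j : j \in J -> P.-integrable [set: T] (fun w => (U j w ^+ 2)%:E).
Proof.
move=> jJ; apply/integrableP; split.
  by apply/measurable_EFinP; exact: measurable_funX.
under eq_integral do rewrite gee0_abs ?lee_fin ?sqr_ge0//.
exact: le_lt_trans (EU2 jJ) (ltry _).
Qed.

Let iUU i j : i \in J -> j \in J -> P.-integrable [set: T] (fun w => (U i w * U j w)%:E).
Proof.
move=> iJ jJ.
have := integrableD measurableT (iU2 iJ) (iU2 jJ).
apply: le_integrable => //.
  by apply/measurable_EFinP; exact: measurable_funM.
move=> w _; rewrite -EFinD !abse_EFin lee_fin [leRHS]ger0_norm ?addr_ge0 ?sqr_ge0//.
set a := U i w; set b := U j w.
have h1 := sqr_ge0 (a - b); have h2 := sqr_ge0 (a + b).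
have h3 := sqr_ge0 a; have h4 := sqr_ge0 b.
rewrite ler_norml; apply/andP; split; nra.
Qed.

Let EUU i j : i \in J -> j \in J -> i != j -> (\int[P]_w (U i w * U j w)%:E = 0)%E.
Proof.
move=> iJ jJ ij.
have mfY : measurable_fun [set: T] (fun w => (f w, Y i w)) by exact: measurable_fun_pair.
pose law : probability (T1 * T2)%type R := distribution P
  (MeasurableFun.Pack (MeasurableFun.Class (isMeasurableFun.Build _ _ _ _ _ mfY)) : {mfun _ >-> _}).
have joint A B : measurable A -> measurable B ->
    P ((fun w => (f w, Y i w)) @^-1` A `&` Y j @^-1` B) = (law A * nu B)%E.
  by move=> mA mB; rewrite fYY.
pose g (z : (T1 * T2) * T2) := (u z.1 * u (z.1.1, z.2))%:E.
have mg : measurable_fun [set: (T1 * T2) * T2] g.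
  apply/measurable_EFinP; apply: measurable_funM.
    by apply: (measurableT_comp mu_); exact: measurable_fst.
  apply: (measurableT_comp mu_); apply: measurable_fun_pair; last exact: measurable_snd.
  by apply: measurableT_comp => //; exact: measurable_fst.
have ig : (law \x nu)%E.-integrable [set: (T1 * T2) * T2] g.
  by apply/(integrable_joint_law mfY (mY j) joint mg); exact: iUU.
transitivity (\int[law \x nu]_z g z)%E.
  by rewrite (integral_joint_law mfY (mY j) joint ig).
rewrite -(integral12_prod_meas1 ig).
(* Finite section moments are known almost everywhere for [mu] only; they transfer because [mu] is
   the first marginal of [law]. *)
have lawae : {ae law, forall z, (\int[nu]_y (h (z.1, y) ^+ 2)%:E < +oo)%E}.
  pose S : set (T1 * T2) := [set z | (\int[nu]_y (h (z.1, y) ^+ 2)%:E < +oo)%E].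
  have mS1 : measurable [set x | (\int[nu]_y (h (x, y) ^+ 2)%:E < +oo)%E].
    rewrite -[X in measurable X]setTI; apply: emeasurable_fun_infty_o => //.
    by apply: (measurable_fun_fubini_tonelli_F (fun z => (h z ^+ 2)%:E)) => // z; rewrite lee_fin sqr_ge0.
  have mS : measurable S.
    by rewrite -[X in measurable X]setTI; exact: (@measurable_fst _ _ T1 T2 measurableT _ mS1).
  apply/(negligibleP _ (measurableC mS)).
  have /(negligibleP _ (measurableC mS1)) mu0 := ae_sq.
  have := fY iJ (measurableC mS1) measurableT; rewrite preimage_setT setIT => e.
  apply: etrans (_ : P (f @^-1` (~` [set x | (\int[nu]_y (h (x, y) ^+ 2)%:E < +oo)%E])) = 0%E).
    by [].
  by rewrite e [X in (X * _)%E]mu0 mul0e.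
transitivity (\int[law]_z cst 0%E z)%E; last by rewrite integral0.
apply: ae_eq_integral => //; first exact: (measurable_fubini_F ig).
have intc x : (\int[nu]_y (h (x, y) ^+ 2)%:E < +oo)%E ->
    (\int[nu]_y (u (x, y))%:E = 0)%E.
  move=> fin; have := integral_centered mh fin; rewrite /Rintegral => e.
  have iu := integrable_centered mh fin.
  by rewrite -(fineK (integrable_fin_num measurableT iu)) e.
apply: filterS lawae => z fin _; rewrite /fubini_F /g /=.
have iu := integrable_centered mh fin.
under eq_integral do rewrite EFinM.
by rewrite (integralZl measurableT iu) intc// mule0.
Qed.

(* The products of distinct terms have mean zero, [Y j] having law [nu]
   given [f] and [Y i]. *)
Lemma sum_centered_sqr_le :
  (\int[P]_w ((\sum_(j in J) U j w) ^+ 2)%:E <= (#|J|%:R * K)%:E)%E.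
Proof.
have -> : (\int[P]_w ((\sum_(j in J) U j w) ^+ 2)%:E =
    \sum_(i in J) \sum_(j in J) \int[P]_w (U i w * U j w)%:E)%E.
  pose g i j : T -> \bar R :=
    if (i \in J) && (j \in J) then fun w => (U i w * U j w)%:E else cst 0%E.
  have ig i j : P.-integrable [set: T] (g i j).
    rewrite /g; case: ifP => [/andP[iJ jJ]|_]; [exact: iUU|exact: integrable0].
  transitivity (\int[P]_w (\sum_(i < n) \sum_(j < n) g i j w))%E.
    apply: eq_integral => w _; rewrite expr2 mulr_suml -sumEFin big_mkcond/=.
    apply: eq_bigr => i _; rewrite /g; case: ifP => iJ; last by rewrite big1.
    rewrite mulr_sumr -sumEFin big_mkcond.
    by apply: eq_bigr => j _; case: (j \in J).
  rewrite integral_sum//; last by move=> i; apply: integrable_sum => // j _.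
  rewrite [RHS]big_mkcond/=; apply: eq_bigr => i _.
  rewrite integral_sum//; case: ifP => iJ; last first.
    by rewrite big1// => j _; rewrite /g iJ/= integral0.
  rewrite [RHS]big_mkcond/=; apply: eq_bigr => j _.
  by rewrite /g iJ/=; case: ifP => // _; rewrite integral0.
rewrite (@le_trans _ _ (\sum_(i in J) K%:E)%E)//.
  apply: lee_sum => i iJ; rewrite (bigD1 i)//= big1 ?adde0; first exact: EU2.
  by move=> j /andP[jJ ji]; rewrite EUU// eq_sym.
by rewrite sumEFin sumr_const mulr_natl.
Qed.

End conditional_variance.

(** * Products of measures *)

Section ae_integral0.
Context {R : realType} {d : measure_display} {T : measurableType d}.
Variable m : {measure set T -> \bar R}.

Lemma ge0_integral_eq0P (g : T -> \bar R) :
  measurable_fun [set: T] g -> (forall x, 0 <= g x)%E ->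
  (\int[m]_x g x = 0)%E <-> {ae m, forall x, g x = 0%E}.
Proof.
move=> mg g0; have := ae_eq_integral_abs m measurableT mg.
rewrite (eq_integral g); last by move=> x _; rewrite gee0_abs.
move=> [h1 h2]; split => [/h1|h].
  by apply: filterS => x; apply.
by apply: h2; apply: filterS h => x.
Qed.

Lemma integral_indicC_eq0P (S : set T) : measurable S ->
  (\int[m]_x (\1_(~` S) x)%:E = 0)%E <-> {ae m, forall x, S x}.
Proof.
move=> mS; rewrite integral_indic//; last exact: measurableC.
by rewrite setIT; have [h1 h2] := negligibleP m (measurableC mS); split.
Qed.

End ae_integral0.

Section ae_fubini.
Context {R : realType} {d1 d2 : measure_display} {T1 : measurableType d1}
  {T2 : measurableType d2}.
Variables (m1 : {sigma_finite_measure set T1 -> \bar R})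
  (m2 : {sigma_finite_measure set T2 -> \bar R}).

Variable S : set (T1 * T2).
Hypothesis mS : measurable S.

Let f (z : T1 * T2) : \bar R := (\1_(~` S) z)%:E.
Let mf : measurable_fun [set: T1 * T2] f.
Proof. by apply/measurable_EFinP/measurable_indic; exact: measurableC. Qed.
Let f0 z : (0 <= f z)%E. Proof. by rewrite lee_fin. Qed.

(** Tonelli applied to the indicator of the complement: a nonnegative integral vanishes exactly when
    its integrand does almost everywhere. *)
Lemma ae_product1P : {ae (m1 \x m2)%E, forall z, S z} <->
  {ae m1, forall x, {ae m2, forall y, S (x, y)}}.
Proof.
have mSx x : measurable [set y | S (x, y)].
  rewrite -[X in measurable X]setTI; exact: (@measurable_pair1 _ _ T1 T2 x measurableT _ mS).
apply: iff_trans (iff_sym (integral_indicC_eq0P (m1 \x m2)%E mS)) _.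
rewrite -/f (fubini_tonelli1 f)//.
apply: iff_trans (ge0_integral_eq0P m1 (measurable_fun_fubini_tonelli_F f mf f0) _) _.
  by move=> x; exact: integral_ge0.
by split; apply: filterS => x; rewrite /fubini_F => /(integral_indicC_eq0P m2 (mSx x)).
Qed.

Lemma ae_product2P : {ae (m1 \x m2)%E, forall z, S z} <->
  {ae m2, forall y, {ae m1, forall x, S (x, y)}}.
Proof.
have mSy y : measurable [set x | S (x, y)].
  rewrite -[X in measurable X]setTI; exact: (@measurable_pair2 _ _ T1 T2 y measurableT _ mS).
apply: iff_trans (iff_sym (integral_indicC_eq0P (m1 \x m2)%E mS)) _.
rewrite -/f (fubini_tonelli2 f)//.
apply: iff_trans (ge0_integral_eq0P m2 (measurable_fun_fubini_tonelli_G f mf f0) _) _.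
  by move=> x; exact: integral_ge0.
by split; apply: filterS => x; rewrite /fubini_G => /(integral_indicC_eq0P m1 (mSy x)).
Qed.

End ae_fubini.

(** * Enlarged filtration and moments of one observation *)

Section enlarged_filtration.
Context {R : realType} {d : measure_display} {T : measurableType d}.
Variables (F : R -> set (set T)) (X : R -> T -> R).
Hypotheses (hF : is_filtration F)
  (mX : forall t, 0 <= t <= 1 -> measurable_fun [set: T] (X t)).

Lemma enlarged_is_filtration : is_filtration (enlarged_filtration F X).
Proof.
split.
  move=> t t01; split.
    apply: sigma_algebra_bigcap => s _; exact: smallest_sigma_algebra.
  move=> A /(_ 1 (or_intror erefl)); apply: smallest_sub A.
    exact: sigma_algebra_measurable.
  move=> A [F1A|[u [B [u01 mB ->]]]].
    by apply: (filtration_measurable hF) F1A; rewrite ler01 lexx.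
  by rewrite -[X in measurable X]setTI; exact: mX.
move=> s t s0 st t1 A As u [/andP[tu u1]|u1]; apply: As; [left|by right].
by rewrite (le_lt_trans st tu).
Qed.

Lemma filtration_sub_enlarged t : 0 <= t <= 1 -> F t `<=` enlarged_filtration F X t.
Proof.
move=> /andP[t0 t1] A FA s hs; apply: sub_sigma_algebra; left.
by apply: (hF.2 t s) FA => //; case: hs => [/andP[/ltW]|->].
Qed.

End enlarged_filtration.

Section model_moments.
Context {R : realType} {d : measure_display} (M : obs_model R d).
Hypothesis hM : obs_model_ok M.

Lemma model_filtration : is_filtration (filt M).
Proof. by case: hM => -[]. Qed.

Lemma model_counting : counting_process (cnt M).
Proof.
case: hM => _ [cp ad] _ _ _; split => // t t01 _ B mB; rewrite setTI.
by apply: (filtration_measurable model_filtration t01); exact: ad.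
Qed.

Lemma model_cov : measurable_process (cov M).
Proof. by case: hM => _ _ [cX mX] _ _; exact: caglad_measurable_process. Qed.

Variable C : R.
Hypothesis C0 : 0 <= C.
Hypothesis hC : {ae prob M, forall w, caglad (full_intens M ^~ w) /\
  forall t, 0 <= t <= 1 -> full_intens M t w <= C}.

(** The assumed bound concerns the intensity for the enlarged filtration, so the moment bounds are
    applied there; their conclusions no longer mention a filtration. *)
Lemma model_moments_le : (\int[prob M]_w (cnt M 1 w)%:R%:E <= C%:E)%E /\
  (\int[prob M]_w ((cnt M 1 w)%:R ^+ 2)%:E <= (C + 2 * C ^+ 2)%:E)%E.
Proof.
have [_ [_ ad] [_ mX] [_ fint] _] := hM.
have hG := enlarged_is_filtration model_filtration mX.
have lC : {ae prob M, forall w, forall t, 0 <= t <= 1 -> full_intens M t w <= C}.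
  by apply: filterS hC => w [].
split; first by have [] := expectation_count_le hG model_counting C0 fint lC.
apply: (second_moment_count_le hG model_counting _ C0 fint lC) => t t01 B mB.
by apply: (filtration_sub_enlarged model_filtration) => //; exact: ad.
Qed.

Lemma model_integrable_count :
  (prob M).-integrable [set: space M] (fun w => (cnt M 1 w)%:R%:E).
Proof.
have [le _] := model_moments_le; apply/integrableP; split.
  by apply/measurable_EFinP; apply: model_counting.2; rewrite ler01 lexx.
under eq_integral do rewrite abse_EFin ger0_norm//.
exact: le_lt_trans le (ltry _).
Qed.

End model_moments.

(** * Time, training data and a new observation *)

Section product3.
Context {R : realType} {d1 d2 d3 : measure_display} {T1 : measurableType d1}
  {T2 : measurableType d2} {T3 : measurableType d3}.
Variables (P1 : probability T1 R) (P2 : probability T2 R) (P3 : probability T3 R).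
Variable Q : probability (T2 * T3)%type R.
Hypothesis QE : forall S, measurable S -> Q S = (P2 \x P3)%E S.

Lemma measurable_product3_section (y : T2) :
  measurable_fun [set: T1 * T3] (fun p => (p.1, (y, p.2))).
Proof.
apply: measurable_fun_pair; first exact: measurable_fst.
by apply: measurable_fun_pair => //; exact: measurable_snd.
Qed.

Section nonnegative.
Variable f : T1 * (T2 * T3) -> \bar R.
Hypotheses (mf : measurable_fun [set: T1 * (T2 * T3)] f) (f0 : forall z, (0 <= f z)%E).

Let mfG : measurable_fun [set: T2 * T3] (fubini_G P1 f).
Proof. exact: measurable_fun_fubini_tonelli_G. Qed.
Let fG0 z : (0 <= fubini_G P1 f z)%E.
Proof. by apply: integral_ge0. Qed.

Let sectionE y : (\int[P1 \x P3]_p f (p.1, (y, p.2)) = fubini_F P3 (fubini_G P1 f) y)%E.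
Proof.
rewrite (fubini_tonelli2 (fun p => f (p.1, (y, p.2))))//.
exact: (measurableT_comp mf (measurable_product3_section y)).
Qed.

(** With [T1] time, [T2] training data and [T3] an observation, the training data move to the
    outermost integral, leaving an integral over time and observation at fixed data. *)
Lemma ge0_integral_product3 :
  (\int[P1 \x Q]_z f z = \int[P2]_y \int[P1 \x P3]_p f (p.1, (y, p.2)))%E.
Proof.
rewrite (fubini_tonelli2 f)//.
rewrite (eq_measure_integral (P2 \x P3)%E); last by move=> S mS _; exact: QE.
rewrite (fubini_tonelli1 (fubini_G P1 f))//.
by apply: eq_integral => y _; rewrite sectionE.
Qed.

Lemma measurable_integral_product3 :
  measurable_fun [set: T2] (fun y => \int[P1 \x P3]_p f (p.1, (y, p.2)))%E.
Proof.
rewrite (_ : (fun y => _) = fubini_F P3 (fubini_G P1 f)); last exact/funext/sectionE.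
exact: measurable_fun_fubini_tonelli_F.
Qed.

End nonnegative.

Lemma ae_product3 (S : set (T1 * (T2 * T3))) : measurable S ->
  {ae (P1 \x Q)%E, forall z, S z} ->
  {ae P2, forall y, {ae (P1 \x P3)%E, forall p, S (p.1, (y, p.2))}}.
Proof.
move=> mS; have mSC : measurable_fun [set: T1 * (T2 * T3)] (fun z => (\1_(~` S) z)%:E : \bar R).
  by apply/measurable_EFinP/measurable_indic; exact: measurableC.
have SC0 z : (0 <= (\1_(~` S) z)%:E :> \bar R)%E by rewrite lee_fin.
move=> /(integral_indicC_eq0P (P1 \x Q)%E mS); rewrite ge0_integral_product3//.
move=> /(ge0_integral_eq0P P2 (measurable_integral_product3 mSC SC0)) h.
apply: filterS (h _) => [y|y]; last exact: integral_ge0.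
have mSy : measurable [set p : T1 * T3 | S (p.1, (y, p.2))].
  by rewrite -[X in measurable X]setTI; exact: measurable_product3_section.
by move=> e; apply/(integral_indicC_eq0P (P1 \x P3)%E mSy); rewrite -[RHS]e.
Qed.

End product3.

(** * An estimator fitted on independent data *)

Section trained_estimator.
Context {R : realType} {d d1 : measure_display} {T1 : measurableType d1}.
Variable M : obs_model R d.
Hypothesis hM : obs_model_ok M.
Variables (mu : probability T1 R) (Q : probability (T1 * space M)%type R).
Hypothesis QE : forall S, measurable S -> Q S = (mu \x prob M)%E S.

Local Notation kappa := (@unit_lebesgue R \x prob M)%E.
Local Notation rho := (@unit_lebesgue R \x Q)%E.

Variables lh Ph : T1 -> R -> space M -> R.
Let N s (z : T1 * space M) := cnt M s z.2.
Let L s (z : T1 * space M) := lh z.1 s z.2.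
Let Gh D s x := cov M s x - Ph D s x.
Let G s (z : T1 * space M) := Gh z.1 s z.2.
Hypotheses (mL : measurable_process L)
  (mPh : measurable_process (fun s (z : T1 * space M) => Ph z.1 s z.2)).

Let cN : counting_process N.
Proof. exact: counting_process_comp measurable_snd (model_counting hM). Qed.

Let mG : measurable_process G.
Proof.
apply: measurable_processB => //.
exact: measurable_process_comp measurable_snd (model_cov hM).
Qed.

Definition trained_integral t z := int_dM (G ^~ z) (N ^~ z) (L ^~ z) t.

Lemma measurable_trained_integral t : 0 <= t <= 1 ->
  measurable_fun [set: T1 * space M] (trained_integral t).
Proof.
move=> t01; apply: measurable_funB; first exact: measurable_int_dN.
apply: measurable_int_ds; last exact: measurable_processM.
by case/andP: t01.
Qed.

Definition trained_variation z := int_dN (fun s => G s z ^+ 2) (N ^~ z) 1.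

Lemma measurable_trained_variation :
  measurable_fun [set: T1 * space M] trained_variation.
Proof.
apply: (measurable_int_dN (H := fun s z => G s z ^+ 2)) => //.
  by rewrite ler01 lexx.
exact: measurable_processX.
Qed.

Variables C C' : R.
Hypotheses (C0 : 0 <= C) (C'0 : 0 <= C').
Hypothesis hC : {ae prob M, forall w, caglad (full_intens M ^~ w) /\
  forall t, 0 <= t <= 1 -> full_intens M t w <= C}.

(** A bound almost everywhere for Lebesgue measure times [Q] says nothing at the jump times, a null
    set of times on each path; the integrals against [dN] need this separate event. *)
Definition jumps_bounded z := forall k, (k < N 1 z)%N ->
  `|G (jump_time (N ^~ z) k.+1) z| <= C'.

Lemma measurable_jumps_bounded : measurable jumps_bounded.
Proof.
have t1 : 0 <= (1 : R) <= 1 by rewrite ler01 lexx.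
rewrite (_ : jumps_bounded = \bigcap_k (~` [set z | (k.+1 <= N 1%R z)%N] `|`
    [set z | `|cut 1 G (jump_time (N ^~ z) k.+1, z)| <= C'])); last first.
  apply/seteqP; split => [z /= h k _|z h k kN].
    have [kN|h0] := leqP k.+1 (N 1 z); [right|left].
      rewrite /= /cut /= jump_time_ge0 (jump_time_le _ (cN.1 z))// kN; exact: h.
    by move=> kN; move: h0; rewrite ltnS leqNgt kN.
  case: (h k Logic.I) => //=.
  by rewrite /cut /= jump_time_ge0 (jump_time_le _ (cN.1 z))// kN.
apply: bigcap_measurable; first by exists 0%N.
move=> k _; apply: measurableU.
  by apply: measurableC; exact: measurable_counting_le.
rewrite -[X in measurable X]setTI; apply: measurable_fun_le => //.
by apply: measurableT_comp => //; exact: measurable_at_jump_time.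
Qed.

Hypothesis bGN : {ae Q, forall z, jumps_bounded z}.
Hypothesis bG : {ae rho, forall p, `|cut 1 G p| <= C'}.
Hypothesis bL : {ae rho, forall p, `|cut 1 L p| <= C}.

Let mbd H c : measurable_process H ->
  measurable [set p : R * (T1 * space M) | `|cut 1 H p| <= c].
Proof.
move=> mH; rewrite -[X in measurable X]setTI; apply: measurable_fun_le => //.
by apply: measurableT_comp => //; exact: mH.
Qed.

Lemma trained_integral_le t : 0 <= t <= 1 ->
  {ae Q, forall z, `|trained_integral t z| <= C' * ((N 1 z)%:R + C)}.
Proof.
move=> t01; have /andP[t0 t1] := t01.
have /(ae_product2P unit_lebesgue Q (mbd C' mG)) bG' := bG.
have /(ae_product2P unit_lebesgue Q (mbd C mL)) bL' := bL.
apply: filterS3 bGN bG' bL' => z Nz Gz Lz; rewrite mulrDr.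
apply: le_trans (ler_normB _ _) _; apply: lerD.
  have NN : (N t z <= N 1%R z)%N by apply: counting_path_mono (cN.1 z) _ _ _.
  apply: le_trans (le_int_dN cN t01 _) _; first by move=> k kN; apply: Nz; exact: leq_trans NN.
  by rewrite ler_wpM2l// ler_nat.
have mGL := measurable_processM mG mL.
pose GL s z := G s z * L s z; have h : (`|(int_ds (GL ^~ z) t)%:E| <= path_mass GL z)%E.
  exact: le_int_ds.
rewrite -lee_fin; apply: le_trans h _; rewrite /path_mass.
rewrite -[leRHS]mule1 -(probability_setT (@unit_lebesgue R)) -integral_cst//.
apply: ae_ge0_le_integral => //=.
- apply/measurable_EFinP; apply: measurableT_comp => //.
  exact: measurable_section_cut.
- by move=> s _; rewrite lee_fin mulr_ge0.
- apply: filterS2 Gz Lz => s h1 h2 _; rewrite lee_fin /cut /=.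
  move: h1 h2; rewrite /= /cut /=; case: ifP => _ h1 h2.
    by rewrite normrM ler_pM.
  by rewrite normr0 mulr_ge0.
Qed.

Let integral_snd (g : space M -> \bar R) : measurable_fun [set: space M] g ->
  (forall x, 0 <= g x)%E -> (\int[Q]_z g z.2 = \int[prob M]_x g x)%E.
Proof.
move=> mg g0; rewrite (eq_measure_integral (mu \x prob M)%E); last by move=> S mS _; exact: QE.
rewrite (fubini_tonelli1 (fun z : T1 * space M => g z.2))//; last first.
  by apply: (measurableT_comp mg); exact: measurable_snd.
by rewrite /fubini_F /= (integral_cst mu measurableT)/= probability_setT mule1.
Qed.

Let mN1 : measurable_fun [set: space M] (fun x => (cnt M 1 x)%:R : R).
Proof. by apply: (model_counting hM).2; rewrite ler01 lexx. Qed.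

(** The constant comes from the pathwise bound by [C' * (N + C)], from [(a + b)^2 <= 2 (a^2 + b^2)],
    and from the second moment of the count. *)
Lemma trained_integral_sqr_le t : 0 <= t <= 1 ->
  (\int[Q]_z (trained_integral t z ^+ 2)%:E <=
   (2 * C' ^+ 2 * ((C + 2 * C ^+ 2) + C ^+ 2))%:E)%E.
Proof.
move=> t01; have [_ N2] := model_moments_le hM C0 hC.
have mY := measurable_trained_integral t01.
pose g (x : space M) : \bar R := ((2 * C' ^+ 2)%:E * (((cnt M 1 x)%:R ^+ 2)%:E + (C ^+ 2)%:E))%E.
have c0 : 0 <= 2 * C' ^+ 2 by rewrite mulr_ge0// sqr_ge0.
have mN2 : measurable_fun [set: space M] (fun x => ((cnt M 1 x)%:R ^+ 2)%:E : \bar R).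
  by apply/measurable_EFinP; exact: measurable_funX.
have mg : measurable_fun [set: space M] g.
  by apply: emeasurable_funM => //; apply: emeasurable_funD.
have g0 x : (0 <= g x)%E by rewrite lee_fin mulr_ge0// addr_ge0// sqr_ge0.
apply: (@le_trans _ _ (\int[Q]_z g z.2)%E).
  apply: ae_ge0_le_integral => //.
  - by move=> z _; rewrite lee_fin sqr_ge0.
  - by apply/measurable_EFinP; exact: measurable_funX.
  - by apply: (measurableT_comp mg); exact: measurable_snd.
  - apply: filterS (trained_integral_le t01) => z h _; rewrite lee_fin.
    rewrite -[leLHS]ger0_norm ?sqr_ge0// normrX.
    apply: le_trans (_ : (C' * ((N 1 z)%:R + C)) ^+ 2 <= _).
      by rewrite ler_pXn2r// nnegrE mulr_ge0// addr_ge0.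
    set n := (N 1 z)%:R; rewrite [leRHS](_ : _ = C' ^+ 2 * (2 * (n ^+ 2 + C ^+ 2))); last by ring.
    by rewrite exprMn ler_wpM2l ?sqr_ge0//; have := sqr_ge0 (n - C); nra.
rewrite integral_snd// /g ge0_integralZl_EFin//; last first.
  - by apply: emeasurable_funD.
  - by move=> x _; rewrite lee_fin addr_ge0// sqr_ge0.
rewrite ge0_integralD//; last by move=> x _; rewrite lee_fin sqr_ge0.
rewrite integral_cst//= probability_setT mule1 (EFinM (2 * C' ^+ 2)).
by apply: lee_wpmul2l; rewrite ?lee_fin// EFinD leeD2r.
Qed.

Lemma trained_variation_le : (\int[Q]_z `|(trained_variation z)%:E| <= (C' ^+ 2 * C)%:E)%E.
Proof.
have [N1 _] := model_moments_le hM C0 hC.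
have t1 : 0 <= (1 : R) <= 1 by rewrite ler01 lexx.
have mN1' : measurable_fun [set: space M] (fun x => (cnt M 1 x)%:R%:E : \bar R) by exact/measurable_EFinP.
pose g (x : space M) : \bar R := ((C' ^+ 2)%:E * (cnt M 1 x)%:R%:E)%E.
have mg : measurable_fun [set: space M] g by exact: emeasurable_funM.
have g0 x : (0 <= g x)%E by rewrite lee_fin mulr_ge0// sqr_ge0.
apply: (@le_trans _ _ (\int[Q]_z g z.2)%E).
  apply: ae_ge0_le_integral => //.
  - apply: measurableT_comp => //; apply/measurable_EFinP; exact: measurable_trained_variation.
  - by apply: (measurableT_comp mg); exact: measurable_snd.
  - apply: filterS bGN => z h _; rewrite abse_EFin lee_fin.
    apply: (le_int_dN (H := fun s z => G s z ^+ 2) cN t1) => k kN.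
    by rewrite normrX ler_pXn2r// ?nnegrE//; exact: h.
rewrite integral_snd// /g ge0_integralZl_EFin ?sqr_ge0// (EFinM (C' ^+ 2)).
by apply: lee_wpmul2l; rewrite ?lee_fin ?sqr_ge0.
Qed.

Hypotheses (plh : forall D, predictable (filt M) (lh D))
  (pPh : forall D, predictable (filt M) (Ph D)).
Hypothesis bR : {ae prob M, forall w, forall t, 0 <= t <= 1 -> `|residual M t w| <= C'}.

Let U s (z : T1 * space M) := proj M s z.2 - Ph z.1 s z.2.
Let V s (z : T1 * space M) := intens M s z.2 - L s z.
Hypothesis hV : (\int[rho]_p (cut 1 V p ^+ 2)%:E < +oo)%E.

Let hF := model_filtration hM.
Let intensM : is_intensity (prob M) (filt M) (cnt M) (intens M).
Proof. by case: hM => _ _ _ []. Qed.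
Let projM : predictable_projection (prob M) (filt M) (cov M) (proj M).
Proof. by case: hM. Qed.
Let ml : measurable_process (intens M).
Proof. by case: intensM => pl _ _; exact: predictable_measurable_process pl. Qed.
Let mproj : measurable_process (proj M).
Proof. by case: projM => pl _; exact: predictable_measurable_process pl. Qed.
Let ml' : measurable_process (fun s (z : T1 * space M) => intens M s z.2).
Proof. exact: measurable_process_comp measurable_snd ml. Qed.
Let mV : measurable_process V. Proof. exact: measurable_processB. Qed.
Let mU : measurable_process U.
Proof. by apply: measurable_processB => //; exact: measurable_process_comp measurable_snd mproj. Qed.

(** Integrability is read off the estimator: almost everywhere [|l| <= |V| + |L| <= 1 + V^2 + C],
    with [V] square integrable by [hV]. *)
Lemma integrable_intensity :
  kappa.-integrable [set: R * space M] (fun p => (cut 1 (intens M) p)%:E).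
Proof.
pose g (p : R * (T1 * space M)) := 1 + cut 1 V p ^+ 2 + C.
have ic c : rho.-integrable [set: R * (T1 * space M)] (EFin \o cst c) by exact: integrable_product_cst.
have ig : rho.-integrable [set: R * (T1 * space M)] (EFin \o g).
  have iV2 : rho.-integrable [set: R * (T1 * space M)] (fun p => (cut 1 V p ^+ 2)%:E).
    apply/integrableP; split.
      by apply/measurable_EFinP; apply: measurable_funX; exact: mV.
    by under eq_integral do rewrite gee0_abs ?lee_fin ?sqr_ge0//.
  exact: (integrableD measurableT (integrableD measurableT (ic 1) iV2) (ic C)).
have /integrableP[_ il] : rho.-integrable [set: R * (T1 * space M)]
    (fun p => (cut 1 (fun s (z : T1 * space M) => intens M s z.2) p)%:E).
  apply: ae_le_integrable ig _; first exact: ml'.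
  apply: filterS bL => p Lp.
  have -> : cut 1 (fun s (z : T1 * space M) => intens M s z.2) p = cut 1 V p + cut 1 L p.
    by rewrite /cut; case: ifP; rewrite ?addr0// /V subrK.
  rewrite [leRHS]ger0_norm; last by rewrite /g !addr_ge0// sqr_ge0.
  apply: le_trans (ler_normD _ _) _; apply: lerD => //.
  rewrite -[cut 1 V p ^+ 2]real_normK ?num_real//.
  by have := sqr_ge0 (`|cut 1 V p| - 1); have := normr_ge0 (cut 1 V p); nra.
apply/integrableP; split; first by apply/measurable_EFinP; exact: ml.
apply: le_lt_trans il; rewrite (ge0_integral_product3 unit_lebesgue QE)//; last first.
  by apply: measurableT_comp => //; apply/measurable_EFinP; exact: ml'.
set K := (X in (X <= _)%E).
have := integral_cst mu measurableT K; rewrite /= probability_setT mule1 => e.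
by rewrite -[leLHS]e.
Qed.

Let idM t : 0 <= t <= 1 -> (prob M).-integrable [set: space M]
  (EFin \o dM_integral (cnt M) t (residual M) (intens M)).
Proof.
exact: (integrable_dM hF (model_counting hM) (model_integrable_count hM C0 hC)
  (model_cov hM) projM intensM integrable_intensity C'0 bR).
Qed.

Lemma LCM_fin t : 0 <= t <= 1 ->
  LCM M t = (\int[prob M]_w dM_integral (cnt M) t (residual M) (intens M) w)%R%:E.
Proof.
move=> t01; rewrite /LCM unlock /Rintegral fineK//.
exact: (integrable_fin_num measurableT (idM t01)).
Qed.

Let bias t D := `|section_mean (prob M) (trained_integral t) D - fine (LCM M t)|.

(** At fixed training data the estimators are fixed predictable processes, so [bias_eq] applies to
    almost every [D], the almost sure bounds being disintegrated first. Passing from [0, t] to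
    [0, 1] makes the right side independent of [t]. *)
Lemma bias_le t : 0 <= t <= 1 -> {ae mu, forall D,
  ((bias t D)%:E <= \int[kappa]_p `|(cut 1 U (p.1, (D, p.2)) * cut 1 V (p.1, (D, p.2)))%:E|)%E}.
Proof.
move=> t01; have /andP[t0 t1] := t01.
have bGN' : {ae (mu \x prob M)%E, forall z, jumps_bounded z}.
  have mJ := measurable_jumps_bounded.
  move: bGN => /(negligibleP _ (measurableC mJ)) QJ.
  by apply/(negligibleP _ (measurableC mJ)); apply: etrans QJ; apply/esym/QE; exact: measurableC.
have /(ae_product1P _ _ measurable_jumps_bounded) bN := bGN'.
have bG' := ae_product3 QE (mbd C' mG) bG.
have bL' := ae_product3 QE (mbd C mL) bL.
apply: filterS3 bN bG' bL' => D ND GD LD.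
have e := bias_eq hF (model_counting hM) (model_integrable_count hM C0 hC)
  (model_cov hM) projM intensM integrable_intensity C0 C'0 bR (plh D) (pPh D) ND GD LD t01.
have i := integrable_bias hF projM intensM integrable_intensity C0 C'0 bR
  (plh D) (pPh D) GD LD t01.
pose W s w := (proj M s w - Ph D s w) * (intens M s w - lh D s w).
have {}e : section_mean (prob M) (trained_integral t) D - fine (LCM M t) =
    (\int[kappa]_p cut t W p)%R by rewrite LCM_fin.
have fi : (\int[kappa]_p (cut t W p)%:E)%E \is a fin_num by exact: (integrable_fin_num measurableT i).
rewrite /bias e /Rintegral -abse_EFin (fineK fi).
apply: le_trans (le_abse_integral _ measurableT (measurable_int _ i)) _.
apply: ge0_le_integral => //.
- by apply: measurableT_comp => //; exact: measurable_int i.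
- apply: measurableT_comp => //; apply/measurable_EFinP; apply: measurable_funM.
    exact: (measurableT_comp mU (measurable_product3_section D)).
  exact: (measurableT_comp mV (measurable_product3_section D)).
- move=> p _; rewrite lee_fin; apply: le_trans (le_cut_norm W p t1) _.
  by rewrite /cut/=; case: ifP; rewrite ?mul0r.
Qed.

(** The Cauchy-Schwarz inequality is used once, on time, training data and observation together,
    since only errors averaged over the training data are controlled. *)
Lemma integral_bias_le t : 0 <= t <= 1 ->
  (\int[mu]_D (bias t D)%:E <=
   (\int[rho]_p (cut 1 U p ^+ 2)%:E) `^ 2^-1 * (\int[rho]_p (cut 1 V p ^+ 2)%:E) `^ 2^-1)%E.
Proof.
move=> t01.
have mUV : measurable_fun [set: R * (T1 * space M)] (fun p => `|(cut 1 U p * cut 1 V p)%:E|%E).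
  apply: measurableT_comp => //; apply/measurable_EFinP.
  by apply: measurable_funM; [exact: mU|exact: mV].
have mb : measurable_fun [set: T1] (fun D => (bias t D)%:E : \bar R).
  apply/measurable_EFinP; apply: measurableT_comp => //.
  apply: measurable_funB => //; apply: measurable_section_mean.
  exact: measurable_trained_integral.
have p2 : 2^-1 + 2^-1 = 1 :> R by field.
have := hoelder rho mU mV (ltr0Sn R 1) (ltr0Sn R 1) p2.
rewrite Lnorm1 => h.
apply: le_trans (_ : \int[rho]_p `|(cut 1 U p * cut 1 V p)%:E| <= _)%E.
  rewrite (ge0_integral_product3 unit_lebesgue QE mUV)//; apply: ae_ge0_le_integral => //.
  - by move=> D _; rewrite lee_fin normr_ge0.
  - by move=> D _; exact: integral_ge0.
  - by apply: measurable_integral_product3 mUV _.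
  - by apply: filterS (bias_le t01) => D Dle _.
apply: le_trans h _; rewrite unlock.
have sq H : (\int[rho]_p `|(EFin \o cut 1 H) p| `^ 2 = \int[rho]_p (cut 1 H p ^+ 2)%:E)%E.
  apply: eq_integral => p _.
  by rewrite abse_EFin poweR_EFin powR_mulrn// real_normK ?num_real.
by rewrite !sq.
Qed.

End trained_estimator.

(** * The estimates from a sample *)

Section random_element_law.
Context {R : realType} {d d1 : measure_display} {T : measurableType d}
  {T1 : measurableType d1}.
Variables (P : probability T R) (X : T -> T1).
Hypothesis mX : measurable_fun [set: T] X.

#[local] HB.instance Definition _ := isMeasurableFun.Build _ _ _ _ X mX.
Definition law_of : probability T1 R := distribution P (X : {mfun _ >-> _}).

Lemma ge0_integral_law_of (f : T1 -> \bar R) : measurable_fun [set: T1] f ->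
  (forall y, 0 <= f y)%E -> (\int[law_of]_y f y = \int[P]_w f (X w))%E.
Proof. exact: ge0_integral_distribution. Qed.

Lemma ae_law_of (A : set T1) : measurable A ->
  {ae law_of, forall y, A y} <-> {ae P, forall w, A (X w)}.
Proof.
move=> mA; have mAC := measurableC mA.
have mXA : measurable [set w | (~` A) (X w)].
  by rewrite -[X in measurable X]setTI; exact: mX.
split=> [/(negligibleP _ mAC) A0|/(negligibleP _ mXA) A0].
  exact/(negligibleP _ mXA).
exact/(negligibleP _ mAC).
Qed.

End random_element_law.

Section sample_laws.
Context {R : realType} {d d' : measure_display} {M : obs_model R d}
  {J : forall n, {set 'I_n}}.
Variables (S : sampling d' M J) (hS : sampling_ok S) (n : nat).
Local Notation P := (sprob S).
Local Notation TD := ((#|~: J n|).-tuple (space M)).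

Let iid : iid_copies S. Proof. by case: hS. Qed.
Let mobs o : measurable_fun [set: sspace S] (all_obs (S := S) o).
Proof. by case: iid. Qed.
Let obs_law o A : measurable A -> P (all_obs o @^-1` A) = prob M A.
Proof. by move=> mA; case: iid => _ h _; exact: h. Qed.
Let obs_indep : independent_family P (all_obs (S := S)). Proof. by case: iid. Qed.

Let o : (#|~: J n|).-tuple (option nat) :=
  [tuple Some (nat_of_ord (enum_val k)) | k < #|~: J n|].

Let uo : uniq o.
Proof. by apply/tuple_uniqP => i j; rewrite !tnth_mktuple => -[/ord_inj/enum_val_inj]. Qed.

Let trainE w : train (S := S) n w = [tuple all_obs (S := S) (tnth o k) w | k < #|~: J n|].
Proof. by apply: eq_from_tnth => k; rewrite !tnth_mktuple. Qed.

Lemma measurable_train : measurable_fun [set: sspace S] (train (S := S) n).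
Proof. rewrite (funext trainE); exact: measurable_tuple_family. Qed.

Definition train_law : probability TD R := law_of P measurable_train.

Let train_indep i A B : i \notin o -> measurable A -> measurable B ->
  P (train (S := S) n @^-1` A `&` all_obs i @^-1` B) = (train_law A * prob M B)%E.
Proof.
move=> io mA mB; have -> : train_law A = P (train (S := S) n @^-1` A) by [].
by rewrite (funext trainE) (independent_tuple mobs obs_indep uo io)// obs_law.
Qed.

Let new_notin : None \notin o.
Proof. by apply/mapP => -[k]. Qed.

Let old_notin (j : 'I_n) : j \in J n -> Some (val j) \notin o.
Proof.
move=> jJ; apply/mapP => -[k _ [/ord_inj jk]].
by have := enum_valP k; rewrite -jk inE jJ.
Qed.

Lemma train_new_indep A B : measurable A -> measurable B ->
  P (train (S := S) n @^-1` A `&` newobs S @^-1` B) = (train_law A * prob M B)%E.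
Proof. by move=> mA mB; exact: (train_indep new_notin mA mB). Qed.

Lemma train_obs_indep (j : 'I_n) A B : j \in J n -> measurable A -> measurable B ->
  P (train (S := S) n @^-1` A `&` obs S j @^-1` B) = (train_law A * prob M B)%E.
Proof. by move=> jJ mA mB; exact: (train_indep (old_notin jJ) mA mB). Qed.

Lemma measurable_newobs : measurable_fun [set: sspace S] (newobs S).
Proof. exact: (mobs None). Qed.

Lemma measurable_obs j : measurable_fun [set: sspace S] (obs S j).
Proof. exact: (mobs (Some j)). Qed.

(** Putting observation [i] in front of the training tuple gives another tuple of distinct copies,
    independent of observation [j]; [psi] splits the longer tuple again. *)
Lemma train_obs2_indep (i j : 'I_n) (A : set (TD * space M)) B :
  i \in J n -> j \in J n -> i != j -> measurable A -> measurable B ->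
  P ((fun w => (train (S := S) n w, obs S i w)) @^-1` A `&` obs S j @^-1` B) =
  (P ((fun w => (train (S := S) n w, obs S i w)) @^-1` A) * prob M B)%E.
Proof.
move=> iJ jJ ij mA mB.
pose o' := cons_tuple (Some (val i)) o.
have uo' : uniq o' by rewrite /= old_notin.
have jo' : Some (val j) \notin o'.
  by rewrite inE negb_or old_notin// andbT eq_sym; apply: contra ij => /eqP[/ord_inj ->].
pose psi (x : (#|~: J n|).+1.-tuple (space M)) : TD * space M :=
  ([tuple tnth x (lift ord0 k) | k < #|~: J n|], tnth x ord0).
have mpsi : measurable_fun [set: (#|~: J n|).+1.-tuple (space M)] psi.
  apply: measurable_fun_pair; last exact: measurable_tnth.
  apply/measurable_fun_tnthP => k.
  rewrite (_ : _ \o _ = (fun x => tnth x (lift ord0 k))); first exact: measurable_tnth.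
  by apply/funext => x /=; rewrite tnth_mktuple.
have -> : (fun w => (train (S := S) n w, obs S i w)) =
    psi \o (fun w => [tuple all_obs (S := S) (tnth o' k) w | k < (#|~: J n|).+1]).
  apply/funext => w; rewrite /psi /= !tnth_mktuple; congr pair.
  rewrite trainE; apply: eq_from_tnth => k; rewrite !tnth_mktuple.
  by congr (all_obs _ w); rewrite /o' tnthS tnth_mktuple.
rewrite comp_preimage.
rewrite (independent_tuple mobs obs_indep uo' jo')//; last first.
  by rewrite -[X in measurable X]setTI; exact: mpsi.
by rewrite obs_law.
Qed.

End sample_laws.

Section sample_bounds.
Context {R : realType} {d d' : measure_display} {M : obs_model R d}
  {J : forall n, {set 'I_n}}.
Variables (S : sampling d' M J) (hM : obs_model_ok M) (hS : sampling_ok S) (n : nat).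
Local Notation P := (sprob S).
Local Notation TD := ((#|~: J n|).-tuple (space M)).
Local Notation mu := (train_law hS n).
Local Notation tr := (train (S := S) n).

(** Taken as an image law so that almost sure statements about the new observation become statements
    about [Q]; [train_new_lawE] then identifies it with a product. *)
Definition train_new_law : probability (TD * space M)%type R :=
  law_of P (measurable_fun_pair (measurable_train (n := n) hS) (measurable_newobs hS)).
Local Notation Q := train_new_law.
Local Notation rho := (@unit_lebesgue R \x Q)%E.

Lemma train_new_lawE A : measurable A -> Q A = (mu \x prob M)%E A.
Proof.
move=> mA; apply/esym.
exact: (joint_lawE (measurable_train (n := n) hS) (measurable_newobs hS)
  (@train_new_indep _ _ _ _ _ S hS n) mA).
Qed.

Let measurable_estimator (h : TD -> R -> space M -> R) : estimator_ok h ->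
  measurable_process (fun s (z : TD * space M) => h z.1 s z.2).
Proof.
case=> mh _; apply/measurable_processP.
pose phi (p : R * (TD * space M)) := (p.2.1, (p.1, p.2.2)).
have mphi : measurable_fun [set: R * (TD * space M)] phi.
  apply: measurable_fun_pair.
    by apply: (measurableT_comp measurable_fst); exact: measurable_snd.
  apply: measurable_fun_pair; first exact: measurable_fst.
  by apply: (measurableT_comp measurable_snd); exact: measurable_snd.
have mI : measurable [set q : TD * (R * space M) | 0 <= q.2.1 <= 1].
  rewrite (_ : [set q | _] = setT `*` (`[0, 1] `*` setT)).
    by apply: measurableX => //; exact: measurableX.
  by apply/seteqP; split => q /=; rewrite in_itv/=; tauto.
apply: (measurable_comp mI (f := fun q : TD * (R * space M) => h q.1 q.2.1 q.2.2) (g := phi)) => //.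
- by move=> _ [p [/=]] + _ <-; rewrite in_itv.
- exact: measurable_funTS mphi.
Qed.

Let ok : estimator_ok (lhat S n) /\ estimator_ok (Pihat S n).
Proof. by case: hS => _ _; exact. Qed.

Let mL := measurable_estimator ok.1.
Let mPh := measurable_estimator ok.2.
Let G s (z : TD * space M) := Ghat S z.1 s z.2.
Let L s (z : TD * space M) := lhat S n z.1 s z.2.
Let mG : measurable_process G.
Proof.
apply: measurable_processB => //.
exact: measurable_process_comp measurable_snd (model_cov hM).
Qed.
Let Y := trained_integral (lhat S n) (Pihat S n).
Let v := trained_variation (Pihat S n).

Let gamma_hatE t w : gamma_hat (S := S) n t w =
  (#|J n|)%:R^-1 * \sum_(j in J n) Y t (tr w, obs S j w).
Proof. by []. Qed.

Let V_hatE w : V_hat (S := S) n 1 w = (#|J n|)%:R^-1 * \sum_(j in J n) v (tr w, obs S j w).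
Proof. by []. Qed.

Variables C C' : R.
Hypotheses (C0 : 0 <= C) (C'0 : 0 <= C').
Hypothesis hC : {ae prob M, forall w, caglad (full_intens M ^~ w) /\
  forall t, 0 <= t <= 1 -> full_intens M t w <= C}.
Hypothesis bR : {ae prob M, forall w, forall t, 0 <= t <= 1 -> `|residual M t w| <= C'}.
Hypothesis best : {ae P, forall w, forall t, 0 <= t <= 1 ->
  `|lhat_new S n t w| <= C /\ `|Ghat_new S n t w| <= C'}.

Let bGN : {ae Q, forall z, jumps_bounded (Pihat S n) C' z}.
Proof.
apply/(ae_law_of _ _ (measurable_jumps_bounded hM mPh C')).
apply: filterS best => w bw k kN /=.
have /bw[] // : 0 <= jump_time (cnt M ^~ (newobs S w)) k.+1 <= 1.
by rewrite jump_time_ge0 (jump_time_le _ ((model_counting hM).1 _))// ler01 lexx.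
Qed.

Let bcut (H : R -> TD * space M -> R) c : 0 <= c -> measurable_process H ->
  {ae P, forall w, forall t, 0 <= t <= 1 -> `|H t (tr w, newobs S w)| <= c} ->
  {ae rho, forall p, `|cut 1 H p| <= c}.
Proof.
move=> c0 mH bH.
have mS : measurable [set p : R * (TD * space M) | `|cut 1 H p| <= c].
  rewrite -[X in measurable X]setTI; apply: measurable_fun_le => //.
  by apply: measurableT_comp => //; exact: mH.
apply/(ae_product1P unit_lebesgue Q mS); apply: nearW => s.
have mSs : measurable [set z | `|cut 1 H (s, z)| <= c].
  rewrite -[X in measurable X]setTI.
  exact: (@measurable_pair1 _ _ R (TD * space M)%type s measurableT _ mS).
apply/(ae_law_of _ _ mSs).
by apply: filterS bH => w bw /=; rewrite /cut/=; case: ifPn => [/bw//|]; rewrite normr0.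
Qed.

Let bG : {ae rho, forall p, `|cut 1 G p| <= C'}.
Proof. by apply: bcut => //; apply: filterS best => w bw t /bw[]. Qed.

Let bL : {ae rho, forall p, `|cut 1 L p| <= C}.
Proof. by apply: bcut => //; apply: filterS best => w bw t /bw[]. Qed.

Let mY t : 0 <= t <= 1 -> measurable_fun [set: TD * space M] (Y t).
Proof. by move=> t01; exact: measurable_trained_integral. Qed.

Let mv : measurable_fun [set: TD * space M] v.
Proof. exact: measurable_trained_variation. Qed.

Let mpair (j : nat) : measurable_fun [set: sspace S] (fun w => (tr w, obs S j w)).
Proof. exact: (measurable_fun_pair (measurable_train (n := n) hS) (measurable_obs hS j)). Qed.

Lemma measurable_gamma_hat t : 0 <= t <= 1 ->
  measurable_fun [set: sspace S] (gamma_hat (S := S) n t).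
Proof.
move=> t01; rewrite (funext (gamma_hatE t)); under eq_fun do rewrite -big_enum/=.
apply: measurable_funM => //; apply: measurable_sum => j; exact: (measurableT_comp (mY t01) (mpair j)).
Qed.

Lemma measurable_V_hat : measurable_fun [set: sspace S] (V_hat (S := S) n 1).
Proof.
rewrite (funext V_hatE); under eq_fun do rewrite -big_enum/=.
apply: measurable_funM => //; apply: measurable_sum => j; exact: (measurableT_comp mv (mpair j)).
Qed.

(** The conditional mean of the estimate at [t] given the training data, when [J n] is nonempty. *)
Definition cond_mean t w := section_mean (prob M) (Y t) (tr w).

Lemma measurable_cond_mean t : 0 <= t <= 1 -> measurable_fun [set: sspace S] (cond_mean t).
Proof.
move=> t01; exact: (measurableT_comp (measurable_section_mean (prob M) (mY t01))
  (measurable_train (n := n) hS)).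
Qed.

Lemma gamma_hat_variance t : 0 <= t <= 1 ->
  (\int[P]_w (((#|J n|)%:R * (gamma_hat (S := S) n t w - cond_mean t w)) ^+ 2)%:E <=
   ((#|J n|)%:R * (2 * C' ^+ 2 * ((C + 2 * C ^+ 2) + C ^+ 2)))%:E)%E.
Proof.
move=> t01.
have hK := trained_integral_sqr_le hM train_new_lawE mL mPh C0 C'0 hC bGN bG bL t01.
rewrite (eq_measure_integral (mu \x prob M)%E) in hK; last by move=> A mA _; exact: train_new_lawE.
have := sum_centered_sqr_le (mY t01) hK (measurable_train (n := n) hS)
  (fun j => measurable_obs hS j) (@train_obs_indep _ _ _ _ _ S hS n)
  (@train_obs2_indep _ _ _ _ _ S hS n).
apply: le_trans; rewrite le_eqVlt; apply/orP; left; apply/eqP.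
apply: eq_integral => w _; congr (_ ^+ 2)%:E.
have [J0|J0] := eqVneq #|J n| 0%N.
  by rewrite J0 mul0r big_pred0// => j; rewrite (cards0_eq J0) inE.
rewrite mulrBr gamma_hatE mulrA mulfV ?pnatr_eq0// mul1r.
rewrite /centered [RHS]sumrB; congr (_ - _).
by transitivity (\sum_(j in J n) cond_mean t w) => //; rewrite sumr_const mulr_natl.
Qed.

(** An observation of [J n] and the new one have the same joint law with the training data, so
    moments computed for the new observation hold for each summand. *)
Let joint_integral (f : TD * space M -> \bar R) (j : 'I_n) : j \in J n ->
  measurable_fun [set: TD * space M] f -> (forall z, 0 <= f z)%E ->
  (\int[P]_w f (tr w, obs S j w) = \int[Q]_z f z)%E.
Proof.
move=> jJ mf f0.
rewrite -(ge0_integral_joint_law (measurable_train (n := n) hS) (measurable_obs hS j)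
  (fun A B => @train_obs_indep _ _ _ _ _ S hS n j A B jJ) mf f0).
by apply: eq_measure_integral => A mA _; apply/esym; exact: train_new_lawE.
Qed.

Lemma V_hat_mean : (0 < #|J n|)%N ->
  (\int[P]_w `|(V_hat (S := S) n 1 w)%:E| <= (C' ^+ 2 * C)%:E)%E.
Proof.
move=> J0; have vle := trained_variation_le hM train_new_lawE mPh C0 C'0 hC bGN.
have mav : measurable_fun [set: TD * space M] (fun z => `|(v z)%:E|%E).
  by apply: measurableT_comp => //; exact/measurable_EFinP.
pose f (j : 'I_n) : sspace S -> \bar R :=
  if j \in J n then fun w => `|(v (tr w, obs S j w))%:E|%E else cst 0%E.
have mf j : measurable_fun [set: sspace S] (f j).
  by rewrite /f; case: ifP => // _; exact: (measurableT_comp mav (mpair j)).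
have f0 j w : (0 <= f j w)%E by rewrite /f; case: ifP.
have c0 : 0 <= (#|J n|)%:R^-1 :> R by rewrite invr_ge0.
apply: (@le_trans _ _ (\int[P]_w ((#|J n|)%:R^-1%:E * \sum_(j < n) f j w))%E).
  apply: ge0_le_integral => //.
  - by apply: measurableT_comp => //; apply/measurable_EFinP; exact: measurable_V_hat.
  - by apply: emeasurable_funM => //; exact: emeasurable_sum.
  - move=> w _; rewrite V_hatE (_ : (\sum_(j < n) f j w)%E =
        (\sum_(j in J n) `|v (tr w, obs S j w)|)%:E).
      rewrite abse_EFin -EFinM lee_fin normrM ger0_norm// ler_wpM2l//.
      exact: ler_norm_sum.
    by rewrite -sumEFin [RHS]big_mkcond/=; apply: eq_bigr => j _; rewrite /f; case: ifP.
rewrite ge0_integralZl_EFin//; last 2 first.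
- by move=> w _; exact: sume_ge0.
- exact: emeasurable_sum.
rewrite ge0_integral_sum//.
apply: (@le_trans _ _ ((#|J n|)%:R^-1%:E * \sum_(j in J n) (C' ^+ 2 * C)%:E)%E).
  apply: lee_wpmul2l => //; rewrite [leRHS]big_mkcond/=; apply: lee_sum => j _.
  rewrite /f; case: ifP => jJ; last by rewrite integral0.
  by rewrite (joint_integral (f := fun z => `|(v z)%:E|%E) jJ).
by rewrite sumEFin sumr_const -EFinM -[X in _ * X]mulr_natl mulrA mulVf ?mul1r// pnatr_eq0 -lt0n.
Qed.

Let norm2E (H : R -> TD * space M -> R) : measurable_process H ->
  norm2 P (fun s w => H s (tr w, newobs S w)) =
  ((\int[rho]_p (cut 1 H p ^+ 2)%:E) `^ 2^-1)%E.
Proof.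
move=> mH; rewrite /norm2; apply: (congr1 (fun x => (x `^ 2^-1)%E)).
pose H2 s z := H s z ^+ 2; have mH2 : measurable_process H2 by exact: measurable_processX.
have mf : measurable_fun [set: R * (TD * space M)] (fun p => (cut 1 H2 p)%:E : \bar R).
  by apply/measurable_EFinP; exact: mH2.
have f0 p : (0 <= (cut 1 H2 p)%:E)%E.
  by rewrite lee_fin /cut /H2; case: ifP => // _; exact: sqr_ge0.
transitivity (\int[P]_w fubini_G unit_lebesgue (fun p => (cut 1 H2 p)%:E)
    (tr w, newobs S w))%E.
  apply: eq_integral => w _.
  exact: (integral_cut (H := H2) (tr w, newobs S w) (lexx 1) mH2).
rewrite -(ge0_integral_law_of P
  (measurable_fun_pair (measurable_train (n := n) hS) (measurable_newobs hS)))//.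
- rewrite -/Q -fubini_tonelli2//; apply: eq_integral => p _.
  by rewrite /cut /H2; case: ifP; rewrite ?expr0n.
- exact: measurable_fun_fubini_tonelli_G.
- by move=> z; exact: integral_ge0.
Qed.

Let GL s z := G s z * L s z.
Let mGL : measurable_process GL. Proof. exact: measurable_processM. Qed.

Let integrable_GL : {ae Q, forall z, (path_mass GL z < +oo)%E}.
Proof.
have iGL : rho.-integrable [set: R * (TD * space M)] (fun p => (cut 1 GL p)%:E).
  have ic : rho.-integrable [set: R * (TD * space M)] (EFin \o cst (C' * C)).
    exact: integrable_product_cst.
  apply: ae_le_integrable ic _; first exact: mGL.
  apply: filterS2 bG bL => p h1 h2; rewrite [leRHS]ger0_norm ?mulr_ge0//.
  move: h1 h2; rewrite /cut /GL.
  by case: ifP => _ h1 h2; [rewrite normrM ler_pM|rewrite normr0 mulr_ge0].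
apply: filterS (integrable_ae measurableT (integrable_path_mass iGL)) => z /(_ Logic.I).
by rewrite ge0_fin_numE// path_mass_ge0.
Qed.

Let mfin : measurable [set z | (path_mass GL z < +oo)%E].
Proof.
rewrite -[X in measurable X]setTI; apply: emeasurable_fun_infty_o => //.
apply: (measurable_fun_fubini_tonelli_G (m1 := unit_lebesgue) (fun p => `|(cut 1 GL p)%:E|%E)) => //.
by apply: measurableT_comp => //; apply/measurable_EFinP; exact: mGL.
Qed.

(** It makes almost every path of [gamma_hat] right-continuous, as the measurability of the test
    requires. *)
Lemma ae_integrable_paths : {ae P, forall w, forall j : 'I_n, j \in J n ->
  lebesgue_measure.-integrable `[0, 1] (fun s : R =>
    (Ghat_at (S := S) j s w * lhat_at (S := S) j s w)%:E)}.
Proof.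
have Q0 : {ae (mu \x prob M)%E, forall z, (path_mass GL z < +oo)%E}.
  move: integrable_GL => /(negligibleP _ (measurableC mfin)) Q0.
  apply/(negligibleP _ (measurableC mfin)); apply: etrans Q0.
  by apply/esym/train_new_lawE; exact: measurableC.
apply: filter_forall => j; have [jJ|jJ] := boolP (j \in J n); last exact: nearW.
have := (ae_joint_law (measurable_train (n := n) hS) (measurable_obs hS j)
  (fun A B => @train_obs_indep _ _ _ _ _ S hS n j A B jJ) mfin).1 Q0.
apply: filterS => w /= fin _; pose z := (tr w, obs S j w).
have mGLz : measurable_fun (`[0, 1] : set (measurableTypeR R)) (GL ^~ z).
  apply: eq_measurable_fun (measurable_funTS (measurable_section_cut z (lexx 1) mGL)).
  by move=> s; rewrite inE/= in_itv/= => s01; rewrite /cut/= s01.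
apply/integrableP; split; first exact/measurable_EFinP.
apply: le_lt_trans fin; rewrite le_eqVlt; apply/orP; left; apply/eqP.
apply: etrans (integral_cut (H := fun s z => `|GL s z|) z (lexx 1) _) _.
  exact: measurable_process_norm.
by apply: eq_integral => s _; rewrite -abs_cut.
Qed.

Let projM : predictable_projection (prob M) (filt M) (cov M) (proj M).
Proof. by case: hM. Qed.
Let mproj : measurable_process (proj M).
Proof.
case: projM => pl _.
exact: (predictable_measurable_process (model_filtration hM) pl).
Qed.
Let mintens : measurable_process (intens M).
Proof.
case: hM => _ _ _ [[pl _ _] _] _.
exact: (predictable_measurable_process (model_filtration hM) pl).
Qed.

Let U s (z : TD * space M) := proj M s z.2 - Pihat S n z.1 s z.2.
Let V s (z : TD * space M) := intens M s z.2 - L s z.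

(** The covariate cancels between the two residuals, leaving the error on the projection; the sign
    disappears in the square. *)
Let g_errE : g_err S n = ((\int[rho]_p (cut 1 U p ^+ 2)%:E) `^ 2^-1)%E.
Proof.
rewrite -norm2E; last first.
  by apply: measurable_processB => //; exact: measurable_process_comp measurable_snd mproj.
rewrite /g_err /norm2; apply: (congr1 (fun x => (x `^ 2^-1)%E)); apply: eq_integral => w _.
apply: eq_integral => s _; congr (_%:E).
by rewrite /U /residual /Ghat_new /Ghat/=; ring.
Qed.

Let h_errE : h_err S n = ((\int[rho]_p (cut 1 V p ^+ 2)%:E) `^ 2^-1)%E.
Proof.
rewrite -norm2E//.
by apply: measurable_processB => //; exact: measurable_process_comp measurable_snd mintens.
Qed.

Hypothesis hfin : (h_err S n < +oo)%E.

Let hV : (\int[rho]_p (cut 1 V p ^+ 2)%:E < +oo)%E.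
Proof.
rewrite ltNge; apply/negP; rewrite leye_eq => /eqP e.
by move: hfin; rewrite h_errE e poweRyr ?ltxx.
Qed.

Lemma cond_mean_bias t : 0 <= t <= 1 ->
  (\int[P]_w `|(cond_mean t w - fine (LCM M t))%:E| <= g_err S n * h_err S n)%E.
Proof.
move=> t01; rewrite g_errE h_errE.
pose f D := `|(section_mean (prob M) (Y t) D - fine (LCM M t))%:E|%E.
have mf : measurable_fun [set: TD] f.
  apply: measurableT_comp => //; apply/measurable_EFinP; apply: measurable_funB => //.
  by apply: measurable_section_mean; exact: mY.
have f0 D : (0 <= f D)%E by exact: abse_ge0.
rewrite -[leLHS](ge0_integral_law_of P (measurable_train (n := n) hS) mf f0).
exact: (integral_bias_le hM train_new_lawE mL mPh C0 C'0 hC bGN bG bL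
  ok.1.2 ok.2.2 bR hV t01).
Qed.

Lemma LCM_fin_num t : 0 <= t <= 1 -> LCM M t \is a fin_num.
Proof.
by move=> t01; rewrite (LCM_fin hM train_new_lawE mL C0 C'0 hC bL bR hV t01).
Qed.

End sample_bounds.

(** * Measurability of the test *)

Section right_continuous_paths.
Context {R : realType}.

Definition cadlag_at_right (f : R -> R) : Prop :=
  forall t, 0 <= t < 1 -> f u @[u --> t^'+] --> f t.

(** A right-continuous path with natural values is constant just after [t], hence so is the
    integral, whatever [h]. *)
Lemma int_dN_right_continuous (h : R -> R) n : counting_path n ->
  cadlag_at_right (fun t => int_dN h n t).
Proof.
move=> cn t /andP[t0 t1]; apply: cvg_near_cst.
have [_ _ rc _] := cn.
have /cvgrPdist_lt/(_ 1 ltr01) near1 := rc _ (introT andP (conj t0 t1)).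
near=> u.
have tu : t < u by near: u; exact: nbhs_right_gt.
have u1 : u < 1 by near: u; exact: nbhs_right_lt.
have nE : n u = n t.
  have : `|(n t)%:R - (n u)%:R| < 1 :> R by near: u.
  have natB i j : (i < j)%N -> 1 <= `|j%:R - i%:R| :> R.
    move=> ij; apply: le_trans (ler_norm _).
    by rewrite -natrB ?(ltnW ij)// ler1n subn_gt0.
  move=> lt1; apply/eqP; apply: contraTT lt1; rewrite neq_ltn -leNgt => /orP[/natB//|/natB].
  by rewrite distrC.
by rewrite !int_dNE// ?nE// ?(ltW u1) ?(ltW t1) ?t0// ?andbT (le_trans t0 (ltW tu)).
Unshelve. all: by end_near.
Qed.

Lemma int_ds_right_continuous (h : R -> R) :
  lebesgue_measure.-integrable `[0, 1] (EFin \o h) -> cadlag_at_right (int_ds h).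
Proof.
move=> ih t /andP[t0 t1].
have /(continuous_within_itvP _ ltr01)[c1 c2 _] := parameterized_integral_continuous ler01 ih.
have [t00|t00] := eqVneq t 0; first by rewrite t00; exact: c2.
apply: cvg_at_right_filter; apply: c1.
by rewrite in_itv/= t1 andbT lt_neqAle eq_sym t00.
Qed.

(** An enumeration of the rationals of [0, 1], padded with 0, so that a supremum over them is the
    supremum of a sequence. *)
Definition unit_rational (k : nat) : R :=
  if unpickle k is Some q then if 0 <= (ratr q : R) <= 1 then ratr q else 0 else 0.

Lemma unit_rational_itv k : 0 <= unit_rational k <= 1.
Proof.
by rewrite /unit_rational; case: unpickle => [q|]; [case: ifP|]; rewrite ?lexx ?ler01.
Qed.

Lemma unit_rationalP (q : rat) : 0 <= (ratr q : R) <= 1 ->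
  exists k, unit_rational k = ratr q.
Proof. by move=> q01; exists (pickle q); rewrite /unit_rational pickleK q01. Qed.

Lemma sup01_rational (f : R -> R) : cadlag_at_right f ->
  sup01 (EFin \o f) = esups (fun k => `|f (unit_rational k)|%:E) 0%N.
Proof.
move=> rc; apply/eqP; rewrite eq_le; apply/andP; split; last first.
  apply: le_ereal_sup => _ [k _ <-].
  by exists (unit_rational k) => //=; rewrite in_itv/=; exact: unit_rational_itv.
have le_rat q : 0 <= (ratr q : R) <= 1 ->
    (`|f (ratr q)|%:E <= esups (fun k => `|f (unit_rational k)|%:E) 0%N)%E.
  by move=> /unit_rationalP[k <-]; apply: ereal_sup_ubound; exists k.
apply: ge_ereal_sup => _ [t t01 <-]; rewrite /comp abse_EFin.
move: t01; rewrite /= in_itv/= => /andP[t0 t1].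
(* Right continuity says nothing at time 1, but this time is itself rational. *)
move: t1; rewrite le_eqVlt => /predU1P[->|t1].
  by have := le_rat 1%R; rewrite rmorph1; apply; rewrite ler01 lexx.
rewrite leNgt; apply/negP; set s := esups _ _ => st.
have s0 : (0 <= s)%E.
  by apply: le_trans (le_rat 0%R _); rewrite rmorph0 ?lexx ?ler01.
have [r sE] : exists r, s = r%:E.
  by case: s s0 st => // r _ _; exists r.
rewrite sE lte_fin in st.
have tt : 0 <= t < 1 by rewrite t0.
have [e /= e0 he] := cvgr_gt _ (cvg_norm (rc _ tt)) _ st.
have [q] : exists q : rat, ratr q \in `]t, (Num.min (t + e) 1)[.
  by apply: rat_in_itvoo; rewrite lt_min t1 ltrDl e0.
rewrite in_itv/= lt_min => /andP[tq /andP[qe q1]].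
have : r < `|f (ratr q)|.
  by apply: he => //=; rewrite ltr0_norm ?subr_lt0// opprB ltrBlDl.
by rewrite ltNge -lee_fin -sE le_rat// (ltW q1) (le_trans t0 (ltW tq)).
Qed.

End right_continuous_paths.

Section complete_measure.
Context {R : realType} {d : measure_display} {T : measurableType d}.
Variable mu : {measure set T -> \bar R}.

Lemma ae_measurable_set (A B : set T) : measure_is_complete mu -> measurable A ->
  {ae mu, forall w, A w <-> B w} -> measurable B.
Proof.
move=> complete mA [N [mN N0 sub]].
have -> : B = (A `\` N) `|` (B `&` N).
  apply/seteqP; split => w.
    move=> Bw; have [Nw|Nw] := pselect (N w); [by right|left; split => //].
    have [|] := pselect (A w <-> B w); first by case=> _; exact.
    by move=> h; case: Nw; exact: sub.
  case=> [[Aw Nw]|[]//].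
  have [|] := pselect (A w <-> B w); first by case=> + _; exact.
  by move=> h; case: Nw; exact: sub.
apply: measurableU; first exact: measurableD.
by apply: complete; exists N; split => // w [].
Qed.

End complete_measure.

Section measurable_test.
Context {R : realType} {d d' : measure_display} {M : obs_model R d}
  {J : forall n, {set 'I_n}}.
Variables (S : sampling d' M J) (hM : obs_model_ok M) (hS : sampling_ok S) (n : nat).
Local Notation P := (sprob S).

Hypothesis mgamma : forall t, 0 <= t <= 1 ->
  measurable_fun [set: sspace S] (gamma_hat (S := S) n t).
Hypothesis mV : measurable_fun [set: sspace S] (V_hat (S := S) n 1).
Hypothesis ipath : {ae P, forall w, forall j : 'I_n, j \in J n ->
  lebesgue_measure.-integrable `[0, 1] (fun s : R =>
    (Ghat_at (S := S) j s w * lhat_at (S := S) j s w)%:E)}.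

Let gamma_hat_right_continuous w :
  (forall j : 'I_n, j \in J n -> lebesgue_measure.-integrable `[0, 1] (fun s : R =>
    (Ghat_at (S := S) j s w * lhat_at (S := S) j s w)%:E)) ->
  cadlag_at_right (fun t => gamma_hat (S := S) n t w).
Proof.
move=> iw t t01; apply: cvgM; first exact: cvg_cst.
apply: cvg_big => [|j jJ]; first exact: add_continuous.
apply: cvgB.
  by apply: int_dN_right_continuous t01; apply: (model_counting hM).1.
exact: (int_ds_right_continuous (iw j jJ)).
Qed.

Let x (w : sspace S) : \bar R :=
  ((Num.sqrt (#|J n|)%:R)%:E *
   esups (fun k => `|gamma_hat (S := S) n (unit_rational k) w|%:E) 0%N)%E.

Let T (w : sspace S) : \bar R :=
  if V_hat (S := S) n 1 w == 0 then (if x w == 0%E then 0%E else +oo%E)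
  else (x w * ((Num.sqrt (V_hat (S := S) n 1 w))^-1)%:E)%E.

Let mT : measurable_fun [set: sspace S] T.
Proof.
have mx : measurable_fun [set: sspace S] x.
  apply: emeasurable_funM => //; apply: measurable_fun_esups => k.
  apply/measurable_EFinP; apply: measurableT_comp => //.
  exact: mgamma (unit_rational_itv k).
apply: measurable_fun_ifT; first exact: measurable_fun_eqr.
  by apply: measurable_fun_ifT => //; exact: measurable_fun_eqe.
apply: emeasurable_funM => //; apply/measurable_EFinP.
have -> : (fun w => (Num.sqrt (V_hat (S := S) n 1 w))^-1) =
    (fun w => Num.sqrt (V_hat (S := S) n 1 w) `^ -1).
  by apply/funext => w; rewrite powR_inv1// sqrtr_ge0.
apply: (measurableT_comp (measurable_powR _)).
apply: measurableT_comp mV; apply: continuous_measurable_fun.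
exact: sqrt_continuous.
Qed.

(* Almost surely the supremum over [0, 1] is one over rational times; the
   completeness of P takes care of the exceptional event. *)
Lemma measurable_LCT z : measurable [set w | LCT S n z w].
Proof.
apply: (ae_measurable_set (mu := P) (A := [set w | (z%:E < T w)%E])).
- by case: hS.
- by rewrite -[X in measurable X]setTI; exact: (emeasurable_fun_o_infty measurableT mT z%:E).
- apply: filterS ipath => w iw; rewrite /= /LCT /T_hat /T.
  by rewrite (sup01_rational (gamma_hat_right_continuous iw)).
Qed.

End measurable_test.

(** * Power of the test *)

Section tail_bounds.
Context {R : realType} {d : measure_display} {T : measurableType d}.
Variable P : probability T R.

Lemma measurable_tail (f : T -> R) (a : R) : measurable_fun [set: T] f ->
  measurable [set w | a <= `|f w|].
Proof.
move=> mf; rewrite -[X in measurable X]setTI; apply: measurable_fun_le => //.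
exact: measurableT_comp.
Qed.

Lemma tail_probability_le (f : T -> R) (a e : R) : measurable_fun [set: T] f -> 0 < a ->
  (\int[P]_w `|(f w)%:E| <= (a * e)%:E)%E -> (P [set w | a <= `|f w|]%R <= e%:E)%E.
Proof.
move=> mf a0 le_ae; have mE : measurable_fun [set: T] (EFin \o f) by exact/measurable_EFinP.
have := le_integral_abse P measurableT mE a0; rewrite setTI => /le_trans/(_ le_ae) le_aP.
have {le_aP} : (a%:E * P [set w | a <= `|f w|]%R <= (a * e)%:E)%E := le_aP.
rewrite -(fineK (fin_num_measure P _ (measurable_tail a mf))) -EFinM !lee_fin.
by rewrite ler_pM2l.
Qed.

Lemma cover3_probability_ge (A E1 E2 E3 : set T) (e : R) : measurable A ->
  measurable E1 -> measurable E2 -> measurable E3 ->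
  (P E1 <= e%:E)%E -> (P E2 <= e%:E)%E -> (P E3 <= e%:E)%E ->
  ~` A `<=` E1 `|` E2 `|` E3 -> ((1 - 3 * e)%:E <= P A)%E.
Proof.
move=> mA m1 m2 m3 le1 le2 le3 sub.
have m12 : measurable (E1 `|` E2) by exact: measurableU.
have le : (P (~` A) <= (3 * e)%:E)%E.
  apply: le_trans (le_measure P _ _ sub) _; rewrite ?inE//.
  - exact: measurableC.
  - exact: measurableU.
  apply: le_trans (measureU2 P m12 m3) _.
  rewrite (_ : 3 * e = e + e + e); last by ring.
  rewrite 2!EFinD; apply: leeD => //.
  by apply: le_trans (measureU2 P m1 m2) _; exact: leeD.
move: le; rewrite probability_setC//.
rewrite -(fineK (fin_num_measure P _ mA)) -EFinB !lee_fin; lra.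
Qed.

End tail_bounds.

Section variation_ge0.
Context {R : realType} {d d' : measure_display} {M : obs_model R d}
  {J : forall n, {set 'I_n}}.
Variables (S : sampling d' M J) (hM : obs_model_ok M) (n : nat).

Lemma V_hat_ge0 w : 0 <= V_hat (S := S) n 1 w.
Proof.
rewrite mulr_ge0 ?invr_ge0//; apply: sumr_ge0 => j _.
rewrite int_dNE//; last by rewrite ler01 lexx.
  by apply: sumr_ge0 => k _; exact: sqr_ge0.
by apply: (model_counting hM).1.
Qed.

End variation_ge0.

Section power_bound.
Context {R : realType} {d d' : measure_display} {M : obs_model R d}
  {J : forall n, {set 'I_n}}.
Variables (S : sampling d' M J) (hM : obs_model_ok M) (hS : sampling_ok S) (n : nat).
Local Notation P := (sprob S).
Variables C C' : R.
Hypotheses (C0 : 0 <= C) (C'0 : 0 <= C').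
Hypothesis hC : {ae prob M, forall w, caglad (full_intens M ^~ w) /\
  forall t, 0 <= t <= 1 -> full_intens M t w <= C}.
Hypothesis bR : {ae prob M, forall w, forall t, 0 <= t <= 1 -> `|residual M t w| <= C'}.
Hypothesis best : {ae P, forall w, forall t, 0 <= t <= 1 ->
  `|lhat_new S n t w| <= C /\ `|Ghat_new S n t w| <= C'}.
Hypothesis hfin : (h_err S n < +oo)%E.
Hypothesis J0 : (0 < #|J n|)%N.
Let s : R := Num.sqrt (#|J n|)%:R.

Variables e Kv L z t : R.
Hypotheses (Kv0 : 0 < Kv) (L0 : 0 < L) (t01 : 0 <= t <= 1).
Hypothesis leKv : C' ^+ 2 * C <= Kv * e.
Hypothesis leL : 2 * C' ^+ 2 * ((C + 2 * C ^+ 2) + C ^+ 2) <= L ^+ 2 * e.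
Hypothesis le_rate : (s%:E * g_err S n * h_err S n <= e%:E)%E.
Hypothesis signal : L + 1 + (`|z| + 1) * Num.sqrt Kv <= s * `|fine (LCM M t)|.

Let s0 : 0 < s. Proof. by rewrite sqrtr_gt0 ltr0n. Qed.
Let s2 : s ^+ 2 = (#|J n|)%:R. Proof. by rewrite sqr_sqrtr. Qed.

Let m := cond_mean (S := S) n t.
Let gam w := gamma_hat (S := S) n t w.
(* Outside of these three events, s |gam| > (|z| + 1) sqrt(Kv) and
   V_hat < Kv. *)
Let E1 := [set w | Kv <= `|V_hat (S := S) n 1 w|].
Let E2 := [set w | s ^+ 2 * L ^+ 2 <= `|(s ^+ 2 * (gam w - m w)) ^+ 2|].
Let E3 := [set w | s^-1 <= `|m w - fine (LCM M t)|].

Let mV : measurable_fun [set: sspace S] (V_hat (S := S) n 1).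
Proof. exact: measurable_V_hat. Qed.
Let mgam : measurable_fun [set: sspace S] gam.
Proof. exact: measurable_gamma_hat. Qed.
Let mm : measurable_fun [set: sspace S] m.
Proof. exact: measurable_cond_mean. Qed.

Let mE2 : measurable_fun [set: sspace S] (fun w => (s ^+ 2 * (gam w - m w)) ^+ 2).
Proof. by apply: measurable_funX; apply: measurable_funM => //; exact: measurable_funB. Qed.

Let mE3 : measurable_fun [set: sspace S] (fun w => m w - fine (LCM M t)).
Proof. exact: measurable_funB. Qed.

Let PE1 : (P E1 <= e%:E)%E.
Proof.
apply: tail_probability_le => //.
by apply: le_trans (V_hat_mean hM hS C0 C'0 hC best J0) _; rewrite lee_fin.
Qed.

Let PE2 : (P E2 <= e%:E)%E.
Proof.
apply: tail_probability_le => //; first by rewrite mulr_gt0// exprn_gt0.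
under eq_integral do rewrite gee0_abs ?lee_fin ?sqr_ge0//.
rewrite s2; apply: le_trans (gamma_hat_variance hM hS C0 C'0 hC best t01) _.
by rewrite lee_fin -[leRHS]mulrA ler_wpM2l.
Qed.

Let PE3 : (P E3 <= e%:E)%E.
Proof.
apply: tail_probability_le => //; first by rewrite invr_gt0.
apply: le_trans (cond_mean_bias hM hS C0 C'0 hC bR best hfin t01) _.
move: le_rate; rewrite -muleA => le_rate'.
rewrite EFinM lee_pdivlMl//.
Qed.

Lemma LCT_power : ((1 - 3 * e)%:E <= P [set w | LCT S n z w])%E.
Proof.
have mL : measurable [set w | LCT S n z w].
  apply: measurable_LCT => //; first by move=> u u01; exact: measurable_gamma_hat.
  exact: (ae_integrable_paths hM hS C0 C'0 best).
apply: (@cover3_probability_ge _ _ _ P _ E1 E2 E3 e) => //; [exact: measurable_tail..|].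
move=> w /=; apply: contra_notP => /not_orP[/not_orP[]].
rewrite /E1 /E2 /E3 /= => /negP + /negP + /negP; rewrite -!ltNge => V1 V2 V3.
have V0 := V_hat_ge0 hM n w (S := S).
rewrite ger0_norm// in V1.
(* The event [E2] bounds a square of order [s ^+ 4]; cancelling [s ^+ 2] and taking the root brings
   back the scale of the statistic. *)
have {}V2 : s * `|gam w - m w| < L.
  rewrite normrX normrM normrX (ger0_norm (ltW s0)) in V2.
  rewrite -(ltr_pM2l s0) mulrA -expr2 -(@ltr_pXn2r _ 2)// ?nnegrE ?mulr_ge0 ?exprn_ge0 ?(ltW s0) ?(ltW L0)//.
  by rewrite [ltRHS]exprMn.
have {}V3 : s * `|m w - fine (LCM M t)| < 1 by rewrite -ltr_pdivlMl// mulr1.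
have big : (`|z| + 1) * Num.sqrt Kv < s * `|gam w|.
  have : `|fine (LCM M t)| <= `|gam w| + `|gam w - m w| + `|m w - fine (LCM M t)|.
    rewrite [in leLHS](_ : fine (LCM M t) = gam w - (gam w - m w) - (m w - fine (LCM M t))); last by ring.
    by apply: le_trans (ler_normB _ _) _; rewrite lerD2r; exact: ler_normB.
  by rewrite -(ler_pM2l s0) !mulrDr; move: signal V2 V3; lra.
set x := (s%:E * sup01 (fun t => (gamma_hat (S := S) n t w)%:E))%E.
have xbig : (((`|z| + 1) * Num.sqrt Kv)%:E < x)%E.
  apply: lt_le_trans (_ : (s * `|gam w|)%:E <= _)%E; first by rewrite lte_fin.
  rewrite EFinM; apply: lee_wpmul2l; first by rewrite lee_fin ltW.
  by apply: ereal_sup_ubound; exists t => //=; rewrite in_itv.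
have c0 : 0 < (`|z| + 1) * Num.sqrt Kv by rewrite mulr_gt0 ?sqrtr_gt0// ltr_wpDl.
have x0 : (0 < x)%E by apply: lt_trans xbig; rewrite lte_fin.
(* When the variance estimate vanishes, the convention gives [+oo], as [x] is positive. *)
rewrite /LCT /T_hat -/s -/x; case: ifPn => [_|Vn0].
  by rewrite gt_eqF// ltry.
have Vp : 0 < V_hat (S := S) n 1 w by rewrite lt_neqAle eq_sym Vn0.
apply: lt_le_trans (_ : ((`|z| + 1) * Num.sqrt Kv / Num.sqrt (V_hat (S := S) n 1 w))%:E <= _)%E.
  rewrite lte_fin ltr_pdivlMr ?sqrtr_gt0//.
  apply: le_lt_trans (_ : `|z| * Num.sqrt (V_hat (S := S) n 1 w) < _).
    by rewrite ler_wpM2r ?sqrtr_ge0// ler_norm.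
  apply: (@le_lt_trans _ _ (`|z| * Num.sqrt Kv)).
    by rewrite ler_wpM2l// ler_wsqrtr// ltW.
  by rewrite ltr_pM2r ?sqrtr_gt0// ltrDl.
by rewrite EFinM; apply: lee_wpmul2r; [rewrite lee_fin invr_ge0 sqrtr_ge0|exact: ltW].
Qed.

End power_bound.

Unset Implicit Arguments.

Theorem theorem5p2 (R : realType) (Theta : Type) (d d' dB : measure_display)
  (M : Theta -> obs_model R d)
  (J : forall n : nat, {set 'I_n})
  (S : forall theta : Theta, sampling d' (M theta) J)
  (TB : measurableType dB) (PB : probability TB R) (B : R -> TB -> R)
  (hB : standard_brownian PB B)
  (hM : forall theta, obs_model_ok (M theta))
  (hS : forall theta, sampling_ok (S theta))
  (boundedness : exists C C' : R, [/\ 0 < C, 0 < C' & forall theta,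
     [/\ {ae prob (M theta), forall w, caglad (full_intens (M theta) ^~ w) /\
            forall t, 0 <= t <= 1 -> full_intens (M theta) t w <= C},
         {ae prob (M theta), forall w, caglad (residual (M theta) ^~ w) /\
            forall t, 0 <= t <= 1 -> `|residual (M theta) t w| <= C'} &
         forall n, {ae sprob (S theta), forall w, forall t, 0 <= t <= 1 ->
            `|lhat_new (S theta) n t w| <= C /\
            `|Ghat_new (S theta) n t w| <= C'}]])
  (rate_J : (fun n => #|J n|) @ \oo --> \oo)
  (rates : (fun n => ereal_sup
      [set Order.max (Order.max (g_err (S theta) n) (h_err (S theta) n))
             ((Num.sqrt (#|J n|)%:R)%:E * g_err (S theta) n * h_err (S theta) n)%E
      | theta in [set: Theta]]) @ \oo --> 0%E)
  (alpha beta : R) (halpha : 0 < alpha) (hab : alpha < beta) (hbeta : beta < 1) :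
  let z := brownian_sup_quantile PB B (1 - alpha) in
  let A (c : R) (n : nat) : set Theta :=
    [set theta |
       ((c / Num.sqrt (#|J n|)%:R)%:E <= sup01 (LCM (M theta)))%E] in
  exists2 c : R, 0 < c &
    (beta%:E <= limn_einf (fun n => ereal_inf
       (1%E |` [set sprob (S theta) [set w | LCT (S theta) n z w]
               | theta in A c n])))%E.
Proof.
move=> z A; have [C [C' [C0 C'0 bd]]] := boundedness.
(* The allowed failure probability is shared equally among three exceptional events. *)
pose e := (1 - beta) / 3.
have e0 : 0 < e by rewrite divr_gt0// subr_gt0.
(* [Kv] is the level at which Markov's inequality gives [e] for the variance estimate; [K] bounds
   the second moment of one summand of [gamma_hat]. *)
pose Kv := C' ^+ 2 * C / e; pose K := 2 * C' ^+ 2 * ((C + 2 * C ^+ 2) + C ^+ 2).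
have Kv0 : 0 < Kv by rewrite divr_gt0// mulr_gt0// exprn_gt0.
have K0 : 0 <= K by rewrite !mulr_ge0 ?addr_ge0 ?mulr_ge0 ?sqr_ge0// ltW.
(* Chebyshev's inequality asks for [L ^+ 2 >= K / e]; since [L >= 1], this follows from
   [L >= K / e], without a square root. *)
pose L := K / e + 1.
have L1 : 1 <= L by rewrite lerDr divr_ge0// ltW.
have leL : K <= L ^+ 2 * e.
  rewrite -ler_pdivrMr//; apply: le_trans (_ : L <= _); first by rewrite lerDl.
  by rewrite expr2 ler_peMl// (le_trans ler01).
(* [L] pays for the fluctuation around the conditional mean, 1 for the conditional bias, and the
   last term for the critical value, where [|z| + 1] keeps the threshold positive and the inequality
   strict. *)
pose c := L + 1 + (`|z| + 1) * Num.sqrt Kv.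
have L0 : 0 < L by exact: lt_le_trans ltr01 L1.
have zK0 : 0 <= (`|z| + 1) * Num.sqrt Kv by rewrite mulr_ge0 ?sqrtr_ge0 ?addr_ge0.
have c0 : 0 < c by rewrite /c; lra.
(* The margin 1 makes the supremum exceed [c / sqrt |J n|] strictly, so that some time [t] does
   too. *)
exists (c + 1); first by rewrite addr_gt0.
apply: limn_einf_ge.
have /cvgnyPgt/(_ 0%N) Jgt := rate_J.
(* The bound 1 serves to make [h_err] finite, the bound [e] to control the scaled product of the
   errors. *)
have d0 : 0 < Num.min 1 e by rewrite lt_min ltr01.
have near0 : \forall x \near (0%E : \bar R), (x < (Num.min 1 e)%:E)%E.
  apply: open_nbhs_nbhs; split; last by rewrite /= lte_fin.
  exact: open_ereal_lt_ereal.
have rate_lt := rates _ near0.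
near=> n.
have J0 : (0 < #|J n|)%N by near: n.
have rn : (ereal_sup
      [set Order.max (Order.max (g_err (S theta) n) (h_err (S theta) n))
             ((Num.sqrt (#|J n|)%:R)%:E * g_err (S theta) n * h_err (S theta) n)%E
      | theta in [set: Theta]] < (Num.min 1 e)%:E)%E by near: n.
apply: le_ereal_inf_tmp => _ [->|[theta Atheta <-]]; first by rewrite lee_fin ltW.
have := le_lt_trans (ereal_sup_ubound (imageT _ theta)) rn.
rewrite !gt_max => /andP[/andP[_ h1] gh].
have s0 : 0 < Num.sqrt (#|J n|)%:R :> R by rewrite sqrtr_gt0 ltr0n.
have hfin : (h_err (S theta) n < +oo)%E by apply: lt_trans h1 _; exact: ltry.
have [bC bR best] := bd theta.
have {}bR : {ae prob (M theta), forall w, forall t, 0 <= t <= 1 -> `|residual (M theta) t w| <= C'}.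
  by apply: filterS bR => w [].
have : ((c / Num.sqrt (#|J n|)%:R)%:E < sup01 (LCM (M theta)))%E.
  apply: lt_le_trans Atheta; rewrite lte_fin ltr_pM2r ?invr_gt0// ltrDl.
  by [].
move=> /ereal_sup_gt[_ [t /= t01 <-]]; rewrite in_itv/= in t01.
have fin := LCM_fin_num (hM theta) (hS theta) (ltW C0) (ltW C'0) bC bR (best n) hfin t01.
rewrite -(fineK fin) abse_EFin lte_fin ltr_pdivrMr// mulrC => signal.
rewrite (_ : beta = 1 - 3 * e); last by rewrite /e; field.
have leKv : C' ^+ 2 * C <= Kv * e by rewrite divfK// gt_eqF.
have le_rate : ((Num.sqrt (#|J n|)%:R)%:E * g_err (S theta) n * h_err (S theta) n <= e%:E)%E.
  by apply: le_trans (ltW gh) _; rewrite lee_fin ge_min lexx orbT.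
exact: (LCT_power (hM theta) (hS theta) (ltW C0) (ltW C'0) bC bR (best n) hfin J0 Kv0
  L0 t01 leKv leL le_rate (ltW signal)).
Unshelve. all: by end_near.
Qed.
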